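(* Let $p,q\ge1$ and assume \[ \alpha_1<\dots<\alpha_p<\alpha_1+1,\qquad\beta_1<\dots<\beta_q<\beta_1+1,\qquad\alpha_1+\beta_1+1>0 . \] Then the deformed Pi\~neiro moment matrix $\mathscr M^{\mathrm P}(t)$ with entries \[ \mathscr M^{\mathrm P}_{r,s}(t)=\int_0^1x^{x_r+y_s-1}\mathrm e^{tx}\,\mathrm dx=\frac1{x_r+y_s}\,{}_1F_1(x_r+y_s;x_r+y_s+1;t) \] is totally positive (all finite minors are strictly positive) for every real $t$. All moment factorizations and normalized Christoffel connections in its finite rectangle therefore exist and remain positive for every real $t$; these assertions hold for arbitrary $p,q$. If, in addition, $\gcd(p,q)=1$, then for each $a\in\mathcal A_{\mathrm{cyc}}$ the selected star refactorizations give a global positive coefficientwise solution $c_h^{(a)}(t)>0$ ($h\ge p$, $t\in\mathbb R$) of the first scalar flow \[ \frac{\partial\mathcal L}{\partial t}=\bigl[(\mathcal L^{M})_+,\mathcal L\bigr],\qquad\mathcal L=\mathcal S^q+c^{(a)}(t)\mathcal S^{-p}, \] and the cyclic products of the refactorized factors satisfy $\partial_t\widetilde T_{(a;r)}=[(\widetilde T_{(a;r)})_+,\widetilde T_{(a;r)}]$, $r\in\{1,\dots,M\}$. More generally, replacing $\mathrm e^{tx}$ by $\exp(\sum_{\ell=1}^Lt_\ell x^\ell)$, with finitely many real times, gives, in the coprime case, global positive coefficientwise solutions of the corresponding commuting scalar flows $\partial_{t_\ell}\mathcal L=[(\mathcal L^{M\ell})_+,\mathcal L]$. When $\gcd(p,q)=1$,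 every coefficient $c_h^{(a)}(t)$ of the first-time deformation can be obtained by finitely many determinants and rational operations from the Kummer entries $\mathscr M^{\mathrm P}_{r,s}(t)$. The initial coefficients $c_h^{(a)}(0)$ are those of the selected minimum-height refactorizations of the Pi\~neiro positive bidiagonal factorization. For $p=3$, $q=2$, $(\alpha_1,\alpha_2,\alpha_3)=(-\tfrac13,0,\tfrac13)$, $(\beta_1,\beta_2)=(0,\tfrac13)$, they are rational.
   Context: $M=p+q$. For $r=qu+j$, $0\le j<q$, put $x_r=u+\beta_{j+1}$; for $s=pv+i$, $0\le i<p$, put $y_s=v+\alpha_{i+1}+1$. $\mathscr M^{\mathrm P}(t)$ is the scalar step-line moment matrix, $\mathscr M_{qu+j,pv+i}=\int x^{u+v}\mathrm d\Psi_{j,i}$, of the deformed Pi\~neiro matrix of measures with $(j,i)$ entry $x^{\alpha_{i+1}+\beta_{j+1}}\mathrm e^{tx}\,\mathrm dx$ on $(0,1)$. Bidiagonal conventions: a lower bidiagonal $L$ is normalized if $L_{n,n}=1$, an upper bidiagonal $U$ is normalized if $U_{n,n+1}=1$; positive means that the remaining entries are all $>0$. Finite rectangle: $\mathsf K_r(x)$ is the $r\times r$ matrix with $1$'s on the first superdiagonal, $x$ in the lower left corner, zeros elsewhere. The vertices are $\mathrm d\Psi_{(b,a)}=\mathsf K_q^b\,\mathrm d\Psi\,(\mathsf K_p^a)^{\mathsf T}$, $0\le b\le q$, $0\le a\le p$, with moment matrix $[\mathscr M_{r+b,s+a}]_{r,s\ge0}$. The moment (Gauss--Borel) factorization at a vertex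 is (moment matrix) $=\mathscr L^{-1}\mathscr U^{-1}$ with $\mathscr L$ unit lower triangular and $\mathscr U$ upper triangular, and the arrays are $\boldsymbol B=\mathscr L\boldsymbol\chi_{[q]}$, $\boldsymbol A=\boldsymbol\chi_{[p]}^{\mathsf T}\mathscr U$ ($\boldsymbol\chi_{[r]}(x)$ stacks $I_r,xI_r,x^2I_r,\dots$). The normalized Christoffel connections are the normalized lower bidiagonal $L$ with $L\boldsymbol B_{(b,a+1)}=\boldsymbol B_{(b,a)}$, $\boldsymbol A_{(b,a)}L=\mathsf K_p^{\mathsf T}\boldsymbol A_{(b,a+1)}$, and the normalized upper bidiagonal $U$ with $U\boldsymbol B_{(b-1,a)}=\boldsymbol B_{(b,a)}\mathsf K_q$, $\boldsymbol A_{(b,a)}U=\boldsymbol A_{(b-1,a)}$. The connections $L_1,\dots,L_p$ along $(0,0)\to(0,1)\to\dots\to(0,p)$ and $U_1,\dots,U_q$ along $(0,0)\to(1,0)\to\dots\to(q,0)$ give the (time-dependent) Pi\~neiro positive bidiagonal factorization $L_1\cdots L_pU_q\cdots U_1$ of the recurrence matrix at $(0,0)$. Selected star refactorizations (for $\gcd(p,q)=1$): put $F_k=L_k$ ($1\le k\le p$), $F_{p+b}=U_{q-b+1}$ ($1\le b\le q$); $\mathcal A_{\mathrm{cyc}}=\{a_-,\dots,a_+\}$, $a_-=p-\lceil p/q\rceil+1$, $a_+=p+1+\min\{q-1,\lceil q/p\rceil\}$. Let $r_k$ be the remainder of $kq$ mod $M$ and $\sigma_{\mathrm{min}}$ the word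 of length $M$ whose $(k+1)$-st letter is $L$ if $r_k<p$ and $U$ otherwise. For $a\in\mathcal A_{\mathrm{cyc}}$, finitely many replacements of a neighbouring pair $U,L$ (upper before lower) by the unique normalized positive pair $\widetilde L,\widetilde U$ with $UL=\widetilde L\widetilde U$ transform $(F_a,\dots,F_M,F_1,\dots,F_{a-1})$ into normalized positive factors $(\widetilde F^{(a)}_1,\dots,\widetilde F^{(a)}_M)$ with type word $\sigma_{\mathrm{min}}$ (minimum-height refactorization, independent of choices); $\widetilde T_{(a;r)}=\widetilde F^{(a)}_r\cdots\widetilde F^{(a)}_M\widetilde F^{(a)}_1\cdots\widetilde F^{(a)}_{r-1}$. Writing $h=Mn+r_{j-1}$ with $n\in\mathbb N_0$, $1\le j\le M$, put $c_h^{(a)}=(\widetilde F_j^{(a)})_{n,n-1}$ if $\widetilde F_j^{(a)}$ is lower and $n\ge1$, $c^{(a)}_h=(\widetilde F_j^{(a)})_{n,n}$ if it is upper; this defines $c_h^{(a)}$ for $h\ge p$, and $c_h^{(a)}=0$ for $h<p$. $\mathcal S$ is the forward shift, $\mathcal S^jc=c_{\,\cdot+j}\mathcal S^j$; for difference operators $X_+$ is the part with nonnegative powers of $\mathcal S$; for matrices $X_+$ is the upper triangular part including the diagonal. A global positive coefficientwise solution means that each coefficient $c_h(t)$, $h\ge p$, is defined and positive for all real times and the flow equations hold coefficient by coefficient. *)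

(* Defs.v *)
From HB Require Import structures.
From Stdlib Require Import Relations.
From mathcomp Require Import all_boot all_order all_algebra.
From mathcomp Require Import all_classical all_reals all_analysis.

Set Implicit Arguments.
Unset Strict Implicit.
Unset Printing Implicit Defensive.

Import Order.TTheory GRing.Theory Num.Theory.
Import numFieldNormedType.Exports.

Local Open Scope classical_set_scope.
Local Open Scope ring_scope.

(** Sums over N are finite-support sums (0 on infinite support); every product
    formed below has a row-finite left or a column-finite right factor. *)
Section SemiInfinite.
Variable R : realType.

Definition imx := nat -> nat -> R.

Definition imx1 : imx := fun i j => (i == j)%:R.

Definition imul (X Y : imx) : imx :=
  fun i j => \sum_(k \in [set: nat]) X i k * Y k j.

Definition iprod (s : seq imx) : imx := foldr imul imx1 s.

Definition icomm (X Y : imx) : imx := fun i j => imul X Y i j - imul Y X i j.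

Definition iupper (X : imx) : imx := fun i j => if (i <= j)%N then X i j else 0.

Definition lower_triangular (X : imx) := forall i j, (i < j)%N -> X i j = 0.
Definition upper_triangular (X : imx) := forall i j, (j < i)%N -> X i j = 0.

Definition totally_positive (X : imx) :=
  forall n (rows cols : 'I_n -> nat),
    {homo rows : i j / (i < j)%N} -> {homo cols : i j / (i < j)%N} ->
    0 < \det (\matrix_(i < n, j < n) X (rows i) (cols j)).

Definition normalized_lower (X : imx) :=
  (forall n, X n n = 1) /\
  (forall i j, i != j -> i != j.+1 -> X i j = 0).

Definition normalized_upper (X : imx) :=
  (forall n, X n n.+1 = 1) /\
  (forall i j, j != i -> j != i.+1 -> X i j = 0).

Definition normalized_pos_lower (X : imx) :=
  normalized_lower X /\ forall n, 0 < X n.+1 n.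

Definition normalized_pos_upper (X : imx) :=
  normalized_upper X /\ forall n, 0 < X n n.

(** Gauss--Borel data: [gbL], [gbU] are the matrices written with script L and
    script U, [gbLi] and [gbUi] their (triangular) inverses. *)
Record gb_data := GBData { gbL : imx; gbU : imx; gbLi : imx; gbUi : imx }.

Record gauss_borel (M : imx) (D : gb_data) : Prop := GaussBorel {
  gb_lower : lower_triangular (gbL D);
  gb_unit : forall n, gbL D n n = 1;
  gb_upper : upper_triangular (gbU D);
  gb_lower_inv : lower_triangular (gbLi D);
  gb_upper_inv : upper_triangular (gbUi D);
  gb_LLi : imul (gbL D) (gbLi D) =2 imx1;
  gb_LiL : imul (gbLi D) (gbL D) =2 imx1;
  gb_UUi : imul (gbU D) (gbUi D) =2 imx1;
  gb_UiU : imul (gbUi D) (gbU D) =2 imx1;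
  gb_fact : M =2 imul (gbLi D) (gbUi D) }.

(** A factorization is positive when its two triangular factors have positive
    entries in their whole triangles, the pivots [gbUi D n n] included. *)
Definition gb_positive (D : gb_data) :=
  (forall r s, (s <= r)%N -> 0 < gbLi D r s) /\
  (forall r s, (r <= s)%N -> 0 < gbUi D r s).

(** Polynomial arrays: an (infinity x q) array is given by its rows in
    ['rV_q], a (p x infinity) array by its columns in ['cV_p]. *)
Definition lcomb m n (a : nat -> R) (V : nat -> 'M[{poly R}]_(m, n)) :
    'M[{poly R}]_(m, n) :=
  \sum_(k \in [set: nat]) (a k)%:P *: V k.

Definition chi r (k : nat) : 'rV[{poly R}]_r :=
  \row_(j < r) ('X^(k %/ r) *+ (k %% r == j)%N).

Definition arrayB q (D : gb_data) (r : nat) : 'rV[{poly R}]_q :=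
  lcomb (gbL D r) (chi q).

Definition arrayA p (D : gb_data) (s : nat) : 'cV[{poly R}]_p :=
  lcomb (gbU D ^~ s) (fun k => (chi p k)^T).

Definition Kmx r : 'M[{poly R}]_r :=
  \matrix_(i < r, j < r)
    (if j == i.+1 :> nat then 1
     else if (i.+1 == r) && (j == 0 :> nat) then 'X else 0).

Definition Kmx_at r (x : R) : 'M[R]_r := map_mx (fun f => f.[x]) (Kmx r).

End SemiInfinite.

(** A matrix of measures on (0,1) is represented by its Lebesgue density. *)
Section Moments.
Variable R : realType.
Variables p q : nat.
Variables (alpha : p.-tuple R) (beta : q.-tuple R).

Definition mx_entry (A : 'M[R]_(q, p)) (j i : nat) : R :=
  if (insub j, insub i) is (Some j', Some i') then A j' i' else 0.

Definition moment_matrix (Phi : R -> 'M[R]_(q, p)) : imx R := fun r s =>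
  \int[lebesgue_measure]_(x in `]0, 1[)
     (x ^+ (r %/ q + s %/ p) * mx_entry (Phi x) (r %% q) (s %% p)).

(** [w] is the deformation factor; [alpha`_i] is alpha_{i+1}, [beta`_j] is
    beta_{j+1}. *)
Definition pineiro_density (w : R -> R) (x : R) : 'M[R]_(q, p) :=
  \matrix_(j < q, i < p) (x `^ (alpha`_i + beta`_j) * w x).

Definition vertex_density (w : R -> R) (b a : nat) (x : R) : 'M[R]_(q, p) :=
  Kmx_at q x ^+ b *m pineiro_density w x *m (Kmx_at p x ^+ a)^T.

Definition pineiro_moment (w : R -> R) : imx R :=
  moment_matrix (pineiro_density w).

Definition vertex_moment (w : R -> R) (b a : nat) : imx R :=
  moment_matrix (vertex_density w b a).

Definition xnode (r : nat) : R := (r %/ q)%:R + beta`_(r %% q).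
Definition ynode (s : nat) : R := (s %/ p)%:R + alpha`_(s %% p) + 1.

(** Connection along (b,a) -> (b,a+1). *)
Definition christoffel_lower (w : R -> R) (b a : nat) (X : imx R) :=
  normalized_lower X /\
  exists D D', [/\ gauss_borel (vertex_moment w b a) D,
    gauss_borel (vertex_moment w b a.+1) D',
    forall r, lcomb (X r) (arrayB q D') = arrayB q D r &
    forall s, lcomb (X ^~ s) (arrayA p D) = (Kmx R p)^T *m arrayA p D' s].

(** Connection along (b,a) -> (b+1,a). *)
Definition christoffel_upper (w : R -> R) (b a : nat) (X : imx R) :=
  normalized_upper X /\
  exists D D', [/\ gauss_borel (vertex_moment w b a) D,
    gauss_borel (vertex_moment w b.+1 a) D',
    forall r, lcomb (X r) (arrayB q D) = arrayB q D' r *m Kmx R q &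
    forall s, lcomb (X ^~ s) (arrayA p D') = arrayA p D s].

End Moments.

Definition kummer (R : realType) (a b t : R) : R :=
  limn (series (fun n : nat =>
    (\prod_(k < n) (a + k%:R)) / (\prod_(k < n) (b + k%:R)) * t ^+ n / n`!%:R)).

Section Star.
Variable R : realType.

Inductive bidiag_factor := Lower of imx R | Upper of imx R.

Definition is_lower (f : bidiag_factor) : bool := if f is Lower _ then true else false.

Definition factor_mx (f : bidiag_factor) : imx R :=
  match f with Lower X => X | Upper X => X end.

Definition normalized_pos_factor (f : bidiag_factor) : Prop :=
  match f with
  | Lower X => normalized_pos_lower X
  | Upper X => normalized_pos_upper X
  end.

Definition star_step (s s' : seq bidiag_factor) : Prop :=
  exists s1 s2 (U L L' U' : imx R),
    [/\ s = s1 ++ [:: Upper U; Lower L] ++ s2,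
        s' = s1 ++ [:: Lower L'; Upper U'] ++ s2,
        normalized_pos_lower L', normalized_pos_upper U' &
        imul U L =2 imul L' U'].

(** Any finite number of replacements, none included. *)
Definition star_refactor : seq bidiag_factor -> seq bidiag_factor -> Prop :=
  clos_refl_trans (seq bidiag_factor) star_step.

Variables p q : nat.

Definition step_rem (k : nat) : nat := ((k * q) %% (p + q))%N.

(** [true] stands for the letter L, [false] for the letter U. *)
Definition sigma_min : seq bool := [seq (step_rem k < p)%N | k <- iota 0 (p + q)].

Definition ceil_div (m n : nat) : nat := ((m + n.-1) %/ n)%N.

Definition cyc_range (a : nat) : bool :=
  (p - ceil_div p q + 1 <= a <= p + 1 + minn (q - 1) (ceil_div q p))%N.

Variables (alpha : p.-tuple R) (beta : q.-tuple R).

(** The list L_1, ..., L_p, U_q, ..., U_1; [L a] is L_{a+1}, [U b] is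
    U_{b+1}. *)
Definition pineiro_factors (w : R -> R) (F : seq bidiag_factor) : Prop :=
  exists L U : nat -> imx R,
    [/\ forall a, (a < p)%N -> christoffel_lower alpha beta w 0 a (L a),
        forall b, (b < q)%N -> christoffel_upper alpha beta w b 0 (U b) &
        F = [seq Lower (L a) | a <- iota 0 p] ++
            [seq Upper (U b) | b <- rev (iota 0 q)]].

Definition selected_factors (w : R -> R) (a : nat) (F : seq bidiag_factor) : Prop :=
  exists F0, [/\ pineiro_factors w F0, star_refactor (rot a.-1 F0) F &
                 [seq is_lower f | f <- F] = sigma_min].

(** [cyclic_product F r] is F_r ... F_M F_1 ... F_{r-1} (1-based). *)
Definition cyclic_product (F : seq bidiag_factor) (r : nat) : imx R :=
  iprod [seq factor_mx f | f <- rot r.-1 F].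

(** For h = M n + r_k the coefficient is read off the factor of 0-based
    position k; k is well defined when p and q are coprime.  If that factor is
    lower and p <= h, then 0 < n, so [n.-1] is genuine. *)
Definition scalar_coef (F : seq bidiag_factor) (h : nat) : R :=
  let n := (h %/ (p + q))%N in
  let k := index (h %% (p + q))%N [seq step_rem k | k <- iota 0 (p + q)] in
  if (h < p)%N then 0 else
  match nth (Lower (imx1 R)) F k with
  | Lower X => X n n.-1
  | Upper X => X n n
  end.

End Star.

(** [X j h] is the coefficient of S^j at the site h, i.e. X stands for
    sum_j X_j S^j with (X_j)_h = [X j h].  Sites range over Z. *)
Section DiffOp.
Variable R : realType.

Definition diffop := int -> int -> R.

Definition dop1 : diffop := fun j _ => (j == 0)%:R.

Definition dop_mul (X Y : diffop) : diffop := fun k h =>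
  \sum_(i \in [set: int]) X i h * Y (k - i) (h + i).

Definition dop_pow (X : diffop) (n : nat) : diffop := iter n (dop_mul X) dop1.

Definition dop_plus (X : diffop) : diffop := fun j h => if 0 <= j then X j h else 0.

Definition dop_comm (X Y : diffop) : diffop := fun j h =>
  dop_mul X Y j h - dop_mul Y X j h.

(** S^q + c S^{-p}; c is extended by 0 to negative sites, in accordance with
    c_h = 0 for h < p. *)
Definition scalar_lax (p q : nat) (c : nat -> R) : diffop := fun j h =>
  (j == q%:Z)%:R + (if j == - p%:Z then (if h is Posz n then c n else 0) else 0).

Definition scalar_flow (p q l : nat) (c : nat -> R) : diffop :=
  dop_comm (dop_plus (dop_pow (scalar_lax p q c) ((p + q) * l)))
           (scalar_lax p q c).

End DiffOp.

Section Times.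
Variable R : realType.

Definition first_time (t : R) : R -> R := fun x => expR (t * x).

(** [t l] is the time t_{l+1}. *)
Definition multi_time L (t : 'I_L -> R) : R -> R :=
  fun x => expR (\sum_(l < L) t l * x ^+ l.+1).

Definition set_time L (t : 'I_L -> R) (l : 'I_L) (s : R) : 'I_L -> R :=
  fun m => if m == l then s else t m.

Definition is_partial L (l : 'I_L) (f : ('I_L -> R) -> R) (t : 'I_L -> R) (v : R) :=
  is_derive (t l) (1 : R) (fun s : R => f (set_time t l s)) v.

End Times.

(** Functions obtained from the entries of a parameter-dependent matrix by
    finitely many determinants and rational operations, uniformly in the
    parameter. *)
Inductive det_rational (R : realType) (T : Type) (X : T -> imx R) :
    (T -> R) -> Prop :=
| DR_entry r s : det_rational X (fun t => X t r s)
| DR_add f g : det_rational X f -> det_rational X g ->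
    det_rational X (fun t => f t + g t)
| DR_sub f g : det_rational X f -> det_rational X g ->
    det_rational X (fun t => f t - g t)
| DR_mul f g : det_rational X f -> det_rational X g ->
    det_rational X (fun t => f t * g t)
| DR_div f g : det_rational X f -> det_rational X g ->
    (forall t, g t != 0) -> det_rational X (fun t => f t / g t)
| DR_det n (f : 'I_n -> 'I_n -> T -> R) :
    (forall i j, det_rational X (f i j)) ->
    det_rational X (fun t => \det (\matrix_(i < n, j < n) f i j t)).

(* Main.v *)
Require Import Defs.
From Stdlib Require Import Relations.
From mathcomp Require Import all_boot all_order all_algebra.
From mathcomp Require Import all_classical all_reals all_analysis.
From mathcomp Require Import perm measurable_realfun ring lra zify.

Set Implicit Arguments.
Unset Strict Implicit.
Unset Printing Implicit Defensive.

Import Order.TTheory GRing.Theory Num.Theory.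
Import numFieldNormedType.Exports.

Local Open Scope classical_set_scope.
Local Open Scope ring_scope.


(** The deformed moments are integrals of [x ^ (x_r + y_s - 1) * w x] over the
    unit interval with increasing nodes [x_r], [y_s] and a positive continuous
    weight [w]. Total positivity ([pineiro_tp]) follows by induction on the size
    of the minor: [n] times a determinant of integrals of [f_i * g_j] is the
    integral of a bordered form, whose value at a point is a positive multiple
    of a determinant of size [n - 1] of the same kind, for the systems reduced at
    this point ([det_umean_gt0]). What the induction needs is the sign of the
    collocation determinants of real powers. These do not vanish, because
    exponential sums have few zeros, and so do not change sign when the
    exponents are moved ([gvand_same_sign]).

    Total positivity makes all leading minors positive, at every vertex of the
    finite rectangle, so Cramer's rule gives the Gauss--Borel factors. A quotient
    of lower factors at neighbouring vertices is also a product of upper factors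
    with one shift in between; hence the connections are bidiagonal, and their
    coefficients are quotients of pivots ([lower_connection],
    [upper_connection]).

    The derivative in the [l]-th time multiplies the weight by [x ^ l], that is,
    it shifts the rows of the moment matrix by [q * l]. Therefore the logarithmic derivative of a
    pivot is a diagonal entry of the shift conjugated by the lower factor
    ([der_pivot]), and this is a diagonal entry of the [l]-th power of the cyclic
    product of the connections at that vertex ([cyc_init_diag]). Quotients of
    pivots thus satisfy the Lax equations of the factors ([init_flow]).

    A replacement of neighbours [U L = L' U'] is one step of the
    quotient-difference algorithm. It keeps positivity, rationality in the
    moments and the Lax equations ([star_flow]). Refactorizations that lead to
    the word [sigma_min] exist because this word dominates the rotated one
    prefix by prefix ([sigma_min_reach]), and all of them have the same result
    ([creach_word_inj]).

    For coprime [p] and [q] the sites of the scalar operator split into residue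
    classes modulo [p + q], numbered along the cycle; on the [k]-th class the
    operator acts as the [k]-th factor ([lax_pow_cprod]). This turns the Lax
    equations of the factors into the scalar flow ([flow_scalar]). The flows
    commute because the coefficients are rational functions of the moments,
    whose mixed partial derivatives agree ([family_commute]). At time zero the
    moments are [1 / (x_r + y_s)], and rational nodes give rational
    coefficients. *)

(** * Semi-infinite matrices *)

Section ImxAlgebra.
Variable R : realType.
Implicit Types X Y Z W : imx R.

Lemma imxP X Y : X =2 Y -> X = Y.
Proof. by move=> e; apply/funext => i; apply/funext => j; exact: e. Qed.

Lemma fsum_ord (V : nmodType) N (F : nat -> V) :
  (forall k, (N <= k)%N -> F k = 0) ->
  \sum_(k \in [set: nat]) F k = \sum_(k < N) F k.
Proof.
move=> F0.
have -> : \sum_(k \in [set: nat]) F k = \sum_(k \in `I_N) F k.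
  symmetry; apply: fsbig_widen => //= k [_ /= /negP]; rewrite -leqNgt.
  exact: F0.
rewrite fsbig_ord; exact: eq_bigr.
Qed.

Lemma imulE N X Y i j :
  (forall k, (N <= k)%N -> X i k * Y k j = 0) ->
  imul X Y i j = \sum_(k < N) X i k * Y k j.
Proof. exact: fsum_ord. Qed.

(** Rows of finite support turn products into finite sums; the uniform bound on
    the bandwidth makes the class closed under products, which associate. *)
Definition row_banded X := exists d, forall i j, (i + d < j)%N -> X i j = 0.

Lemma rb1 : row_banded (imx1 R).
Proof. by exists 0%N => i j; rewrite addn0 /imx1 => /ltn_eqF ->. Qed.

Lemma rbM X Y : row_banded X -> row_banded Y -> row_banded (imul X Y).
Proof.
move=> [d Xd] [e Ye]; exists (d + e)%N => i j ij.
have h k : X i k * Y k j = 0.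
  have [ik|ik] := ltnP (i + d) k; first by rewrite Xd ?mul0r.
  rewrite Ye ?mulr0//; lia.
by rewrite (@imulE 0) ?big_ord0.
Qed.

Lemma imulA X Y Z : row_banded X -> row_banded Y ->
  imul X (imul Y Z) = imul (imul X Y) Z.
Proof.
move=> [d Xd] [e Ye]; apply: imxP => i j.
pose N := (i + d + e).+1.
have YZ k : (k <= i + d)%N -> imul Y Z k j = \sum_(m < N) Y k m * Z m j.
  by move=> ki; apply: imulE => m; rewrite /N => Nm; rewrite Ye ?mul0r//; lia.
have XY m : imul X Y i m = \sum_(k < (i + d).+1) X i k * Y k m.
  by apply: imulE => k ik; rewrite Xd ?mul0r//; lia.
rewrite (@imulE (i + d).+1); last by move=> k ik; rewrite Xd ?mul0r//; lia.
rewrite (@imulE N); last first.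
  move=> m; rewrite /N => Nm; rewrite XY big1 ?mul0r// => k _.
  by rewrite Ye ?mulr0//; have := ltn_ord k; lia.
under eq_bigr => k _ do rewrite YZ ?mulr_sumr -1?ltnS//.
under [RHS]eq_bigr => m _ do rewrite XY mulr_suml.
by rewrite exchange_big; apply: eq_bigr => m _; apply: eq_bigr => k _; rewrite mulrA.
Qed.

Lemma imul1m X : imul (imx1 R) X = X.
Proof.
apply: imxP => i j; rewrite (@imulE i.+1) => [|k ik]; last first.
  by rewrite /imx1 (ltn_eqF ik) mul0r.
rewrite big_ord_recr/= big1 ?add0r /imx1 ?eqxx ?mul1r// => k _.
by rewrite (gtn_eqF (ltn_ord k)) mul0r.
Qed.

Definition itr X : imx R := fun i j => X j i.

Lemma itrK X : itr (itr X) = X. Proof. by []. Qed.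

Lemma itrM X Y : itr (imul X Y) = imul (itr Y) (itr X).
Proof.
apply: imxP => i j; rewrite /itr /imul.
by apply: eq_fsbigr => k _; rewrite mulrC.
Qed.

Lemma itr1 : itr (imx1 R) = imx1 R.
Proof. by apply: imxP => i j; rewrite /itr /imx1 eq_sym. Qed.

Lemma imulm1 X : imul X (imx1 R) = X.
Proof. by rewrite -[LHS]itrK itrM itr1 imul1m. Qed.

Definition col_banded X := row_banded (itr X).

Lemma imulA_col X Y Z : col_banded Y -> col_banded Z ->
  imul X (imul Y Z) = imul (imul X Y) Z.
Proof.
move=> cY cZ; rewrite -[LHS]itrK -[RHS]itrK; congr itr.
by rewrite !itrM imulA.
Qed.

Lemma cbM X Y : col_banded X -> col_banded Y -> col_banded (imul X Y).
Proof. by move=> cX cY; rewrite /col_banded itrM; exact: rbM. Qed.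

(** Here [Y] is arbitrary: the outer factors cut both summations down to finite
    ranges. This is how the moment matrices, full and infinite, are multiplied. *)
Lemma imulA_mid X Y Z : row_banded X -> col_banded Z ->
  imul X (imul Y Z) = imul (imul X Y) Z.
Proof.
move=> [d Xd] [e Ze]; apply: imxP => i j.
rewrite (@imulE (i + d).+1); last by move=> k ik; rewrite Xd ?mul0r//; lia.
rewrite (@imulE (j + e).+1); last first.
  by move=> k jk; rewrite [Z k j]Ze ?mulr0//; lia.
have YZ k : imul Y Z k j = \sum_(m < (j + e).+1) Y k m * Z m j.
  by apply: imulE => m jm; rewrite [Z m j]Ze ?mulr0//; lia.
have XY m : imul X Y i m = \sum_(k < (i + d).+1) X i k * Y k m.
  by apply: imulE => k ik; rewrite Xd ?mul0r//; lia.
under eq_bigr => k _ do rewrite YZ mulr_sumr.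
under [RHS]eq_bigr => m _ do rewrite XY mulr_suml.
by rewrite exchange_big; apply: eq_bigr => m _; apply: eq_bigr => k _; rewrite mulrA.
Qed.

Lemma rb_lower X : lower_triangular X -> row_banded X.
Proof. by move=> lX; exists 0%N => i j; rewrite addn0 => /lX. Qed.

Lemma cb_upper X : upper_triangular X -> col_banded X.
Proof. by move=> lX; exists 0%N => i j; rewrite addn0 => /lX. Qed.

Lemma itr_lower X : upper_triangular X -> lower_triangular (itr X).
Proof. by move=> uX i j /uX. Qed.

Lemma itr_upper X : lower_triangular X -> upper_triangular (itr X).
Proof. by move=> uX i j /uX. Qed.

Lemma lowerM X Y : lower_triangular X -> lower_triangular Y ->
  lower_triangular (imul X Y).
Proof.
move=> lX lY i j ij; rewrite (@imulE 0) ?big_ord0// => k _.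
have [ik|ki] := ltnP i k; first by rewrite lX ?mul0r.
by rewrite lY ?mulr0//; lia.
Qed.

Lemma upperM X Y : upper_triangular X -> upper_triangular Y ->
  upper_triangular (imul X Y).
Proof.
by move=> uX uY; rewrite -(itrK (imul X Y)) itrM; apply/itr_upper/lowerM; apply/itr_lower.
Qed.

Lemma lower_diagM X Y n : lower_triangular X -> lower_triangular Y ->
  imul X Y n n = X n n * Y n n.
Proof.
move=> lX lY; rewrite (@imulE n.+1) => [|k nk]; last by rewrite lX ?mul0r.
by rewrite big_ord_recr/= big1 ?add0r// => k _; rewrite lY ?mulr0.
Qed.

Lemma upper_diagM X Y n : upper_triangular X -> upper_triangular Y ->
  imul X Y n n = X n n * Y n n.
Proof.
move=> uX uY; have := lower_diagM n (itr_lower uY) (itr_lower uX).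
by rewrite -itrM /itr mulrC.
Qed.

Lemma lower_cancel X Y Z : lower_triangular X -> (forall n, X n n != 0) ->
  imul X Y = imul X Z -> Y = Z.
Proof.
move=> lX X0 e; apply: imxP => i j; elim/ltn_ind: i => i IH.
have h W : imul X W i j = \sum_(k < i) X i k * W k j + X i i * W i j.
  rewrite (@imulE i.+1) => [|k ik]; last by rewrite lX ?mul0r.
  by rewrite big_ord_recr.
have := congr1 (fun W => W i j) e; rewrite /= !h.
rewrite (eq_bigr (fun k : 'I_i => X i k * Z k j)); last by move=> k _; rewrite IH.
by move/addrI/(mulfI (X0 i)).
Qed.

Lemma lower_inv_comm X Y : lower_triangular X -> lower_triangular Y ->
  (forall n, X n n != 0) -> imul X Y = imx1 R -> imul Y X = imx1 R.
Proof.
move=> lX lY X0 e; apply: (lower_cancel lX X0).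
by rewrite imulA ?e ?imul1m ?imulm1//; apply: rb_lower.
Qed.

Lemma upper_inv_comm X Y : upper_triangular X -> upper_triangular Y ->
  (forall n, X n n != 0) -> imul X Y = imx1 R -> imul Y X = imx1 R.
Proof.
move=> uX uY X0 e.
have YX : imul (itr Y) (itr X) = imx1 R by rewrite -itrM e itr1.
have Y0 n : itr Y n n != 0.
  have : imul X Y n n = 1 by rewrite e /imx1 eqxx.
  rewrite upper_diagM// => XY; apply/eqP => Y0; move: XY; rewrite /itr in Y0.
  by rewrite Y0 mulr0 => /eqP; rewrite eq_sym oner_eq0.
have := lower_inv_comm (itr_lower uY) (itr_lower uX) Y0 YX.
by rewrite -itrM => /(congr1 itr); rewrite itrK itr1.
Qed.

Lemma lower_upper_one X : lower_triangular X -> upper_triangular X ->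
  (forall n, X n n = 1) -> X = imx1 R.
Proof.
move=> lX uX X1; apply: imxP => i j; rewrite /imx1.
by have [/lX ->|/uX ->|->] := ltngtP i j; rewrite ?X1.
Qed.

End ImxAlgebra.

(** * Gauss--Borel factorization *)

Section GaussBorel.
Variable R : realType.
Implicit Types M X : imx R.

Definition tau M n : R := \det (\matrix_(i < n, j < n) M i j).
Definition pivot M n : R := tau M n.+1 / tau M n.

Lemma tau_tr M n : tau (itr M) n = tau M n.
Proof. by rewrite /tau -det_tr; congr (\det _); apply/matrixP => i j; rewrite !mxE. Qed.

Lemma pivot_tr M n : pivot (itr M) n = pivot M n.
Proof. by rewrite /pivot (tau_tr M n.+1) (tau_tr M n). Qed.

(** Row [n] of the unit lower triangular [X] such that [X M] is upper
    triangular: Cramer's rule expresses it by the cofactors of the last column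
    of the leading block of size [n.+1]. *)
Definition elim_mx M : imx R := fun n k =>
  if (k <= n)%N then
    cofactor (\matrix_(i < n.+1, j < n.+1) M i j) (inord k) ord_max / tau M n
  else 0.

(** The minor that Cramer's rule puts at entry [(n, s)] of the eliminated
    matrix: two equal columns for [s < n], a quotient of leading minors for
    [s = n], and a minor on increasing columns for [n <= s]. *)
Definition col_block M (n s : nat) : 'M[R]_n.+1 :=
  \matrix_(i < n.+1, j < n.+1) M i (if j == ord_max then s else j : nat).

Lemma elim_mxE M n s : imul (elim_mx M) M n s = \det (col_block M n s) / tau M n.
Proof.
rewrite (@imulE _ n.+1) => [|k nk]; last by rewrite /elim_mx leqNgt nk mul0r.
rewrite (expand_det_col _ ord_max) mulr_suml; apply: eq_bigr => k _.
rewrite /elim_mx -ltnS ltn_ord inord_val mxE eqxx mulrC mulrA; congr (_ * _ / _).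
rewrite /cofactor; congr (_ * \det _); apply/matrixP => i j; rewrite !mxE.
by rewrite eq_sym (negbTE (neq_lift _ _)).
Qed.

Lemma elim_mx_lower M : lower_triangular (elim_mx M).
Proof. by move=> i j ij; rewrite /elim_mx leqNgt ij. Qed.

Lemma elim_mx_unit M n : tau M n != 0 -> elim_mx M n n = 1.
Proof.
move=> t0; rewrite /elim_mx leqnn /cofactor (_ : inord n = ord_max); last first.
  by apply: val_inj; rewrite /= inordK.
rewrite /= -signr_odd addnn odd_double mul1r (_ : \det _ = tau M n) ?divff//.
by congr (\det _); apply/matrixP => i j; rewrite !mxE !lift_max.
Qed.

Lemma elim_mx_upper M : upper_triangular (imul (elim_mx M) M).
Proof.
move=> n s sn; rewrite elim_mxE (_ : \det _ = 0) ?mul0r//.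
rewrite -det_tr; apply: (@determinant_alternate _ _ _ ord_max (inord s)).
  by rewrite -val_eqE/= inordK 1?ltnW// gtn_eqF.
move=> j; rewrite !mxE eqxx -val_eqE/= inordK 1?ltnW//.
by rewrite (ltn_eqF sn).
Qed.

Lemma elim_mx_pivot M n : imul (elim_mx M) M n n = pivot M n.
Proof.
rewrite elim_mxE; congr (\det _ / _); apply/matrixP => i j; rewrite !mxE.
by case: eqP => // ->.
Qed.

Lemma elim_mx_gt0 M n s : totally_positive M -> (n <= s)%N ->
  0 < imul (elim_mx M) M n s.
Proof.
move=> tp ns; rewrite elim_mxE divr_gt0//.
  apply: (tp _ (fun i => i : nat)
    (fun j : 'I_n.+1 => if j == ord_max then s else j : nat)) => // i j ij.
  rewrite -!val_eqE /=.
  have [jn|jn] := eqVneq (j : nat) n.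
    by have -> : (i == n :> nat) = false; lia.
  by have -> : (i == n :> nat) = false; have := ltn_ord j; lia.
by apply: (tp _ (fun i => i : nat) (fun i => i : nat)).
Qed.

(** The upper factor comes from eliminating in the transpose, the two
    inverses from multiplying by [M] again. *)
Definition gb_of M : gb_data R :=
  let U := itr (fun n k => elim_mx (itr M) n k / pivot M n) in
  GBData (elim_mx M) U (imul M U) (imul (elim_mx M) M).

Lemma gb_of_Li M r s : gbLi (gb_of M) r s = imul (elim_mx (itr M)) (itr M) s r / pivot M s.
Proof.
rewrite /= -[imul M _]itrK itrM itrK /itr.
rewrite !(@imulE _ s.+1); last 2 first.
- by move=> k sk; rewrite elim_mx_lower ?mul0r.
- by move=> k sk; rewrite elim_mx_lower// !mul0r.
by rewrite mulr_suml; apply: eq_bigr => k _; rewrite mulrAC.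
Qed.

Lemma gb_ofP M : (forall n, tau M n != 0) -> gauss_borel M (gb_of M).
Proof.
move=> t0.
have tT n : tau (itr M) n != 0 by rewrite tau_tr.
have p0 n : pivot M n != 0 by rewrite mulf_neq0// invr_neq0.
set D := gb_of M.
have lL : lower_triangular (gbL D) by exact: elim_mx_lower.
have uL n : gbL D n n = 1 by exact: elim_mx_unit.
have uUi : upper_triangular (gbUi D) by exact: elim_mx_upper.
have uU : upper_triangular (gbU D).
  by move=> i j ij; rewrite /= /itr elim_mx_lower// mul0r.
have lLi : lower_triangular (gbLi D).
  by move=> r s rs; rewrite gb_of_Li elim_mx_upper// mul0r.
have Li1 n : gbLi D n n = 1.
  by rewrite gb_of_Li elim_mx_pivot pivot_tr divff.
have Ui n : gbUi D n n = pivot M n by exact: elim_mx_pivot.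
have e : imul (gbL D) (gbLi D) = imul (gbUi D) (gbU D).
  by apply: imulA_mid; [exact: rb_lower|exact: cb_upper].
have e1 : imul (gbL D) (gbLi D) = imx1 R.
  apply: lower_upper_one; first exact: lowerM.
    by rewrite e; exact: upperM.
  by move=> n; rewrite lower_diagM// uL Li1 mulr1.
have L0 n : gbL D n n != 0 by rewrite uL oner_neq0.
have e2 : imul (gbUi D) (gbU D) = imx1 R by rewrite -e e1.
have Ui0 n : gbUi D n n != 0 by rewrite Ui.
split => // [i j|i j|i j|i j|].
- by rewrite e1.
- by rewrite (lower_inv_comm lL lLi L0 e1).
- by rewrite (upper_inv_comm uUi uU Ui0 e2).
- by rewrite e2.
have -> : M = imul (gbLi D) (gbUi D); last by [].
apply: (lower_cancel lL L0); rewrite imulA; [|exact: rb_lower|exact: rb_lower].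
by rewrite e1 imul1m.
Qed.

(** The quotient of two unit lower factors equals one of two upper factors,
    hence is the identity. *)
Lemma gauss_borel_unique M D D' : gauss_borel M D -> gauss_borel M D' -> D = D'.
Proof.
case: D => L U Li Ui; case: D' => L' U' Li' Ui'.
case=> /= lL L1 uU lLi uUi /imxP LLi /imxP LiL /imxP UUi /imxP UiU /imxP e.
case=> /= lL' L1' uU' lLi' uUi' /imxP LLi' /imxP LiL' /imxP UUi' /imxP UiU' /imxP e'.
have rl := rb_lower; have cu := cb_upper.
have eX : imul L' Li = imul Ui' U.
  have : imul (imul L' Li) Ui = Ui'.
    rewrite -imulA -?e; [|exact: rl..].
    by rewrite e' imulA ?LLi' ?imul1m//; exact: rl.
  move=> <-; rewrite -imulA_col; [|exact: cu..].
  by rewrite UiU imulm1.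
have X1 : imul L' Li = imx1 R.
  apply: lower_upper_one; first exact: lowerM.
    by rewrite eX; exact: upperM.
  move=> n; rewrite lower_diagM// L1' mul1r.
  have := congr1 (fun X => X n n) LLi; rewrite lower_diagM// L1 mul1r => ->.
  by rewrite /imx1 eqxx.
have LL' : L' = L by rewrite -[L']imulm1 -LiL imulA ?X1 ?imul1m//; exact: rl.
have UU' : U = U'.
  have : imul U' (imul Ui' U) = U'.
    by rewrite -eX X1 imulm1.
  by rewrite imulA_col ?UUi' ?imul1m//; exact: cu.
have Lie : Li' = Li by rewrite -[Li]imul1m -LiL' -imulA ?LL' ?LLi ?imulm1//; exact: rl.
have Ui_ : Ui = Ui'.
  by rewrite -[Ui']imulm1 -UUi imulA_col ?UU' ?UiU' ?imul1m//; exact: cu.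
by congr GBData.
Qed.

End GaussBorel.

(** * Christoffel connections as bidiagonal matrices *)

Section Arrays.
Variable R : realType.
Implicit Types (X Y Z M : imx R) (a : nat -> R).

Lemma lcombE m n N a (V : nat -> 'M[{poly R}]_(m, n)) :
  (forall k, (N <= k)%N -> a k = 0) ->
  lcomb a V = \sum_(k < N) (a k)%:P *: V k.
Proof. by move=> a0; apply: fsum_ord => k /a0 ->; rewrite scale0r. Qed.

Lemma lcomb_imul m n X Y (V : nat -> 'M[{poly R}]_(m, n)) r :
  row_banded X -> row_banded Y ->
  lcomb (X r) (fun k => lcomb (Y k) V) = lcomb (imul X Y r) V.
Proof.
move=> [d Xd] [e Ye].
have X0 k : (r + d < k)%N -> X r k = 0 by exact: Xd.
rewrite (@lcombE _ _ (r + d).+1)// (@lcombE _ _ (r + d + e).+1); last first.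
  move=> k rk; rewrite (@imulE _ (r + d).+1) => [|j rj]; last by rewrite X0 ?mul0r.
  by rewrite big1// => j _; rewrite Ye ?mulr0//; have := ltn_ord j; lia.
under eq_bigr => k _.
  rewrite (@lcombE _ _ (r + d + e).+1); last first.
    by move=> j rj; rewrite Ye//; have := ltn_ord k; lia.
  rewrite scaler_sumr; over.
rewrite exchange_big; apply: eq_bigr => j _ /=.
rewrite (@imulE _ (r + d).+1) => [|k rk]; last by rewrite X0 ?mul0r.
by rewrite rmorph_sum scaler_suml; apply: eq_bigr => k _; rewrite scalerA rmorphM.
Qed.

Lemma chi_coef q N a (j : 'I_q) u :
  ((\sum_(k < N) (a k)%:P *: chi R q k) 0 j)`_u =
  if (u * q + j < N)%N then a (u * q + j)%N else 0.
Proof.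
rewrite summxE coef_sum.
have q0 : (0 < q)%N by case: q j => // -[].
have cE (k : nat) : (((a k)%:P *: chi R q k) 0 j)`_u = if k == (u * q + j)%N then a k else 0.
  rewrite !mxE coefCM coefMn coefXn.
  have -> : (k == (u * q + j)%N) = (u == (k %/ q)%N) && ((k %% q)%N == j).
    apply/eqP/andP => [->|[/eqP -> /eqP <-]]; last by rewrite -divn_eq.
    by rewrite divnMDl// divn_small ?addn0// modnMDl modn_small// !eqxx.
  by case: eqP; case: eqP => //= _ _; rewrite ?mulr1// ?mulr0n ?mulr0 ?mul0rn ?mulr0.
under eq_bigr => k _ do rewrite cE.
case: ltnP => [lt|le].
  rewrite (bigD1 (Ordinal lt))//= eqxx big1 ?addr0// => k /negP kN.
  by case: eqP => // ke; case: kN; apply/eqP/val_inj.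
by rewrite big1// => k _; rewrite ltn_eqF// (leq_trans (ltn_ord k)).
Qed.

(** The monomial rows [chi q k] are independent, so identities between arrays
    are identities between coefficient matrices. *)
Lemma lcomb_chi_inj q X Y : (0 < q)%N -> row_banded X -> row_banded Y ->
  (forall r, lcomb (X r) (chi R q) = lcomb (Y r) (chi R q)) -> X = Y.
Proof.
move=> q0 [d Xd] [e Ye] h; apply: imxP => r s.
pose N := (r + d + e + s).+1.
have := congr1 (fun v : 'rV[{poly R}]_q => (v 0 (Ordinal (ltn_pmod s q0)))`_(s %/ q)) (h r).
rewrite !(@lcombE _ _ N); [|by move=> k; rewrite /N => ?; rewrite ?Ye//; lia
  |by move=> k; rewrite /N => ?; rewrite ?Xd//; lia].
rewrite !chi_coef /= -divn_eq.
by have -> : (s < N)%N by rewrite /N; lia.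
Qed.

Lemma lcomb_tr m n N a (V : nat -> 'M[{poly R}]_(m, n)) :
  (forall k, (N <= k)%N -> a k = 0) -> lcomb a (fun k => (V k)^T) = (lcomb a V)^T.
Proof.
move=> a0; rewrite !(lcombE _ a0) linear_sum; apply: eq_bigr => k _.
by rewrite linearZ.
Qed.

(** The matrix [Kmx] moves to the next monomial row, so it acts on arrays as a
    shift of the coefficient matrix. *)
Lemma chi_Kmx q k : (0 < q)%N -> chi R q k *m Kmx R q = chi R q k.+1.
Proof.
case: q => // q _; apply/rowP => j; rewrite !mxE.
rewrite (bigD1 (Ordinal (ltn_pmod k (ltn0Sn q))))//= big1 ?addr0; last first.
  move=> i ki; rewrite !mxE (_ : _ == i :> nat = false) ?mulr0n ?mul0r//.
  by apply: contraNF ki => /eqP ki; apply/eqP/val_inj.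
rewrite !mxE /= eqxx mulr1n.
have kE := divn_eq k q.+1; have lt := ltn_pmod k (ltn0Sn q).
have [eq1|ne1] := eqVneq (k %% q.+1)%N q.
  have k1 : k.+1 = ((k %/ q.+1).+1 * q.+1)%N by rewrite {1}kE eq1; lia.
  rewrite k1 mulnK// modnMl eq1 eqxx (_ : j == q.+1 :> nat = false); last first.
    by have := ltn_ord j; lia.
  by rewrite eq_sym /=; case: eqP => _; rewrite ?mulr1n ?mulr0n ?mulr0// exprSr.
have [d1 m1] : (k.+1 %/ q.+1 = k %/ q.+1)%N /\ (k.+1 %% q.+1 = (k %% q.+1).+1)%N.
  have lt1 : ((k %% q.+1).+1 < q.+1)%N by lia.
  have -> : k.+1 = (k %/ q.+1 * q.+1 + (k %% q.+1).+1)%N by rewrite addnS -kE.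
  rewrite divnMDl// modnMDl [in X in (_ + X)%N]divn_small//.
  by rewrite addn0; split; [|exact: (modn_small lt1)].
rewrite d1 m1 eq_sym (_ : (k %% q.+1).+1 == q.+1 = false) /=; last by lia.
by case: eqP => _; rewrite ?mulr1// mulr0.
Qed.

(** Multiplication by it on the left deletes the first row, by its transpose on
    the right the first column: this is the passage between neighbouring
    vertices of the finite rectangle. *)
Definition shift_mx : imx R := fun i j => (j == i.+1)%:R.

Lemma rb_shift : row_banded shift_mx.
Proof. by exists 1%N => i j ij; rewrite /shift_mx; case: eqP => // e; lia. Qed.

Lemma shiftM X r s : imul shift_mx X r s = X r.+1 s.
Proof.
rewrite (@imulE _ r.+2) => [|k rk]; last first.
  by rewrite /shift_mx gtn_eqF ?mul0r.
rewrite big_ord_recr/= /shift_mx eqxx mul1r big1 ?add0r// => k _.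
by rewrite ltn_eqF ?mul0r.
Qed.

Lemma mulTshift X r s : imul X (itr shift_mx) r s = X r s.+1.
Proof. by rewrite -[imul X _]itrK itrM itrK /itr shiftM. Qed.

Lemma Tshift_mul X r s : imul (itr shift_mx) X r s = if r is r'.+1 then X r' s else 0.
Proof.
rewrite (@imulE _ r) => [|k rk]; last by rewrite /itr /shift_mx ltn_eqF ?mul0r.
case: r => [|r]; first by rewrite big_ord0.
rewrite big_ord_recr/= /itr /shift_mx eqxx mul1r big1 ?add0r// => k _.
by rewrite gtn_eqF ?mul0r// ltnS.
Qed.

Lemma mul_shift X r s : imul X shift_mx r s = if s is s'.+1 then X r s' else 0.
Proof. by rewrite -[imul X _]itrK itrM /itr Tshift_mul. Qed.

Section Conditions.
Variables (q : nat).
Hypothesis q0 : (0 < q)%N.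

Lemma arrayB_lcomb X (D D' : gb_data R) : row_banded X ->
  lower_triangular (gbL D) -> lower_triangular (gbL D') ->
  (forall r, lcomb (X r) (arrayB q D') = arrayB q D r) <-> imul X (gbL D') = gbL D.
Proof.
move=> rX /rb_lower lD /rb_lower lD'; split=> [h|h r]; last first.
  by rewrite [RHS]/arrayB -h -lcomb_imul.
by apply: (lcomb_chi_inj q0) => // [|r]; [exact: rbM|rewrite -lcomb_imul//; exact: h].
Qed.

Lemma arrayB_lcombK X (D D' : gb_data R) : row_banded X ->
  lower_triangular (gbL D) -> lower_triangular (gbL D') ->
  (forall r, lcomb (X r) (arrayB q D) = arrayB q D' r *m Kmx R q) <->
  imul X (gbL D) = imul (gbL D') shift_mx.
Proof.
move=> rX /rb_lower lD /rb_lower lD'.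
have KE r : arrayB q D' r *m Kmx R q = lcomb (imul (gbL D') shift_mx r) (chi R q).
  case: lD' => d Ld.
  have Ls : forall k, (r + d < k)%N -> gbL D' r k = 0 by exact: Ld.
  rewrite /arrayB (lcombE _ Ls) mulmx_suml (@lcombE _ _ (r + d).+2); last first.
    by move=> [|k]// rk; rewrite mul_shift Ls.
  rewrite [RHS]big_ord_recl /= mul_shift scale0r add0r; apply: eq_bigr => k _.
  by rewrite mul_shift -scalemxAl chi_Kmx.
split=> [h|h r]; last by rewrite KE -h /arrayB lcomb_imul.
apply: (lcomb_chi_inj q0) => [||r]; [exact: rbM|exact: (rbM _ rb_shift)|].
by rewrite -lcomb_imul// -KE; exact: h.
Qed.

Lemma itr_inj X Y : itr X = itr Y -> X = Y.
Proof. by move=> h; rewrite -[X]itrK h itrK. Qed.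

Lemma lcomb_chiT_inj X Y : row_banded X -> row_banded Y ->
  (forall r, lcomb (X r) (fun k => (chi R q k)^T) = lcomb (Y r) (fun k => (chi R q k)^T)) ->
  X = Y.
Proof.
move=> rX rY h; apply: (lcomb_chi_inj q0) => // r.
case: rX rY => [d Xd] [e Ye].
have Xs : forall k, (r + d < k)%N -> X r k = 0 by exact: Xd.
have Ys : forall k, (r + e < k)%N -> Y r k = 0 by exact: Ye.
by apply: trmx_inj; rewrite -(lcomb_tr _ Xs) -(lcomb_tr _ Ys).
Qed.

Lemma arrayA_lcomb X (D D' : gb_data R) : col_banded X ->
  upper_triangular (gbU D) -> upper_triangular (gbU D') ->
  (forall s, lcomb (X ^~ s) (arrayA q D') = arrayA q D s) <-> imul (gbU D') X = gbU D.
Proof.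
move=> rX /cb_upper lD /cb_upper lD'.
have E s : lcomb (X ^~ s) (arrayA q D') =
    lcomb (itr (imul (gbU D') X) s) (fun k => (chi R q k)^T).
  by rewrite itrM -lcomb_imul.
split=> [h|h s]; last by rewrite E h.
apply/itr_inj/lcomb_chiT_inj => [|//|s]; last by rewrite -E; exact: h.
by rewrite itrM; exact: rbM.
Qed.

Lemma arrayA_lcombK X (D D' : gb_data R) : col_banded X ->
  upper_triangular (gbU D) -> upper_triangular (gbU D') ->
  (forall s, lcomb (X ^~ s) (arrayA q D) = (Kmx R q)^T *m arrayA q D' s) <->
  imul (gbU D) X = imul (itr shift_mx) (gbU D').
Proof.
move=> rX /cb_upper lD /cb_upper lD'.
have E s : lcomb (X ^~ s) (arrayA q D) =
    lcomb (itr (imul (gbU D) X) s) (fun k => (chi R q k)^T).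
  by rewrite itrM -lcomb_imul.
have KE s : (Kmx R q)^T *m arrayA q D' s =
    lcomb (itr (imul (itr shift_mx) (gbU D')) s) (fun k => (chi R q k)^T).
  case: lD' => d Ud.
  have Us : forall k, (s + d < k)%N -> gbU D' k s = 0 by move=> k; exact: Ud.
  rewrite /arrayA (lcombE _ Us) mulmx_sumr (@lcombE _ _ (s + d).+2); last first.
    by move=> [|k]// rk; rewrite {1}/itr Tshift_mul Us.
  rewrite [RHS]big_ord_recl /= {1}/itr Tshift_mul scale0r add0r; apply: eq_bigr => k _.
  by rewrite {1}/itr Tshift_mul -scalemxAr -trmx_mul chi_Kmx.
split=> [h|h s]; last by rewrite E h KE.
apply/itr_inj/lcomb_chiT_inj => [||s]; last by rewrite -E -KE; exact: h.
  by rewrite itrM; exact: rbM.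
by rewrite itrM itrK; exact: rbM _ rb_shift.
Qed.

End Conditions.

Lemma rb_bidiag_lower X : normalized_lower X -> row_banded X /\ col_banded X.
Proof.
move=> [_ X0]; split; [exists 0%N|exists 1%N] => i j ij.
  by rewrite X0//; lia.
by rewrite /itr X0//; lia.
Qed.

Lemma rb_bidiag_upper X : normalized_upper X -> row_banded X /\ col_banded X.
Proof.
move=> [_ X0]; split; [exists 1%N|exists 0%N] => i j ij.
  by rewrite X0//; lia.
by rewrite /itr X0//; lia.
Qed.

End Arrays.

Lemma gb_Li1 (R : realType) (M : imx R) D (gD : gauss_borel M D) n : gbLi D n n = 1.
Proof.
have := lower_diagM n (gb_lower gD) (gb_lower_inv gD).
by rewrite (imxP (gb_LLi gD)) /imx1 eqxx (gb_unit gD) mul1r.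
Qed.

Section Connections.
Variable R : realType.
Implicit Types (X Y Z M : imx R).
Variables (M M' : imx R) (D D' : gb_data R).
Hypotheses (gD : gauss_borel M D) (gD' : gauss_borel M' D').

(** When [M'] is [M] with its first column deleted, the quotient of the lower
    factors is also a product of upper factors with one shift in between, so it
    is lower bidiagonal. *)
Section Lower.
Hypothesis MM' : M' = imul M (itr (shift_mx R)).

Lemma conn_lowerE : imul (gbL D) (gbLi D') =
  imul (gbUi D) (imul (itr (shift_mx R)) (gbU D')).
Proof.
have rl := @rb_lower R; have cu := @cb_upper R.
case: gD => lL L1 uU lLi uUi /imxP LLi /imxP LiL /imxP UUi /imxP UiU /imxP e.
case: gD' => lL' L1' uU' lLi' uUi' /imxP LLi' /imxP LiL' /imxP UUi' /imxP UiU' /imxP e'.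
have cS : col_banded (itr (shift_mx R)) by exact: rb_shift.
have MU : imul M' (gbU D') = gbLi D'.
  by rewrite e' -imulA_col ?UiU' ?imulm1//; exact: cu.
have LM : imul (gbL D) M = gbUi D.
  by rewrite e imulA ?LLi ?imul1m//; exact: rl.
have cSU : col_banded (imul (itr (shift_mx R)) (gbU D')).
  by apply: cbM => //; exact: cu.
rewrite -MU MM' -(imulA_col _ cS) ?(imulA_mid _ _ cSU) ?LM//; [exact: rl|exact: cu].
Qed.

Lemma conn_lower_entry i j : (j < i)%N -> imul (gbL D) (gbLi D') i j =
  if i == j.+1 then gbUi D i i * gbU D' j j else 0.
Proof.
move=> ji; have uUi := gb_upper_inv gD; have uU' := gb_upper gD'.
rewrite conn_lowerE (@imulE _ j.+2) => [|[|k]]; last 2 first.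
- by [].
- by move=> jk; rewrite Tshift_mul uU' ?mulr0.
rewrite big_ord_recr/= Tshift_mul big1 ?add0r; last first.
  by move=> k _; rewrite uUi ?mul0r//; have := ltn_ord k; lia.
by case: eqP => [->//|ne]; rewrite uUi ?mul0r//; lia.
Qed.

Lemma conn_lower_normalized : normalized_lower (imul (gbL D) (gbLi D')).
Proof.
split=> [n|i j ne1 ne2].
  rewrite lower_diagM; [|exact: gb_lower gD|exact: gb_lower_inv gD'].
  by rewrite (gb_unit gD) mul1r (gb_Li1 gD').
have [ij|ji|e] := ltngtP i j; last by rewrite e eqxx in ne1.
  by apply: lowerM => //; [exact: gb_lower gD|exact: gb_lower_inv gD'].
by rewrite conn_lower_entry// (negbTE ne2).
Qed.

Lemma conn_lowerL : imul (imul (gbL D) (gbLi D')) (gbL D') = gbL D.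
Proof.
rewrite -imulA ?(imxP (gb_LiL gD')) ?imulm1//; apply: rb_lower.
  exact: gb_lower gD.
exact: gb_lower_inv gD'.
Qed.

Lemma conn_lowerU : imul (gbU D) (imul (gbL D) (gbLi D')) =
  imul (itr (shift_mx R)) (gbU D').
Proof.
have cu := @cb_upper R.
have cSU : col_banded (imul (itr (shift_mx R)) (gbU D')).
  by apply: cbM; [exact: rb_shift|exact: cu (gb_upper gD')].
rewrite conn_lowerE imulA_col ?(imxP (gb_UUi gD)) ?imul1m//.
exact: cu (gb_upper_inv gD).
Qed.

Lemma conn_lower_unique X : imul X (gbL D') = gbL D -> row_banded X ->
  X = imul (gbL D) (gbLi D').
Proof.
move=> <- rX; rewrite -imulA ?(imxP (gb_LLi gD')) ?imulm1//.
exact: rb_lower (gb_lower gD').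
Qed.

End Lower.

(** Deleting the first row of [M] instead gives an upper bidiagonal
    connection, for the same reason. *)
Section Upper.
Hypothesis MM' : M' = imul (shift_mx R) M.

Lemma conn_upperE : imul (gbUi D') (gbU D) =
  imul (imul (gbL D') (shift_mx R)) (gbLi D).
Proof.
have rl := @rb_lower R; have cu := @cb_upper R.
have MU : imul M (gbU D) = gbLi D.
  rewrite (imxP (gb_fact gD)) -imulA_col ?(imxP (gb_UiU gD)) ?imulm1//.
    exact: cu (gb_upper_inv gD).
  exact: cu (gb_upper gD).
have LM : imul (gbL D') M' = gbUi D'.
  rewrite (imxP (gb_fact gD')) imulA ?(imxP (gb_LLi gD')) ?imul1m//.
    exact: rl (gb_lower gD').
  exact: rl (gb_lower_inv gD').
have rLS : row_banded (imul (gbL D') (shift_mx R)).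
  by apply: rbM; [exact: rl (gb_lower gD')|exact: rb_shift].
rewrite -LM -MU MM' (imulA _ _ (rb_shift R)); last exact: rl (gb_lower gD').
by rewrite (imulA_mid _ rLS)//; exact: cu (gb_upper gD).
Qed.

Lemma conn_upper_entry i j : (i < j)%N ->
  imul (gbUi D') (gbU D) i j = (j == i.+1)%:R.
Proof.
move=> ij; have lL' := gb_lower gD'; have lLi := gb_lower_inv gD.
rewrite conn_upperE (@imulE _ i.+2) => [|[|k]]; last 2 first.
- by [].
- by move=> jk; rewrite mul_shift lL' ?mul0r.
rewrite big_ord_recr/= mul_shift big1 ?add0r; last first.
  by move=> k _; rewrite [gbLi D _ _]lLi ?mulr0//; have := ltn_ord k; lia.
rewrite (gb_unit gD') mul1r; case: eqP => [->|ne]; first exact: gb_Li1 gD _.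
by rewrite lLi//; lia.
Qed.

Lemma conn_upper_diag n : imul (gbUi D') (gbU D) n n = gbUi D' n n * gbU D n n.
Proof. by rewrite upper_diagM//; [exact: gb_upper_inv gD'|exact: gb_upper gD]. Qed.

Lemma conn_upper_normalized : normalized_upper (imul (gbUi D') (gbU D)).
Proof.
split=> [n|i j ne1 ne2]; first by rewrite conn_upper_entry// eqxx.
have [ij|ji|e] := ltngtP i j; last by rewrite e eqxx in ne1.
  by rewrite conn_upper_entry// (negbTE ne2).
by apply: upperM => //; [exact: gb_upper_inv gD'|exact: gb_upper gD].
Qed.

Lemma conn_upperL : imul (imul (gbUi D') (gbU D)) (gbL D) =
  imul (gbL D') (shift_mx R).
Proof.
have rl := @rb_lower R.
have rLS : row_banded (imul (gbL D') (shift_mx R)).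
  by apply: rbM; [exact: rl (gb_lower gD')|exact: rb_shift].
rewrite conn_upperE -imulA ?(imxP (gb_LiL gD)) ?imulm1//.
exact: rl (gb_lower_inv gD).
Qed.

Lemma conn_upperU : imul (gbU D') (imul (gbUi D') (gbU D)) = gbU D.
Proof.
have cu := @cb_upper R.
rewrite imulA_col ?(imxP (gb_UUi gD')) ?imul1m//.
  exact: cu (gb_upper_inv gD').
exact: cu (gb_upper gD).
Qed.

Lemma conn_upper_unique X : imul (gbU D') X = gbU D -> col_banded X ->
  X = imul (gbUi D') (gbU D).
Proof.
have cu := @cb_upper R.
move=> <- cX; rewrite imulA_col ?(imxP (gb_UiU gD')) ?imul1m//.
exact: cu (gb_upper gD').
Qed.

End Upper.
End Connections.

(** * Star refactorization *)

Lemma rt1n_cons (A : Type) (r : relation A) x y z :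
  r x y -> clos_refl_trans_1n A r y z -> clos_refl_trans_1n A r x z.
Proof. exact: Relation_Operators.rt1n_trans. Qed.

Section Factors.
Variable R : realType.
Implicit Types (u l : nat -> R).

(** Normalized bidiagonal matrices are handled through their free coefficients,
    which determine them and can be differentiated one by one. *)
Definition mkL l : imx R := fun i j =>
  if i == j then 1 else if i == j.+1 then l j else 0.
Definition mkU u : imx R := fun i j =>
  if j == i then u i else if j == i.+1 then 1 else 0.

Definition cfactor := (bool * (nat -> R))%type.
Definition to_factor (f : cfactor) : bidiag_factor R :=
  if f.1 then Lower (mkL f.2) else Upper (mkU f.2).
Definition pos_factor (f : cfactor) := forall n, 0 < f.2 n.

Lemma mkL_sub l n : mkL l n.+1 n = l n.
Proof. by rewrite /mkL gtn_eqF// eqxx. Qed.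

Lemma mkU_diag u n : mkU u n n = u n.
Proof. by rewrite /mkU eqxx. Qed.

Lemma normalized_mkL l : normalized_lower (mkL l).
Proof.
split=> [n|i j /negbTE ne1 /negbTE ne2]; first by rewrite /mkL eqxx.
by rewrite /mkL ne1 ne2.
Qed.

Lemma normalized_mkU u : normalized_upper (mkU u).
Proof.
split=> [n|i j /negbTE ne1 /negbTE ne2]; first by rewrite /mkU gtn_eqF// eqxx.
by rewrite /mkU ne1 ne2.
Qed.

Lemma normalized_lowerE (X : imx R) : normalized_lower X -> X = mkL (fun n => X n.+1 n).
Proof.
move=> [X1 X0]; apply: imxP => i j; rewrite /mkL.
have [->|ne] := eqVneq; first exact: X1.
by have [->//|ne2] := eqVneq; exact: X0.
Qed.

Lemma normalized_upperE (X : imx R) : normalized_upper X -> X = mkU (fun n => X n n).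
Proof.
move=> [X1 X0]; apply: imxP => i j; rewrite /mkU.
have [->//|ne] := eqVneq.
by have [->|ne2] := eqVneq; [exact: X1|exact: X0].
Qed.

Lemma pos_to_factor f : pos_factor f -> normalized_pos_factor (to_factor f).
Proof.
case: f => -[] f f0 /=; split => //.
- exact: normalized_mkL.
- by move=> n; rewrite mkL_sub; exact: f0.
- exact: normalized_mkU.
- by move=> n; rewrite mkU_diag; exact: f0.
Qed.

Lemma is_lower_to_factor f : is_lower (to_factor f) = f.1.
Proof. by case: f => -[]. Qed.

Lemma rb_mkL l : row_banded (mkL l).
Proof. exact: (rb_bidiag_lower (normalized_mkL l)).1. Qed.

Lemma rb_mkU u : row_banded (mkU u).
Proof. exact: (rb_bidiag_upper (normalized_mkU u)).1. Qed.

Lemma mkU_mul u Y i j : imul (mkU u) Y i j = u i * Y i j + Y i.+1 j.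
Proof.
rewrite (@imulE _ i.+2) => [|k ik]; last first.
  by rewrite /mkU !gtn_eqF ?mul0r// ltnW.
rewrite !big_ord_recr/= /mkU eqxx gtn_eqF// eqxx mul1r big1 ?add0r// => k _.
have := ltn_ord k => ki.
by rewrite !ltn_eqF ?mul0r// ltnW.
Qed.

Lemma mkL_mul l Y i j :
  imul (mkL l) Y i j = Y i j + (if i is i'.+1 then l i' * Y i' j else 0).
Proof.
rewrite (@imulE _ i.+1) => [|k ik]; last first.
  by rewrite /mkL !ltn_eqF ?mul0r// ltnW.
rewrite big_ord_recr/= {2}/mkL eqxx mul1r addrC; congr (_ + _).
case: i => [|i]; first by rewrite big_ord0.
rewrite big_ord_recr/= mkL_sub big1 ?add0r// => k _.
by have ki := ltn_ord k; rewrite /mkL !gtn_eqF ?mul0r//; lia.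
Qed.

(** The pair [L'], [U'] with [U L = L' U'] is found row by row (this is the
    step of the quotient-difference algorithm). *)
Fixpoint star_up u l n : R :=
  if n is n'.+1 then u n + l n - u n * l n' / star_up u l n' else u 0 + l 0.

Definition star_lo u l n : R := u n.+1 * l n / star_up u l n.

Lemma star_upS u l n : star_up u l n.+1 = u n.+1 + l n.+1 - star_lo u l n.
Proof. by []. Qed.

(** Positivity is kept because the differences [star_up n - l n] satisfy a
    multiplicative recursion. *)
Lemma star_up_gt u l n : (forall n, 0 < u n) -> (forall n, 0 < l n) ->
  l n < star_up u l n.
Proof.
move=> u0 l0; elim: n => [|n IH]; first by rewrite /= ltrDr.
have s0 : 0 < star_up u l n by exact: lt_trans IH.
rewrite star_upS addrAC ltrDr subr_gt0 /star_lo ltr_pdivrMr//.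
by rewrite ltr_pM2l.
Qed.

Lemma star_up_gt0 u l n : (forall n, 0 < u n) -> (forall n, 0 < l n) ->
  0 < star_up u l n.
Proof. by move=> u0 l0; exact: lt_trans (star_up_gt n u0 l0). Qed.

Lemma star_lo_gt0 u l n : (forall n, 0 < u n) -> (forall n, 0 < l n) ->
  0 < star_lo u l n.
Proof. by move=> u0 l0; rewrite divr_gt0 ?mulr_gt0 ?star_up_gt0. Qed.

Lemma UL_entry u l i j : imul (mkU u) (mkL l) i j =
  if j == i then u i + l i else if j == i.+1 then 1 else
  if i == j.+1 then u i * l j else 0.
Proof.
rewrite mkU_mul /mkL eqSS ![_ == j]eq_sym.
have [->|ne] := eqVneq j i.
  by rewrite (ltn_eqF (ltnSn i)) mulr1.
have [->|ne2] := eqVneq j i.+1; last by rewrite addr0; case: ifP; rewrite ?mulr0.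
by rewrite (ltn_eqF (leqnSn i.+1)) mulr0 add0r.
Qed.

Lemma LU_entry u l i j : imul (mkL l) (mkU u) i j =
  if j == i then u i + (if i is i'.+1 then l i' else 0) else
  if j == i.+1 then 1 else if i == j.+1 then l j * u j else 0.
Proof.
rewrite mkL_mul /mkU; case: i => [|i].
  by rewrite addr0; case: (j == 0)%N; rewrite ?addr0//; case: (j == 1)%N.
have [->|ne] := eqVneq j i.+1; first by rewrite gtn_eqF// mulr1.
rewrite eqSS [i == j]eq_sym; have [->|ne2] := eqVneq j i.+2.
  by rewrite gtn_eqF ?mulr0 ?addr0.
by have [->|] := eqVneq j i; rewrite ?add0r ?mulr0.
Qed.

Lemma star_mul u l : (forall n, star_up u l n != 0) ->
  imul (mkU u) (mkL l) = imul (mkL (star_lo u l)) (mkU (star_up u l)).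
Proof.
move=> s0; apply: imxP => i j; rewrite UL_entry LU_entry.
case: (j == i); first by case: i => [|i]; rewrite ?addr0// star_upS subrK.
by case: (j == i.+1) => //; have [->|//] := eqVneq i j.+1; rewrite /star_lo divfK.
Qed.

Lemma star_unique u l u' l' : (forall n, u' n != 0) ->
  imul (mkU u) (mkL l) = imul (mkL l') (mkU u') ->
  u' = star_up u l /\ l' = star_lo u l.
Proof.
move=> s0 e.
have d n : u n + l n = u' n + (if n is n'.+1 then l' n' else 0).
  by have := congr1 (fun X => X n n) e; rewrite /= UL_entry LU_entry !eqxx.
have s n : u n.+1 * l n = l' n * u' n.
  have := congr1 (fun X => X n.+1 n) e; rewrite /= UL_entry LU_entry eqxx.
  by rewrite !ltn_eqF.
have ue n : u' n = star_up u l n.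
  elim: n => [|n IH]; first by rewrite /= d addr0.
  by rewrite star_upS d /star_lo s -IH mulfK// addrK.
split; apply/funext => n; first exact: ue.
by rewrite /star_lo s -ue mulfK.
Qed.

Definition cstep (s s' : seq cfactor) := exists s1 u l s2,
  s = s1 ++ [:: (false, u); (true, l)] ++ s2 /\
  s' = s1 ++ [:: (true, star_lo u l); (false, star_up u l)] ++ s2.

Definition creach := clos_refl_trans_1n (seq cfactor) cstep.

Definition pos_list (s : seq cfactor) :=
  forall k, (k < size s)%N -> pos_factor (nth (true, fun=> 0) s k).

Lemma pos_list_cat s1 s2 : pos_list (s1 ++ s2) <-> pos_list s1 /\ pos_list s2.
Proof.
rewrite /pos_list size_cat; split=> [h|[h1 h2] k].
  split=> k ks; first by have := h k; rewrite nth_cat ks; apply; rewrite ltn_addr.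
  have := h (size s1 + k)%N; rewrite nth_cat addKn ltn_add2l.
  by rewrite (_ : (_ + k < size s1)%N = false); [exact|apply/negbTE; rewrite -leqNgt leq_addr].
move=> kss; rewrite nth_cat; case: (ltnP k (size s1)) => ks; first exact: h1.
by apply: h2; rewrite ltn_subLR.
Qed.

Lemma pos_list_cons f s : pos_list (f :: s) <-> pos_factor f /\ pos_list s.
Proof.
split=> [h|[h1 h2] [|k] ks //]; last exact: h2.
by split=> [|k ks]; [exact: (h 0%N)|exact: (h k.+1)].
Qed.

Lemma pos_list_mid s1 f g s2 : pos_list (s1 ++ [:: f; g] ++ s2) <->
  [/\ pos_list s1, pos_factor f, pos_factor g & pos_list s2].
Proof.
split=> [/pos_list_cat[h1 /pos_list_cons[hf /pos_list_cons[hg h2]]]//|[h1 hf hg h2]].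
by apply/pos_list_cat; split=> //; apply/pos_list_cons; split=> //; apply/pos_list_cons.
Qed.

Lemma pos_list_star s1 u l s2 :
  pos_list (s1 ++ [:: (false, u); (true, l)] ++ s2) ->
  pos_list (s1 ++ [:: (true, star_lo u l); (false, star_up u l)] ++ s2).
Proof.
move=> /pos_list_mid[h1 hu hl h2].
have lo : pos_factor (true, star_lo u l) by move=> n; exact: star_lo_gt0.
have up : pos_factor (false, star_up u l) by move=> n; exact: star_up_gt0.
exact/pos_list_mid.
Qed.

Lemma cstep_star s s' : pos_list s -> cstep s s' ->
  star_step (map to_factor s) (map to_factor s').
Proof.
move=> ps [s1 [u [l [s2 [es es']]]]]; subst s s'.
have ps' := pos_list_star ps.
move: ps ps' => /pos_list_mid[_ hu hl _] /pos_list_mid[_ hl' hu' _].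
exists (map to_factor s1), (map to_factor s2), (mkU u), (mkL l),
  (mkL (star_lo u l)), (mkU (star_up u l)); split => //.
- by rewrite map_cat.
- by rewrite map_cat.
- exact: (pos_to_factor hl').
- exact: (pos_to_factor hu').
- move=> i j; rewrite star_mul// => n; apply: lt0r_neq0; exact: hu'.
Qed.

Lemma map_cat_inv (T S : Type) (f : T -> S) s a b : map f s = a ++ b ->
  exists s1 s2, [/\ s = s1 ++ s2, map f s1 = a & map f s2 = b].
Proof.
move=> e; exists (take (size a) s), (drop (size a) s).
by rewrite cat_take_drop map_take map_drop e take_size_cat// drop_size_cat.
Qed.

Lemma star_cstep s x : star_step (map to_factor s) x ->
  exists2 s', cstep s s' & x = map to_factor s'.
Proof.
move=> [s1 [s2 [U [L [L' [U' [es ex nL nU /imxP e]]]]]]].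
have [t1 [t2 [-> e1 e2]]] := map_cat_inv es.
case: t2 e2 => [//|[[] u] [|[[] l] t2]]//= [eu el e2].
case: nL nU => nL' L0 [nU' U0].
move=> {es}; subst U L.
have lE := normalized_lowerE nL'; have uE := normalized_upperE nU'.
rewrite lE uE in e; case: (star_unique _ e) => [n|]; first exact: lt0r_neq0.
move=> u'E l'E.
exists (t1 ++ [:: (true, star_lo u l); (false, star_up u l)] ++ t2).
  by exists t1, u, l, t2.
by rewrite ex map_cat /= -e1 -e2 lE uE u'E l'E.
Qed.

(** A refactorization whose word starts with a lower letter must have brought
    the first lower factor to the front. The passage through the upper factors
    before it leaves no choice, whence a function. *)
Fixpoint pull (s : seq cfactor) : option ((nat -> R) * seq cfactor) :=
  match s with
  | [::] => None
  | (true, l) :: s' => Some (l, s')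
  | (false, u) :: s' =>
      if pull s' is Some (l, s1) then
        Some (star_lo u l, (false, star_up u l) :: s1)
      else None
  end.

Lemma cstep_cons f s s' : cstep s s' -> cstep (f :: s) (f :: s').
Proof. by move=> [s1 [u [l [s2 [-> ->]]]]]; exists (f :: s1), u, l, s2. Qed.

(** A replacement either moves the first lower factor itself, and the pull
    absorbs it, or survives in the remaining list. *)
Lemma pull_step s s' l s1' : cstep s s' -> pull s' = Some (l, s1') ->
  exists2 s1, pull s = Some (l, s1) & s1 = s1' \/ cstep s1 s1'.
Proof.
move=> [t [u [m [t2 [-> ->]]]]].
elim: t l s1' => [|[[] f] t IH] l s1' /=.
- by move=> [<- <-]; exists ((false, star_up u m) :: t2) => //; left.
- move=> [<- <-]; eexists; first by [].
  by right; exists t, u, m, t2.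
- case E: (pull _) => [[l2 s2]|//] [<- <-].
  have [s3 -> [->|c]] := IH _ _ E; eexists => //; [by left|right].
  exact: cstep_cons.
Qed.

Lemma creach_lower s l x : creach s ((true, l) :: x) ->
  exists2 s1, pull s = Some (l, s1) & creach s1 x.
Proof.
move=> h; remember ((true, l) :: x) as y eqn:ey; elim: h ey => [s' ->|s' s2 y' st _ IH e].
  by exists x => //; exact: rt1n_refl.
have [s1 p1 r1] := IH e; have [s3 p3 [e3|st3]] := pull_step st p1.
  by exists s3 => //; rewrite e3.
by exists s3 => //; exact: rt1n_cons st3 r1.
Qed.

Lemma creach_upper s u x : creach s ((false, u) :: x) ->
  exists2 s1, s = (false, u) :: s1 & creach s1 x.
Proof.
move=> h; remember ((false, u) :: x) as y eqn:ey; elim: h ey => [s' ->|s' s2 y' st _ IH e].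
  by exists x => //; exact: rt1n_refl.
have [s1 p1 r1] := IH e; case: st => [[|f t] [v [m [t2 [-> e2]]]]]; rewrite p1 in e2 => //.
case: e2 => ef e2; rewrite -ef; eexists; first by [].
by apply: rt1n_cons r1; exists t, v, m, t2; rewrite e2.
Qed.

(** A refactorization is determined by the resulting word: its first letter
    tells what happened to the head of the list. *)
Lemma creach_word_inj s x y : creach s x -> creach s y ->
  map fst x = map fst y -> x = y.
Proof.
elim: x y s => [|[b f] x IH] [|[b' f'] y] s //= rx ry [eb exy].
case: b rx eb => rx eb; subst b'.
  have [s1 p1 r1] := creach_lower rx; have [s2 p2 r2] := creach_lower ry.
  move: p2; rewrite p1 => -[ef es]; subst.
  by rewrite (IH y s2).
have [s1 p1 r1] := creach_upper rx; have [s2 p2 r2] := creach_upper ry.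
move: p2; rewrite p1 => -[ef es]; subst.
by rewrite (IH y s2).
Qed.

Lemma creach_star s s' : pos_list s -> creach s s' ->
  star_refactor (map to_factor s) (map to_factor s').
Proof.
move=> ps h; elim: h ps => [x _|x y z xy _ IH px]; first exact: rt_refl.
apply: rt_trans (IH _); first by apply: rt_step; exact: cstep_star.
by move: xy px => [s1 [u [l [s2 [-> ->]]]]]; exact: pos_list_star.
Qed.

Lemma star_creach s y : star_refactor (map to_factor s) y ->
  exists2 s', creach s s' & y = map to_factor s'.
Proof.
move=> h0; have := clos_rt_rt1n _ _ _ _ h0.
move ex: (map to_factor s) => x h; elim: h s ex {h0} => [x' s <-|x' y' z xy _ IH s e].
  by exists s => //; exact: rt1n_refl.
subst x'; have [s1 st1 e1] := star_cstep xy.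
have [s2 r2 e2] := IH _ (esym e1).
by exists s2 => //; exact: rt1n_cons st1 r2.
Qed.

(** The positions of the replacements depend on words only, so they can be
    carried out simultaneously for a family of factor lists. *)
Definition wstep (v v' : seq bool) := exists v1 v2,
  v = v1 ++ [:: false; true] ++ v2 /\ v' = v1 ++ [:: true; false] ++ v2.

Lemma reach_family (T : Type) (P : (T -> seq cfactor) -> Prop) (v w : seq bool) :
  (forall (s1 : T -> seq cfactor) (u l : T -> nat -> R) (s2 : T -> seq cfactor) v1 v2,
     (forall t, map fst (s1 t) = v1) -> (forall t, map fst (s2 t) = v2) ->
     P (fun t => s1 t ++ [:: (false, u t); (true, l t)] ++ s2 t) ->
     P (fun t => s1 t ++ [:: (true, star_lo (u t) (l t));
                           (false, star_up (u t) (l t))] ++ s2 t)) ->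
  clos_refl_trans_1n _ wstep v w ->
  forall s, (forall t, map fst (s t) = v) -> P s ->
  exists s', [/\ forall t, map fst (s' t) = w, P s' & forall t, creach (s t) (s' t)].
Proof.
move=> Pstep; elim=> {v w} [v|v v' w [v1 [v2 [-> ->]]] _ IH] s sv Ps.
  by exists s; split=> // t; exact: rt1n_refl.
pose d : cfactor := (true, fun=> 0).
pose s1 t := take (size v1) (s t).
pose s2 t := drop (size v1).+2 (s t).
pose u t := (nth d (s t) (size v1)).2.
pose l t := (nth d (s t) (size v1).+1).2.
have sE t : s t = s1 t ++ [:: (false, u t); (true, l t)] ++ s2 t.
  have [t1 [t2 [e e1 e2]]] := map_cat_inv (sv t).
  have sz : size v1 = size t1 by rewrite -e1 size_map.
  case: t2 e e2 => [//|[b0 f0] [//|[b1 f1] t2]] e [eb0 eb1 _].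
  rewrite /s1 /u /l /s2 sz e !nth_cat ltnn subnn /= ltnNge leqnSn /= subSn// subnn /=.
  rewrite take_size_cat// eb0 eb1 -(addn2 (size t1)) addnC -drop_drop.
  by rewrite drop_size_cat//= drop0.
have e1 t : map fst (s1 t) = v1 by rewrite /s1 map_take sv take_size_cat.
have e2 t : map fst (s2 t) = v2.
  rewrite /s2 map_drop sv; elim: (v1) => //=; exact: drop0.
have Ps' := Ps; rewrite (funext sE) in Ps'; have {}Ps' := Pstep _ _ _ _ _ _ e1 e2 Ps'.
have [|s' [sw Ps'' r]] := IH _ _ Ps'.
  by move=> t; rewrite map_cat /= e1 e2.
exists s'; split=> // t; apply: rt1n_cons (r t).
by exists (s1 t), (u t), (l t), (s2 t); split=> //; exact: sE.
Qed.

End Factors.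

(** * Words and dominance *)

Section Words.
Implicit Types (v w : seq bool).

Notation wreach := (clos_refl_trans_1n _ wstep).

Lemma wreach_trans v1 v2 v3 : wreach v1 v2 -> wreach v2 v3 -> wreach v1 v3.
Proof. by elim=> // x y z xy _ IH /IH; exact: rt1n_cons. Qed.

Lemma wreach_cons b v w : wreach v w -> wreach (b :: v) (b :: w).
Proof.
elim=> [x|x y z [v1 [v2 [-> ->]]] _ IH]; first exact: rt1n_refl.
by apply: rt1n_cons IH; exists (b :: v1), v2.
Qed.

Lemma wreach_rem v : true \in v -> wreach v (true :: rem true v).
Proof.
elim: v => //= -[] v IH; first by rewrite eqxx => _; exact: rt1n_refl.
rewrite inE /= => /IH h; apply: wreach_trans (wreach_cons false h) _.
by apply: rt1n_cons (rt1n_refl _ _ _); exists [::], (rem true v).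
Qed.

Lemma count_take_rem v k :
  count id (take k (rem true v)) = (count id (take k.+1 v)).-1.
Proof.
elim: v k => [|[] v IH] k; first by case: k.
  by [].
by case: k => [|k] /=; [case: v {IH}|exact: IH].
Qed.

(** Lower letters move to the front one swap at a time, so a word is
    reachable as soon as each of its prefixes has at least as many lower
    letters. *)
Lemma wreach_dominated v w : size v = size w -> count id v = count id w ->
  (forall k, (count id (take k v) <= count id (take k w))%N) -> wreach v w.
Proof.
elim: w v => [|[] w IH] v sz ct dom.
- by rewrite (size0nil sz); exact: rt1n_refl.
- have tv : true \in v by rewrite -has_pred1 has_count (eq_count (a2 := id)) ?ct// => -[].
  apply: wreach_trans (wreach_rem tv) (wreach_cons _ _); apply: IH.
  + by rewrite size_rem// sz.
  + have := count_take_rem v (size v); rewrite !take_oversize ?ct//.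
      by rewrite size_rem// leq_pred.
  + by move=> k; rewrite count_take_rem; have := dom k.+1; rewrite /=; lia.
- case: v sz ct dom => [|[] v]//= [sz] ct dom; first by have := dom 1%N; rewrite /= !take0.
  apply: wreach_cons; apply: IH => // k; have := dom k.+1; rewrite /=; lia.
Qed.

Lemma count_take_nseq k n b : count id (take k (nseq n b)) = (minn k n * b)%N.
Proof.
have [kn|nk] := leqP k n; first by rewrite take_nseq// count_nseq mulnC; case: b.
by rewrite take_oversize ?size_nseq 1?ltnW// count_nseq mulnC; case: b.
Qed.

Lemma count_take_cat k v w : count id (take k (v ++ w)) =
  (count id (take k v) + count id (take (k - size v) w))%N.
Proof.
rewrite take_cat; case: ltnP => kv.
  have -> : (k - size v = 0)%N by lia.
  by rewrite take0 addn0.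
by rewrite count_cat (take_oversize kv).
Qed.

Section SigmaMin.
Variables p q : nat.
Hypotheses (p0 : (0 < p)%N) (q0 : (0 < q)%N).
Let M := (p + q)%N.

Lemma step_rem_lt k : (step_rem p q k < M)%N.
Proof. by rewrite /step_rem ltn_mod addn_gt0 p0. Qed.

(** Going around the cycle: a lower letter adds [q] to the remainder, an upper
    letter subtracts [p]. *)
Lemma step_remS k : step_rem p q k.+1 =
  if (step_rem p q k < p)%N then (step_rem p q k + q)%N else (step_rem p q k - p)%N.
Proof.
have lt := step_rem_lt k.
rewrite {1}/step_rem mulSn addnC -modnDml -/(step_rem p q k); case: ifP => h.
  by rewrite modn_small// /M; lia.
have -> : (step_rem p q k + q = step_rem p q k - p + M)%N by rewrite /M; lia.
by rewrite modnDr modn_small// /M; rewrite /M in lt *; lia.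
Qed.

Lemma size_sigma_min : size (sigma_min p q) = M.
Proof. by rewrite size_map size_iota. Qed.

Lemma nth_sigma_min k : (k < M)%N -> nth true (sigma_min p q) k = (step_rem p q k < p)%N.
Proof. by move=> kM; rewrite (nth_map 0%N) ?size_iota// nth_iota. Qed.

(** The remainders of [k * q] wrap around once for every upper letter, so a
    prefix of length [k] has [(k * q) %/ (p + q)] of them. *)
Lemma sigma_min_count k : (k <= M)%N ->
  (k * q + M * count id (take k (sigma_min p q)) = M * k + step_rem p q k)%N.
Proof.
elim: k => [|k IH] kM; first by rewrite take0 /step_rem mul0n mod0n /= !muln0.
have kM' : (k < M)%N by [].
have {}IH := IH (ltnW kM').
rewrite (take_nth true) ?size_sigma_min// -cats1 count_cat /= addn0 nth_sigma_min//.
have lt := step_rem_lt k.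
by rewrite step_remS; case: ifP => h; rewrite /M in IH lt *; nia.
Qed.

Lemma sigma_min_countE k : (k <= M)%N ->
  (count id (take k (sigma_min p q)) <= k)%N /\
  (k * q < M * (k - count id (take k (sigma_min p q))).+1)%N /\
  (M * (k - count id (take k (sigma_min p q))) <= k * q)%N.
Proof.
move=> kM; have e := sigma_min_count kM.
have lt := step_rem_lt k.
have le : (count id (take k (sigma_min p q)) <= k)%N.
  by rewrite (leq_trans (count_size _ _))// size_take; case: ifP; lia.
by rewrite /M in e lt *; split=> //; split; nia.
Qed.

Lemma ceil_divP m n : (0 < n)%N -> (0 < m)%N ->
  ((ceil_div m n - 1) * n < m)%N /\ (0 < ceil_div m n)%N.
Proof.
move=> n0 m0; rewrite /ceil_div.
have e := divn_eq (m + n.-1) n; have lt := ltn_pmod (m + n.-1) n0.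
set d := (_ %/ _)%N in e *; set r := (_ %% _)%N in e lt *.
by split; nia.
Qed.

(** Dominance of every prefix. If the rotated word is [L^j U^q L^(p-j)], a
    failure would need a prefix of [sigma_min] with more upper letters than
    [k - j]; if it is [U^(q-b) L^p U^b], one with more than both [q - b] and
    [k - p]. The two ends of the range of [a] keep [j * q], resp. [b * p], below
    [p + q], which excludes this. *)
Lemma sigma_min_reach a : cyc_range p q a ->
  wreach (rot a.-1 (nseq p true ++ nseq q false)) (sigma_min p q).
Proof.
rewrite /cyc_range => /andP[a1 a2].
have [cp1 cp2] := ceil_divP q0 p0; have [cq1 cq2] := ceil_divP p0 q0.
set cp := ceil_div p q in a1 cp1 cp2 *; set cq := ceil_div q p in a2 cq1 cq2 *.
have cpp : (cp <= p)%N by nia.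
have szM : size (rot a.-1 (nseq p true ++ nseq q false)) = M.
  by rewrite size_rot size_cat !size_nseq.
have cM : count id (sigma_min p q) = p.
  have := sigma_min_count (leqnn M); rewrite take_oversize ?size_sigma_min//.
  by rewrite /step_rem modnMr /M; nia.
apply: wreach_dominated.
- by rewrite szM size_sigma_min.
- have h := seq.permP (permEl (perm_rot a.-1 (nseq p true ++ nseq q false))).
  by rewrite cM h count_cat !count_nseq /=; lia.
move=> k; have [kM|Mk] := leqP k M; last first.
  have h := seq.permP (permEl (perm_rot a.-1 (nseq p true ++ nseq q false))).
  have Mk' := ltnW Mk.
  rewrite !take_oversize ?szM ?size_sigma_min// cM h.
  by rewrite count_cat !count_nseq /=; lia.
have [ck1 [ck2 ck3]] := sigma_min_countE kM.
set c := count id (take k _) in ck1 ck2 ck3 *.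
have [ap|pa] := leqP a.-1 p.
- have -> : rot a.-1 (nseq p true ++ nseq q false) =
            (nseq (p - a.-1) true ++ nseq q false) ++ nseq a.-1 true.
    rewrite -[p in nseq p true](subnKC ap) nseqD -catA -{1}[a.-1](size_nseq _ true).
    by rewrite rot_size_cat.
  rewrite !count_take_cat size_cat !size_nseq !count_take_nseq !muln1 muln0 addn0.
  set j := (p - a.-1)%N.
  have jq : (j * q < M)%N by rewrite /M /j; nia.
  have pj : p = (j + a.-1)%N by rewrite /j; lia.
  have M0 : (0 < M)%N by rewrite /M; lia.
  have d1 : (k - c <= q)%N.
    by rewrite -(leq_pmul2l M0) (leq_trans ck3)// leq_mul2r kM orbT.
  have d2 : (k - c <= k - j)%N.
    rewrite -ltnS -(ltn_pmul2l M0) (leq_ltn_trans ck3)// mulnS.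
    have h : (k * q <= j * q + M * (k - j))%N.
      have kj : (k <= j + (k - j))%N by lia.
      rewrite (leq_trans (leq_mul kj (leqnn q)))// mulnDl leq_add2l mulnC leq_mul2r.
      by rewrite /M leq_addl orbT.
    by rewrite (leq_ltn_trans h)// ltn_add2r.
  by clear -ck1 d1 d2 pj; rewrite /minn; case: ifP; case: ifP; lia.
- pose b := (a.-1 - p)%N.
  have bq : (b < q)%N by rewrite /b; lia.
  have bp : (b * p < M)%N.
    have : (b <= cq)%N by rewrite /b; lia.
    by rewrite /M; nia.
  have -> : rot a.-1 (nseq p true ++ nseq q false) =
            nseq (q - b) false ++ (nseq p true ++ nseq b false).
    have -> : a.-1 = size (nseq p true ++ nseq b false).
      by rewrite size_cat !size_nseq /b; lia.
    have -> : q = (b + (q - b))%N by lia.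
    by rewrite nseqD catA rot_size_cat addKn.
  rewrite !count_take_cat !size_nseq !count_take_nseq !muln1 !muln0 add0n addn0.
  have d : (k - c <= q - b)%N || (k - c <= k - p)%N.
    rewrite -[_ || _]negbK negb_or -!ltnNge; apply/negP => /andP[d1 d2].
    have [x [kx xb]] : exists x, (k + x = M)%N /\ (x <= b)%N.
      exists (M - k)%N; split; first by lia.
      have : (M * (q - b).+1 <= k * q)%N.
        by rewrite (leq_trans _ ck3)// leq_mul2l d1 orbT.
      rewrite /M in bp kM *; clear -bp bq kM; nia.
    have : (M * (k - p).+1 <= k * q)%N.
      by rewrite (leq_trans _ ck3)// leq_mul2l d2 orbT.
    rewrite /M in bp kx *; have xp : (x * p <= b * p)%N by rewrite leq_mul2r xb orbT.
    clear -bp kx xp xb bq; have -> : (k - p = q - x)%N by lia.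
    have [y ey] : exists y, q = (x + y)%N by exists (q - x)%N; lia.
    have -> : (q - x = y)%N by lia.
    have -> : k = (p + y)%N by lia.
    have e1 : (p * q = p * x + p * y)%N by rewrite ey mulnDr.
    have e2 : (y * q = y * x + y * y)%N by rewrite -mulnDr -ey.
    by rewrite mulnDl !mulnS; nia.
  by clear -ck1 d bq; rewrite /minn; case: ifP => h; lia.
Qed.

End SigmaMin.
End Words.

(** * Lax equations of the factors *)

Section Calculus.
Variable R : realType.
Implicit Types (f g : R -> R) (x a b : R).

Lemma der_add f g x a b : is_derive x (1 : R) f a -> is_derive x (1 : R) g b ->
  is_derive x (1 : R) (fun y => f y + g y) (a + b).
Proof. by move=> fa gb; exact: is_deriveD. Qed.

Lemma der_sub f g x a b : is_derive x (1 : R) f a -> is_derive x (1 : R) g b ->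
  is_derive x (1 : R) (fun y => f y - g y) (a - b).
Proof. by move=> fa gb; exact: is_deriveB. Qed.

Lemma der_mul f g x a b : is_derive x (1 : R) f a -> is_derive x (1 : R) g b ->
  is_derive x (1 : R) (fun y => f y * g y) (a * g x + f x * b).
Proof.
move=> fa gb; apply: (is_derive_eq (is_deriveM fa gb)).
by rewrite /GRing.scale /= addrC [g x * a]mulrC.
Qed.

Lemma der_div f g x a b : g x != 0 ->
  is_derive x (1 : R) f a -> is_derive x (1 : R) g b ->
  is_derive x (1 : R) (fun y => f y / g y) ((a - f x / g x * b) / g x).
Proof.
move=> g0 fa gb; have gV := is_deriveV g0 gb.
apply: (is_derive_eq (der_mul fa gV)).
by rewrite /GRing.scale /=; field.
Qed.

Lemma der_sum n (h : 'I_n -> R -> R) x (d : 'I_n -> R) :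
  (forall i, is_derive x (1 : R) (h i) (d i)) ->
  is_derive x (1 : R) (fun y => \sum_(i < n) h i y) (\sum_(i < n) d i).
Proof.
move=> hd; have := is_derive_sum hd.
by rewrite (_ : \sum_(i < n) h i = fun y => \sum_(i < n) h i y)//;
  apply/funext => y; rewrite fct_sumE.
Qed.

Lemma der_ext f g x a : (forall y, f y = g y) ->
  is_derive x (1 : R) f a -> is_derive x (1 : R) g a.
Proof. by move=> /funext ->. Qed.

Lemma der_cst (c x : R) : is_derive x (1 : R) (fun=> c) 0.
Proof. exact: is_derive_cst. Qed.

Lemma der_unique f x a b : is_derive x (1 : R) f a -> is_derive x (1 : R) f b -> a = b.
Proof. by move=> fa fb; rewrite -(@derive_val _ _ _ _ _ _ _ fa) (@derive_val _ _ _ _ _ _ _ fb). Qed.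

End Calculus.

Section LaxEntries.
Variable R : realType.
Implicit Types (X Y Z A B C F : imx R) (u l : nat -> R).

Fixpoint mpow X m : imx R := if m is m'.+1 then imul X (mpow X m') else imx1 R.

Lemma rb_mpow X m : row_banded X -> row_banded (mpow X m).
Proof. by move=> rX; elim: m => [|m IH]; [exact: rb1|exact: rbM]. Qed.

Lemma mpow_comm X Y F m : row_banded X -> row_banded Y -> row_banded F ->
  imul X F = imul F Y -> imul (mpow X m) F = imul F (mpow Y m).
Proof.
move=> rX rY rF e; elim: m => [|m IH]; first by rewrite /= imul1m imulm1.
have rm := rb_mpow m rX.
by rewrite /= -imulA// IH !imulA// e.
Qed.

Lemma mul_mkU X u i j :
  imul X (mkU u) i j = X i j * u j + (if j is j'.+1 then X i j' else 0).
Proof.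
rewrite (@imulE _ j.+1) => [|k jk]; last first.
  by rewrite /mkU !ltn_eqF ?mulr0// ltnW.
rewrite big_ord_recr/= mkU_diag addrC; congr (_ + _).
case: j => [|j]; first by rewrite big_ord0.
rewrite big_ord_recr/= {2}/mkU gtn_eqF// eqxx mulr1 big1 ?add0r// => k _.
by have ki := ltn_ord k; rewrite /mkU !gtn_eqF ?mulr0//; lia.
Qed.

Lemma mul_mkL X l i j : imul X (mkL l) i j = X i j + X i j.+1 * l j.
Proof.
rewrite (@imulE _ j.+2) => [|k ik]; last first.
  by rewrite /mkL !gtn_eqF ?mulr0// ltnW.
rewrite !big_ord_recr/= mkL_sub {2}/mkL eqxx mulr1 big1 ?add0r// => k _.
have := ltn_ord k => ki.
by rewrite /mkL !ltn_eqF ?mulr0// ltnW.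
Qed.

(** If [A F = F B], the entries of [A_+ F - F B_+] cancel where both products
    agree with the full ones, and vanish for degree reasons on the other side:
    only the coefficients of [F] that are free to move remain. *)
Lemma lax_upper A B u i j : imul A (mkU u) = imul (mkU u) B ->
  imul (iupper A) (mkU u) i j - imul (mkU u) (iupper B) i j =
  if j == i then u i * (A i i - B i i) else 0.
Proof.
move=> e; have := congr1 (fun X => X i j) e.
rewrite /= !mul_mkU !mkU_mul /iupper => eij.
have [ij|ji|eq] := ltngtP i j.
- case: j ij eij => [//|j] ij eij.
  by rewrite -ltnS ij eij subrr.
- case: j ji eij => [|j] ji eij; first by rewrite mul0r mulr0 !addr0 subrr.
  by rewrite (leqNgt i j) (ltnW ji) /= mul0r mulr0 !addr0 subrr.
- subst j; rewrite addr0.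
  case: i {e eij} => [|i]; first by rewrite addr0 mulrBr mulrC.
  by rewrite ltnn addr0 mulrBr mulrC.
Qed.

Lemma lax_lower A B l i j : imul A (mkL l) = imul (mkL l) B ->
  imul (iupper A) (mkL l) i j - imul (mkL l) (iupper B) i j =
  if i == j.+1 then l j * (A j.+1 j.+1 - B j j) else 0.
Proof.
move=> e; have := congr1 (fun X => X i j) e.
rewrite /= !mul_mkL !mkL_mul /iupper => eij.
have [ij|ji] := leqP i j.
  rewrite (leqW ij) ltn_eqF ?ltnS//.
  case: i ij {e} eij => [|i] ij eij; first by rewrite eij subrr.
  by rewrite (ltnW ij) eij subrr.
have [->|ne] := eqVneq i j.+1.
  by rewrite !leqnn !add0r mulrBr mulrC.
have -> : (i <= j.+1)%N = false by lia.
case: i ji ne {e eij} => [//|i] ji ne.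
have -> : (i <= j)%N = false by lia.
by rewrite !add0r mul0r mulr0 subrr.
Qed.

(** The diagonal of the Lax equation of the product [U L = L' U'], written with
    either factorization. *)
Lemma star_lax_diag A B B' C u l n :
  let u' := star_up u l in let l' := star_lo u l in
  (forall n, u' n != 0) ->
  imul A (mkU u) = imul (mkU u) B -> imul B (mkL l) = imul (mkL l) C ->
  imul A (mkL l') = imul (mkL l') B' -> imul B' (mkU u') = imul (mkU u') C ->
  u n * (A n n - B n n) + l n * (B n.+1 n.+1 - C n n) =
  u' n * (B' n n - C n n) +
  (if n is n'.+1 then l' n' * (A n n - B' n' n') else 0).
Proof.
move=> u' l' u'0 AU BL AL BU.
have e1 := congr1 (fun X => X n n.+1) AU; rewrite /= mul_mkU mkU_mul in e1.
have e2 := congr1 (fun X => X n n) BL; rewrite /= mul_mkL mkL_mul in e2.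
have e3 := congr1 (fun X => X n n) AL; rewrite /= mul_mkL mkL_mul in e3.
have d0 : l' n * u' n = u n.+1 * l n by rewrite /l' /star_lo divfK.
case: n d0 e1 e2 e3 => [|n] d0 e1 e2 e3.
  have d1 : u' 0%N = u 0%N + l 0%N by [].
  rewrite !addr0 in e2 e3 *; rewrite d1 in d0 *.
  have E1 := congr1 (fun x => l 0%N * x) e1.
  have E2 := congr1 (fun x => u 0%N * x) e2.
  have E3 := congr1 (fun x => (u 0%N + l 0%N) * x) e3.
  have D0 := congr1 (fun x => A 0%N 1%N * x) d0.
  by move: E1 E2 E3 D0; lra.
have d1 : u' n.+1 = u n.+1 + l n.+1 - l' n by [].
have d2 : l' n * u' n = u n.+1 * l n by rewrite /l' /star_lo divfK.
have e4 := congr1 (fun X => X n n.+1) BU; rewrite /= mul_mkU mkU_mul in e4.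
rewrite d1 in d0 e4 *.
have E1 := congr1 (fun x => l n.+1 * x) e1.
have E2 := congr1 (fun x => u n.+1 * x) e2.
have E3 := congr1 (fun x => (u n.+1 + l n.+1 - l' n) * x) e3.
have E4 := congr1 (fun x => l' n * x) e4.
have D0 := congr1 (fun x => A n.+1 n.+2 * x) d0.
have D2 := congr1 (fun x => C n n.+1 * x) d2.
by move: E1 E2 E3 E4 D0 D2; lra.
Qed.

(** The star step carries the evolution of the two old factors to that of the
    two new ones; the rows are treated in the order in which they are computed. *)
Lemma star_flow (u l : R -> nat -> R) x A B B' C :
  let u' := star_up (u x) (l x) in let l' := star_lo (u x) (l x) in
  (forall n, u' n != 0) ->
  imul A (mkU (u x)) = imul (mkU (u x)) B -> imul B (mkL (l x)) = imul (mkL (l x)) C ->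
  imul A (mkL l') = imul (mkL l') B' -> imul B' (mkU u') = imul (mkU u') C ->
  (forall n, is_derive x (1 : R) (fun y => u y n) (u x n * (A n n - B n n))) ->
  (forall n, is_derive x (1 : R) (fun y => l y n) (l x n * (B n.+1 n.+1 - C n n))) ->
  (forall n, is_derive x (1 : R) (fun y => star_up (u y) (l y) n) (u' n * (B' n n - C n n))) /\
  (forall n, is_derive x (1 : R) (fun y => star_lo (u y) (l y) n)
     (l' n * (A n.+1 n.+1 - B' n n))).
Proof.
move=> u' l' u'0 AU BL AL BU du dl.
have E n := star_lax_diag n u'0 AU BL AL BU.
have lo n : is_derive x (1 : R) (fun y => star_up (u y) (l y) n) (u' n * (B' n n - C n n)) ->
    is_derive x (1 : R) (fun y => star_lo (u y) (l y) n) (l' n * (A n.+1 n.+1 - B' n n)).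
  move=> dn; rewrite /star_lo.
  apply: (is_derive_eq (der_div (u'0 n) (der_mul (du n.+1) (dl n)) dn)).
  rewrite /l' /star_lo -/(u' n); field.
  exact: u'0.
have up n : is_derive x (1 : R) (fun y => star_up (u y) (l y) n) (u' n * (B' n n - C n n)).
  elim: n => [|n IH].
    apply: (is_derive_eq (der_add (du 0%N) (dl 0%N))).
    by rewrite E addr0.
  apply: (is_derive_eq (der_sub (der_add (du n.+1) (dl n.+1)) (lo n IH))).
  by rewrite E addrK.
by split=> // n; exact: lo.
Qed.

End LaxEntries.

(** * Flows of cyclic factor lists *)

Section CyclicFlow.
Variable R : realType.
Implicit Types (s : seq (cfactor R)) (x : R) (A B C F P : imx R).

Definition fmx (f : cfactor R) : imx R := if f.1 then mkL f.2 else mkU f.2.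

Lemma factor_mxE f : factor_mx (to_factor f) = fmx f.
Proof. by case: f => -[]. Qed.

Lemma rb_fmx f : row_banded (fmx f).
Proof. by rewrite /fmx; case: f.1; [exact: rb_mkL|exact: rb_mkU]. Qed.

Definition lprod s : imx R := iprod (map fmx s).

Lemma rb_lprod s : row_banded (lprod s).
Proof. by elim: s => [|f s IH]; [exact: rb1|exact: rbM (rb_fmx f) IH]. Qed.

Lemma lprod_band s i j : (i + size s < j)%N -> lprod s i j = 0.
Proof.
elim: s i j => [|f s IH] i j /= ij; first by rewrite /lprod /= /imx1 ltn_eqF//; lia.
rewrite /lprod /= (@imulE _ 0) ?big_ord0// => k _.
have [ik|ik] := ltnP i.+1 k; last by rewrite [X in _ * X]IH ?mulr0//; lia.
rewrite /fmx /mkL /mkU; case: ifP => _; first by rewrite !ltn_eqF ?mul0r//; lia.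
by rewrite !gtn_eqF ?mul0r//; lia.
Qed.

Lemma lprod_cat s1 s2 : lprod (s1 ++ s2) = imul (lprod s1) (lprod s2).
Proof.
elim: s1 => [|f s1 IH]; first by rewrite imul1m.
rewrite /lprod /= -/(lprod (s1 ++ s2)) IH imulA//; first exact: rb_fmx.
exact: rb_lprod.
Qed.

Lemma lprod1 f : lprod [:: f] = fmx f.
Proof. exact: imulm1. Qed.

Definition cyc s k := lprod (rot k s).

Lemma rb_cyc s k : row_banded (cyc s k).
Proof. exact: rb_lprod. Qed.

Definition dflt : cfactor R := (true, fun=> 0).

(** Both sides are the product around the whole cycle followed by the factor at
    which it started. *)
Lemma cyc_comm s k : (k < size s)%N ->
  imul (cyc s k) (fmx (nth dflt s k)) = imul (fmx (nth dflt s k)) (cyc s k.+1).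
Proof.
move=> ks; rewrite /cyc /rot (drop_nth dflt ks) (take_nth dflt ks).
rewrite !lprod_cat -cats1 !lprod_cat lprod1 -/(lprod _) -/([:: _] ++ _).
rewrite -cat1s lprod_cat lprod1.
have rb := rb_lprod; have rf := rb_fmx (nth dflt s k).
rewrite -!imulA//; do ?[exact: rbM]; exact: rb.
Qed.

(** Replacing two neighbours by another factorization of their product is seen
    by one cyclic product only, the one that starts between them. *)
Lemma cyc_replace s1 f g f' g' s2 j : imul (fmx f) (fmx g) = imul (fmx f') (fmx g') ->
  (j <= (size s1 + size s2).+2)%N -> j != (size s1).+1 ->
  cyc (s1 ++ [:: f; g] ++ s2) j = cyc (s1 ++ [:: f'; g'] ++ s2) j.
Proof.
move=> e jle jne; rewrite /cyc.
have E a b : lprod (a ++ [:: f; g] ++ b) = lprod (a ++ [:: f'; g'] ++ b).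
  rewrite !lprod_cat /lprod /= !imulm1 e.
  by [].
have [j1|j1] := leqP j (size s1).
  rewrite /rot !takel_cat// !drop_cat.
  have [lt|ge] := ltnP j (size s1); first by rewrite -!catA; exact: E.
  have -> : (j - size s1 = 0)%N by lia.
  by rewrite !drop0 -!catA; exact: (E [::]).
have jE : j = (size s1 + (2 + (j - (size s1).+2)))%N by lia.
have ln : forall a b : cfactor R, size (s1 ++ [:: a; b]) = (size s1).+2.
  by move=> a b; rewrite size_cat addn2.
have i2 : (j - (size s1).+2 <= size s2)%N by lia.
rewrite /rot !catA !drop_cat !take_cat !ln.
have -> : (j < (size s1).+2)%N = false by lia.
by have := E (drop (j - (size s1).+2) s2 ++ s1) (take (j - (size s1).+2) s2);
  rewrite -!catA.
Qed.

Definition flow_rhs s m k n : R :=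
  let f := nth dflt s k in
  f.2 n * (mpow (cyc s k) m (f.1 + n)%N (f.1 + n)%N - mpow (cyc s k.+1) m n n).

(** The [m]-th Lax flow reduced to the coefficients that can move: by
    [lax_lower] and [lax_upper] only diagonals of powers of the cyclic products
    on both sides of a factor occur. *)
Definition flow_at (s : R -> seq (cfactor R)) m x := forall k n, (k < size (s x))%N ->
  is_derive x (1 : R) (fun y => (nth dflt (s y) k).2 n) (flow_rhs (s x) m k n).

Lemma nth_mid s1 (f g : cfactor R) s2 k : nth dflt (s1 ++ [:: f; g] ++ s2) k =
  if (k < size s1)%N then nth dflt s1 k else
  if k == size s1 then f else if k == (size s1).+1 then g
  else nth dflt s2 (k - (size s1).+2).
Proof.
rewrite nth_cat; case: ltnP => // ks.
have [->|n1] := eqVneq k (size s1); first by rewrite subnn.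
have [->|n2] := eqVneq k (size s1).+1; first by rewrite subSnn.
by have -> : (k - size s1 = (k - (size s1).+2).+2)%N by lia.
Qed.

(** Outside the replaced pair neither the factors nor the neighbouring cyclic
    products change; for the pair itself this is [star_flow]. *)
Lemma flow_star (s1 : R -> seq (cfactor R)) (u l : R -> nat -> R)
    (s2 : R -> seq (cfactor R)) n1 n2 m x :
  (forall y, size (s1 y) = n1) -> (forall y, size (s2 y) = n2) ->
  (forall n, star_up (u x) (l x) n != 0) ->
  flow_at (fun y => s1 y ++ [:: (false, u y); (true, l y)] ++ s2 y) m x ->
  flow_at (fun y => s1 y ++ [:: (true, star_lo (u y) (l y));
                               (false, star_up (u y) (l y))] ++ s2 y) m x.
Proof.
move=> sz1 sz2 up0 fl.
set s := fun y => _ in fl; set s' := fun y => _.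
have szs y : size (s y) = (n1 + n2).+2 by rewrite !size_cat sz1 sz2 /=; lia.
have szs' y : size (s' y) = (n1 + n2).+2 by rewrite !size_cat sz1 sz2 /=; lia.
have nE y k : nth dflt (s y) k = if (k < n1)%N then nth dflt (s1 y) k else
    if k == n1 then (false, u y) else if k == n1.+1 then (true, l y)
    else nth dflt (s2 y) (k - n1.+2) by rewrite nth_mid sz1.
have nE' y k : nth dflt (s' y) k = if (k < n1)%N then nth dflt (s1 y) k else
    if k == n1 then (true, star_lo (u y) (l y)) else
    if k == n1.+1 then (false, star_up (u y) (l y))
    else nth dflt (s2 y) (k - n1.+2) by rewrite nth_mid sz1.
have cycE j : (j <= (n1 + n2).+2)%N -> j != n1.+1 -> cyc (s' x) j = cyc (s x) j.
  move=> jn j1; rewrite /s /s' (@cyc_replace _ (false, u x) (true, l x)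
    (true, star_lo (u x) (l x)) (false, star_up (u x) (l x)))// ?sz1 ?sz2//.
  exact: star_mul.
pose A k := mpow (cyc (s x) k) m; pose A' k := mpow (cyc (s' x) k) m.
have AE j : (j <= (n1 + n2).+2)%N -> j != n1.+1 -> A' j = A j.
  by move=> jn j1; rewrite /A /A' cycE.
have comm k : (k < (n1 + n2).+2)%N ->
    imul (A k) (fmx (nth dflt (s x) k)) = imul (fmx (nth dflt (s x) k)) (A k.+1).
  move=> kn; apply: mpow_comm; [exact: rb_cyc|exact: rb_cyc|exact: rb_fmx|].
  by apply: cyc_comm; rewrite szs.
have comm' k : (k < (n1 + n2).+2)%N ->
    imul (A' k) (fmx (nth dflt (s' x) k)) = imul (fmx (nth dflt (s' x) k)) (A' k.+1).
  move=> kn; apply: mpow_comm; [exact: rb_cyc|exact: rb_cyc|exact: rb_fmx|].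
  by apply: cyc_comm; rewrite szs'.
have l1 : (n1 < (n1 + n2).+2)%N by lia.
have l2 : (n1.+1 < (n1 + n2).+2)%N by lia.
have := comm _ l1; have := comm _ l2; have := comm' _ l1; have := comm' _ l2.
have fl1 n := fl n1 n; have fl2 n := fl n1.+1 n.
rewrite /flow_rhs !szs -/(A _) -/(A _) in fl1 fl2.
have fl1' n := fl1 n l1; have fl2' n := fl2 n l2.
have E1 y : nth dflt (s y) n1 = (false, u y) by rewrite nE ltnn eqxx.
have E2 y : nth dflt (s y) n1.+1 = (true, l y).
  by rewrite nE ltnNge leqnSn /= eqxx gtn_eqF.
have E1' y : nth dflt (s' y) n1 = (true, star_lo (u y) (l y)) by rewrite nE' ltnn eqxx.
have E2' y : nth dflt (s' y) n1.+1 = (false, star_up (u y) (l y)).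
  by rewrite nE' ltnNge leqnSn /= eqxx gtn_eqF.
rewrite !E1 !E2 !E1' !E2' /fmx /= => c2' c1' c2 c1.
rewrite (AE n1) ?ltn_eqF// 1?ltnW// in c1'.
rewrite (AE n1.+2) ?gtn_eqF// in c2'.
have du n : is_derive x (1 : R) (fun y => u y n) (u x n * (A n1 n n - A n1.+1 n n)).
  have := fl1' n; rewrite !E1 /= add0n.
  by apply: der_ext => y; rewrite E1.
have dl n : is_derive x (1 : R) (fun y => l y n) (l x n * (A n1.+1 n.+1 n.+1 - A n1.+2 n n)).
  have := fl2' n; rewrite !E2 /= add1n.
  by apply: der_ext => y; rewrite E2.
have [dup dlo] := star_flow up0 c1 c2 c1' c2' du dl.
move=> k n; rewrite szs' => kn; rewrite /flow_rhs -/(A' _) -/(A' _).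
have [kn1|kn1] := ltnP k n1.
  rewrite !AE; [|lia..]; have := fl k n; rewrite szs /flow_rhs => /(_ kn).
  rewrite -/(A _) -/(A _) nE nE' kn1.
  by apply: der_ext => y; rewrite nE nE' kn1.
have [ek|kn2] := eqVneq k n1.
  subst k; rewrite (AE n1); [|lia..].
  rewrite E1' /= add1n; move: (dlo n); apply: der_ext => y; by rewrite E1'.
have [ek|kn3] := eqVneq k n1.+1.
  subst k; rewrite (AE n1.+2); [|lia..].
  rewrite E2' /= add0n; move: (dup n); apply: der_ext => y; by rewrite E2'.
have nF : (k < n1)%N = false by lia.
have F y : nth dflt (s' y) k = nth dflt (s y) k.
  by rewrite nE nE' nF (negbTE kn2) (negbTE kn3).
rewrite !AE; [|lia..]; rewrite F.
by have := fl k n; rewrite szs => /(_ kn); apply: der_ext => y; rewrite F.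
Qed.

Definition lax A B P : imx R := fun i j => imul (iupper A) P i j - imul P (iupper B) i j.

Lemma rb_iupper A : row_banded A -> row_banded (iupper A).
Proof.
by move=> [d Ad]; exists d => i j ij; rewrite /iupper; case: ifP => // _; exact: Ad.
Qed.

Lemma imul_lax A B C F P : row_banded A -> row_banded B -> row_banded C ->
  row_banded F -> row_banded P -> forall i j,
  lax A C (imul F P) i j = imul (lax A B F) P i j + imul F (lax B C P) i j.
Proof.
move=> /rb_iupper rA /rb_iupper rB /rb_iupper rC rF rP i j.
have -> : imul (lax A B F) P i j =
    imul (imul (iupper A) F) P i j - imul (imul F (iupper B)) P i j.
  have [d1 b1] := rbM rA rF; have [d2 b2] := rbM rF rB.
  rewrite !(@imulE _ (i + d1 + d2).+1) => [|k ik|k ik|k ik]; first last.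
  - by rewrite /lax b1 ?b2 ?subrr ?mul0r//; lia.
  - by rewrite b1 ?mul0r//; lia.
  - by rewrite b2 ?mul0r//; lia.
  by rewrite -sumrB; apply: eq_bigr => k _; rewrite mulrBl.
have -> : imul F (lax B C P) i j =
    imul F (imul (iupper B) P) i j - imul F (imul P (iupper C)) i j.
  have [d1 b1] := rF.
  rewrite !(@imulE _ (i + d1).+1) => [|k ik|k ik|k ik]; try by rewrite b1 ?mul0r//; lia.
  by rewrite -sumrB; apply: eq_bigr => k _; rewrite mulrBr.
by rewrite /lax !imulA// addrA subrK.
Qed.

Lemma fmx_lax f A B i j : imul A (fmx f) = imul (fmx f) B ->
  lax A B (fmx f) i j =
  if i == (f.1 + j)%N then f.2 j * (A (f.1 + j)%N (f.1 + j)%N - B j j) else 0.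
Proof.
rewrite /lax /fmx; case: f => -[] f /= e; first by rewrite lax_lower// add1n.
by rewrite lax_upper// add0n eq_sym; case: eqP => // ->.
Qed.

(** Leibniz' rule along a segment of the list: by [imul_lax] the inner terms
    telescope. *)
Lemma der_segment (s : R -> seq (cfactor R)) v m x k n :
  (forall y, map fst (s y) = v) -> flow_at s m x -> (k + n <= size v)%N ->
  forall i j, is_derive x (1 : R) (fun y => lprod (take n (drop k (s y))) i j)
    (lax (mpow (cyc (s x) k) m) (mpow (cyc (s x) (k + n)) m)
         (lprod (take n (drop k (s x)))) i j).
Proof.
move=> sv fl; have sz y : size (s y) = size v by rewrite -(sv y) size_map.
have rA k' : row_banded (mpow (cyc (s x) k') m) by exact/rb_mpow/rb_cyc.
elim: n k => [|n IH] k kn i j.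
  rewrite take0 addn0 /lax imul1m imulm1 subrr.
  by have := der_cst (imx1 R i j) x; apply: der_ext => y; rewrite take0.
have kv : (k < size v)%N by lia.
have E y : lprod (take n.+1 (drop k (s y))) =
    imul (fmx (nth dflt (s y) k)) (lprod (take n (drop k.+1 (s y)))).
  by rewrite (drop_nth dflt) ?sz.
have fmx0 y i' j' : (i'.+1 < j')%N -> fmx (nth dflt (s y) k) i' j' = 0.
  rewrite /fmx /mkL /mkU => ij; case: ifP => _.
    by rewrite !ltn_eqF//; lia.
  by rewrite !gtn_eqF//; lia.
have sE y : imul (fmx (nth dflt (s y) k)) (lprod (take n (drop k.+1 (s y)))) i j =
    \sum_(a < i.+2) fmx (nth dflt (s y) k) i a * lprod (take n (drop k.+1 (s y))) a j.
  by apply: imulE => a ia; rewrite fmx0 ?mul0r.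
have comm := cyc_comm (_ : (k < size (s x))%N); rewrite sz in comm.
have {}comm := mpow_comm m (rb_cyc _ _) (rb_cyc _ _) (rb_fmx _) (comm kv).
have dF a : is_derive x (1 : R) (fun y => fmx (nth dflt (s y) k) i a)
    (lax (mpow (cyc (s x) k) m) (mpow (cyc (s x) k.+1) m) (fmx (nth dflt (s x) k)) i a).
  rewrite fmx_lax//; set b := (nth dflt (s x) k).1.
  have bE y : (nth dflt (s y) k).1 = b.
    by rewrite /b -!(nth_map _ true fst) ?sz// !sv.
  have fE y : fmx (nth dflt (s y) k) i a =
      if i == (b + a)%N then (nth dflt (s y) k).2 a else (if b then (i == a)%:R else (a == i.+1)%:R).
    rewrite /fmx bE /mkL /mkU; case: (b) => /=.
      have [->|] := eqVneq i a; first by rewrite add1n ltn_eqF.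
      by rewrite add1n; case: eqP => // ->; rewrite gtn_eqF.
    rewrite add0n [a == i]eq_sym; have [->//|_] := eqVneq i a.
    by case: eqP.
  apply: (der_ext (fun y => esym (fE y))); case: eqP => _; last exact: der_cst.
  by have := fl k a; rewrite sz /flow_rhs -/b; exact.
apply: (der_ext (fun y => esym (etrans (congr1 (fun X => X i j) (E y)) (sE y)))).
apply: (is_derive_eq (der_sum (fun a => der_mul (dF a) (IH k.+1 _ a j)))); first by lia.
rewrite big_split /= E (@imul_lax _ (mpow (cyc (s x) k.+1) m))//; try exact: rb_fmx; try exact: rb_lprod.
rewrite addSnnS; congr (_ + _).
  rewrite (@imulE _ i.+2)// => a ia.
  by rewrite fmx_lax// (_ : _ == _ = false) ?mul0r//; lia.
by rewrite (@imulE _ i.+2)// => a ia; rewrite fmx0 ?mul0r.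
Qed.

Lemma rot_full s : rot (size s) s = s.
Proof. by rewrite /rot drop_size take_size. Qed.

Lemma cyc_size s : cyc s (size s) = cyc s 0.
Proof. by rewrite /cyc rot_full rot0. Qed.

Lemma der_cyc (s : R -> seq (cfactor R)) v m x k :
  (forall y, map fst (s y) = v) -> flow_at s m x -> (k <= size v)%N ->
  forall i j, is_derive x (1 : R) (fun y => cyc (s y) k i j)
    (lax (mpow (cyc (s x) k) m) (mpow (cyc (s x) k) m) (cyc (s x) k) i j).
Proof.
move=> sv fl kv i j; have sz y : size (s y) = size v by rewrite -(sv y) size_map.
pose N := size v.
have rA k' : row_banded (mpow (cyc (s x) k') m) by exact/rb_mpow/rb_cyc.
have E y : cyc (s y) k =
    imul (lprod (take (N - k) (drop k (s y)))) (lprod (take k (drop 0 (s y)))).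
  by rewrite drop0 -lprod_cat take_oversize// size_drop sz.
have h1 : (k + (N - k) <= size v)%N by rewrite subnKC.
have d1 := der_segment sv fl h1; have d2 := der_segment sv fl (kv : (0 + k <= _)%N).
have cs : cyc (s x) (size v) = cyc (s x) 0 by rewrite -(sz x) cyc_size.
rewrite subnKC// cs in d1.
have b1 y i' j' : (i' + (N - k) < j')%N -> lprod (take (N - k) (drop k (s y))) i' j' = 0.
  move=> ij; apply: lprod_band; rewrite size_take size_drop sz.
  by rewrite -/N ltnn.
have sE y : cyc (s y) k i j = \sum_(a < (i + (N - k)).+1)
    lprod (take (N - k) (drop k (s y))) i a * lprod (take k (drop 0 (s y))) a j.
  by rewrite E; apply: imulE => a ia; rewrite b1 ?mul0r//; lia.
apply: (der_ext (fun y => esym (sE y))).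
apply: (is_derive_eq (der_sum (fun a => der_mul (d1 i a) (d2 a j)))).
have rk := rA k; move: (mpow (cyc (s x) k) m) rk d1 d2 => Ak rk d1 d2.
rewrite E (@imul_lax _ (mpow (cyc (s x) 0) m))//; try exact: rb_lprod.
rewrite big_split /=; congr (_ + _).
  rewrite (@imulE _ (i + (N - k)).+1)// => a ia.
  (* an entry of the product that vanishes identically has derivative zero *)
  rewrite (der_unique (d1 i a) (der_ext _ (der_cst 0 x))) ?mul0r// => y.
  by rewrite b1//; lia.
by rewrite (@imulE _ (i + (N - k)).+1)// => a ia; rewrite b1 ?mul0r//; lia.
Qed.

End CyclicFlow.

(** * The scalar Lax operator *)

Section DiffOpTheory.
Variable R : realType.
Variables p q : nat.
Hypotheses (p0 : (0 < p)%N) (q0 : (0 < q)%N).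
Implicit Types (Y : diffop R) (c : nat -> R) (k h j : int).

Definition site c h : R := if h is Posz n then c n else 0.

Lemma fsum2 (a b : int) (F : int -> R) : a != b ->
  (forall i, i != a -> i != b -> F i = 0) ->
  \sum_(i \in [set: int]) F i = F a + F b.
Proof.
move=> ab F0.
have -> : \sum_(i \in [set: int]) F i = \sum_(i \in [set a] `|` [set b]) F i.
  symmetry; apply: fsbig_widen => //= i [_ /= /not_orP[ia ib]].
  by apply: F0; apply/eqP.
rewrite fsbigU//=; first by rewrite !fsbig_set1.
by move=> i [/= -> e]; move: ab; rewrite e eqxx.
Qed.

Lemma qNp : (q%:Z == - p%:Z) = false.
Proof. by apply/eqP; lia. Qed.

Lemma lax_mul c Y k h : dop_mul (scalar_lax p q c) Y k h =
  Y (k - q%:Z) (h + q%:Z) + site c h * Y (k + p%:Z) (h - p%:Z).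
Proof.
rewrite /dop_mul (@fsum2 q%:Z (- p%:Z)) ?qNp//; last first.
  by move=> i /negbTE iq /negbTE ip; rewrite /scalar_lax iq ip addr0 mul0r.
rewrite /scalar_lax !eqxx qNp [- _ == _]eq_sym qNp addr0 mul1r add0r opprK.
by [].
Qed.

Lemma mul_lax c Y k h : dop_mul Y (scalar_lax p q c) k h =
  Y (k - q%:Z) h + Y (k + p%:Z) h * site c (h + k + p%:Z).
Proof.
rewrite /dop_mul (@fsum2 (k - q%:Z) (k + p%:Z)).
- rewrite /scalar_lax !subKr eqxx qNp addr0 mulr1.
  have -> : k - (k + p%:Z) = - p%:Z by lia.
  by rewrite eqxx [- _ == _]eq_sym qNp add0r addrA.
- by apply/eqP; lia.
- move=> i i1 i2; rewrite /scalar_lax.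
  have -> : (k - i == q%:Z) = false by apply/negbTE/eqP; move/eqP: i1; lia.
  have -> : (k - i == - p%:Z) = false by apply/negbTE/eqP; move/eqP: i2; lia.
  by rewrite addr0 mulr0.
Qed.

Lemma lax_pow_comm c n k h : dop_mul (scalar_lax p q c) (dop_pow (scalar_lax p q c) n) k h =
  dop_mul (dop_pow (scalar_lax p q c) n) (scalar_lax p q c) k h.
Proof.
elim: n k h => [|n IH] k h.
  rewrite lax_mul mul_lax /= /dop1; congr (_ + _).
  have [e|_] := eqVneq; last by rewrite mulr0 mul0r.
  by rewrite mulr1 mul1r; congr (site c _); lia.
set Y := dop_pow _ n in IH *.
rewrite mul_lax /= -/Y !(lax_mul c Y) lax_mul !IH !mul_lax.
have -> : h + q%:Z + (k - q%:Z) + p%:Z = h + k + p%:Z by lia.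
have -> : h - p%:Z + (k + p%:Z) + p%:Z = h + k + p%:Z by lia.
have -> : k + p%:Z - q%:Z = k - q%:Z + p%:Z by lia.
ring.
Qed.

(** Powers of the operator only contain shifts congruent to [n q] modulo
    [p + q], because [q] and [- p] are congruent. *)
Lemma lax_pow_support c n k h : ~~ ((p + q)%:Z %| k - (n * q)%:Z)%Z ->
  dop_pow (scalar_lax p q c) n k h = 0.
Proof.
elim: n k h => [|n IH] k h nd.
  rewrite /= /dop1; case: eqP => // k0; rewrite k0 mul0n subr0 dvdz0 in nd.
  by [].
rewrite /= lax_mul !IH ?mulr0 ?addr0//.
  apply: contra nd => d; rewrite (_ : k - _ = k + p%:Z - (n * q)%:Z - (p + q)%:Z).
    by apply: rpredB => //; exact: dvdzz.
  by rewrite mulSn; lia.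
apply: contra nd => d; rewrite (_ : k - (n.+1 * q)%:Z = k - q%:Z - (n * q)%:Z)//.
by rewrite mulSn; lia.
Qed.

(** The full power commutes with the operator, so the truncation only matters
    for shifts below [q]. Between [- p] and [q] the support of the power leaves
    nothing but its coefficient of order zero, met at the shift [- p]. *)
Lemma scalar_flowE l c j h : scalar_flow p q l c j h =
  let Y := dop_pow (scalar_lax p q c) ((p + q) * l) in
  if j == - p%:Z then site c h * (Y 0 h - Y 0 (h - p%:Z)) else 0.
Proof.
rewrite /scalar_flow /dop_comm; set Y := dop_pow _ _.
have comm := lax_pow_comm c ((p + q) * l) j h; rewrite -/Y lax_mul mul_lax in comm.
rewrite lax_mul mul_lax /dop_plus /=.
have [qj|jq] := lerP q%:Z j.
  have -> : (j == - p%:Z) = false by apply/eqP; lia.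
  have -> : 0 <= j - q%:Z by lia.
  have -> : 0 <= j + p%:Z by lia.
  by rewrite comm subrr.
have -> : (0 <= j - q%:Z) = false by lia.
case: eqP => [ej|nj].
  rewrite ej addNr lexx !add0r (_ : h - p%:Z + p%:Z = h); last by lia.
  by rewrite mulrBr mulrC.
case: ifP => [jp|_]; last by rewrite mul0r mulr0 !addr0 subrr.
have Y0 h' : Y (j + p%:Z) h' = 0.
  apply: lax_pow_support; apply/negP => d.
  have : ((p + q)%:Z %| j + p%:Z)%Z.
    rewrite (_ : j + p%:Z = j + p%:Z - ((p + q) * l * q)%:Z + (p + q)%:Z * (l * q)%:Z).
      by apply: rpredD => //; exact: dvdz_mulr.
    by rewrite -PoszM mulnA subrK.
  move=> /dvdzP[a]; rewrite PoszD => ea.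
  have [a0|a0|a0] := ltgtP a 0; [nia|nia|].
  by apply: nj; rewrite a0 mul0r in ea; lia.
by rewrite !Y0 mul0r mulr0 !addr0 subrr.
Qed.

End DiffOpTheory.

Section ScalarReduction.
Variable R : realType.
Variables p q : nat.
Hypotheses (p0 : (0 < p)%N) (q0 : (0 < q)%N) (cpq : coprime p q).
Let M := (p + q)%N.
Implicit Types (s : seq (cfactor R)).

Lemma M_gt0 : (0 < M)%N. Proof. by rewrite addn_gt0 p0. Qed.

Lemma step_rem_mod k : step_rem p q (k %% M) = step_rem p q k.
Proof. by rewrite /step_rem modnMml. Qed.

Lemma step_rem_inj : {in [pred k | k < M]%N &, injective (step_rem p q)}.
Proof.
move=> i j iM jM; wlog ij : i j iM jM / (i <= j)%N.
  by move=> W e; case/orP: (leq_total i j) => h; [exact: W|symmetry; exact: W].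
move=> /eqP; rewrite /step_rem eq_sym eqn_mod_dvd ?leq_mul2r ?ij ?orbT//.
rewrite -mulnBl Gauss_dvdl; last first.
  by rewrite coprime_sym /coprime gcdnDr gcdnC.
move=> d; apply/eqP; rewrite eqn_leq ij /= -subn_eq0; apply: contraLR d.
rewrite -lt0n => d0; rewrite gtnNdvd//.
by rewrite (leq_ltn_trans (leq_subr _ _)).
Qed.

Lemma index_step_rem k : (k < M)%N ->
  index (step_rem p q k) [seq step_rem p q k | k <- iota 0 M] = k.
Proof.
move=> kM; have sz : size [seq step_rem p q k | k <- iota 0 M] = M.
  by rewrite size_map size_iota.
have {1}-> : step_rem p q k = nth 0%N [seq step_rem p q k | k <- iota 0 M] k.
  by rewrite (nth_map 0%N) ?size_iota// nth_iota.
apply: index_uniq; first by rewrite sz.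
rewrite map_inj_in_uniq ?iota_uniq// => i j; rewrite !mem_iota /= add0n.
exact: step_rem_inj.
Qed.

Lemma step_rem_surj r : (r < M)%N -> exists2 k, (k < M)%N & step_rem p q k = r.
Proof.
move=> rM; pose f (i : 'I_M) : 'I_M := Ordinal (step_rem_lt q p0 i).
have fi : injective f.
  move=> i j /(congr1 val) /= e; apply: val_inj.
  by apply: step_rem_inj e; rewrite inE ltn_ord.
have [g gK fK] := injF_bij fi.
exists (g (Ordinal rM)) => //.
by have := congr1 val (fK (Ordinal rM)).
Qed.

Section OneList.
Variable s : seq (cfactor R).
Hypothesis sw : map fst s = sigma_min p q.
Let c := scalar_coef p q (map (@to_factor R) s).
Let f k := nth (dflt R) s (k %% M).

Lemma size_s : size s = M.
Proof. by rewrite -(size_map fst) sw size_sigma_min. Qed.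

Lemma f_lower k : (f k).1 = (step_rem p q k < p)%N.
Proof.
have kM := ltn_pmod k M_gt0.
rewrite /f -(nth_map _ true) ?size_s// sw nth_sigma_min//.
by rewrite step_rem_mod.
Qed.

Lemma scalar_coefE n k : c (M * n + step_rem p q k) =
  if (f k).1 then (if n is n'.+1 then (f k).2 n' else 0) else (f k).2 n.
Proof.
rewrite /c /scalar_coef -/M; have kM := ltn_pmod k M_gt0.
have rM := step_rem_lt q p0 k.
rewrite mulnC modnMDl modn_small// -step_rem_mod index_step_rem// step_rem_mod.
rewrite divnMDl ?M_gt0// divn_small// addn0.
rewrite (nth_map (dflt R)) ?size_s//.
have fl := f_lower k; rewrite /f in fl *.
case: (nth _ _ _) fl => -[] g /= fl.
  case: n => [|n]; first by rewrite mul0n add0n -fl.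
  rewrite mkL_sub (_ : (_ < p)%N = false)//; rewrite /M in rM *; nia.
rewrite mkU_diag (_ : (_ < p)%N = false)//.
have := esym fl => /negbT; rewrite -leqNgt => h; lia.
Qed.

(** Products of [m] consecutive factors that may run around the cycle several
    times, as the powers of the scalar operator do. *)
Fixpoint cprod k m : imx R :=
  if m is m'.+1 then imul (fmx (f k)) (cprod k.+1 m') else imx1 R.

Lemma rb_cprod k m : row_banded (cprod k m).
Proof. by elim: m k => [|m IH] k; [exact: rb1|exact: rbM (rb_fmx _) (IH _)]. Qed.

Lemma cprodD k m n : cprod k (m + n) = imul (cprod k m) (cprod (k + m) n).
Proof.
elim: m k => [|m IH] k; first by rewrite addn0 imul1m.
by rewrite addSn /= IH addSnnS imulA//; [exact: rb_fmx|exact: rb_cprod].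
Qed.

Lemma cprod_mod k m : cprod (k + M) m = cprod k m.
Proof. by elim: m k => [//|m IH] k; rewrite /= -addSn IH /f modnDr. Qed.

Lemma cprod_lprod k m : (k + m <= M)%N -> cprod k m = lprod (take m (drop k s)).
Proof.
elim: m k => [|m IH] k km; first by rewrite take0.
have kM : (k < M)%N by lia.
by rewrite /= IH ?addSnnS// [in RHS](drop_nth (dflt R)) ?size_s// /f modn_small.
Qed.

Lemma cprod_cyc k m : (k <= M)%N -> cprod k (M * m) = mpow (cyc s k) m.
Proof.
move=> kM; have e : cprod k M = cyc s k.
  have -> : cprod k M = imul (cprod k (M - k)) (cprod (0 + M) k).
    by rewrite -[X in cprod k X = _](subnK kM) cprodD subnKC.
  rewrite cprod_mod !cprod_lprod ?subnKC// drop0 -lprod_cat.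
  by rewrite take_oversize// size_drop size_s.
elim: m => [|m IH]; first by rewrite muln0.
by rewrite mulnS cprodD cprod_mod IH e.
Qed.

(** On the sites congruent to [step_rem k], numbered by their quotients, the
    scalar operator acts as the [k]-th factor. *)
Lemma lax_pow_cprod m n n' k :
  dop_pow (scalar_lax p q c) m
    ((M * n' + step_rem p q (k + m))%N%:Z - (M * n + step_rem p q k)%N%:Z)
    (M * n + step_rem p q k)%N%:Z = cprod k m n n'.
Proof.
elim: m n k => [|m IH] n k.
  rewrite addn0 /= /dop1 /imx1; congr ((_ : bool)%:R).
  by apply/eqP/eqP; have := M_gt0; nia.
rewrite /= lax_mul// /site scalar_coefE /fmx.
have rS := step_remS p0 q0 k; rewrite f_lower; case: ifP rS => h rS.
  rewrite mkL_mul; congr (_ + _).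
    rewrite -(IH n k.+1) addSnnS; congr (dop_pow _ _ _ _); lia.
  case: n => [|n]; first by rewrite mul0r.
  congr (_ * _); rewrite -(IH n k.+1) addSnnS; congr (dop_pow _ _ _ _); rewrite /M; nia.
rewrite mkU_mul addrC; have hp : (p <= step_rem p q k)%N by lia.
congr (_ * _ + _).
  rewrite -(IH n k.+1) addSnnS; congr (dop_pow _ _ _ _); rewrite /M; nia.
rewrite -(IH n.+1 k.+1) addSnnS; congr (dop_pow _ _ _ _); rewrite /M; nia.
Qed.

Lemma lax_pow_diag l n k : (k <= M)%N ->
  dop_pow (scalar_lax p q c) (M * l) 0 (M * n + step_rem p q k)%N%:Z =
  mpow (cyc s k) l n n.
Proof.
move=> kM; rewrite -cprod_cyc// -lax_pow_cprod.
have -> : step_rem p q (k + M * l) = step_rem p q k.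
  by rewrite -step_rem_mod addnC mulnC modnMDl step_rem_mod.
by rewrite subrr.
Qed.

End OneList.

Lemma site_cases (h : nat) : exists n k, (k < M)%N /\ h = (M * n + step_rem p q k)%N.
Proof.
have [k kM e] := step_rem_surj (ltn_pmod h M_gt0).
by exists (h %/ M)%N, k; split=> //; rewrite e mulnC -divn_eq.
Qed.

Lemma flow_scalar (s : R -> seq (cfactor R)) l x :
  (forall y, map fst (s y) = sigma_min p q) -> flow_at s l x ->
  let c y := scalar_coef p q (map (@to_factor R) (s y)) in
  forall j h, is_derive x (1 : R) (fun y => scalar_lax p q (c y) j h)
    (scalar_flow p q l (c x) j h).
Proof.
move=> sw fl c j h; rewrite scalar_flowE//=.
have lE y : scalar_lax p q (c y) j h =
  (j == q%:Z)%:R + (if j == - p%:Z then site (c y) h else 0) by [].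
apply: (der_ext (fun y => esym (lE y))).
have [->|_] := eqVneq j (- p%:Z); last exact: der_cst.
rewrite [- _ == _]eq_sym qNp//.
suff : is_derive x (1 : R) (fun y => site (c y) h)
   (site (c x) h * (dop_pow (scalar_lax p q (c x)) (M * l) 0 h -
                    dop_pow (scalar_lax p q (c x)) (M * l) 0 (h - p%:Z))).
  by apply: der_ext => y; rewrite add0r.
case: h {lE} => h; last by rewrite /= mul0r; exact: der_cst.
have [n [k [kM ->]]] := site_cases h.
rewrite lax_pow_diag// 1?ltnW//.
have szx : size (s x) = M by exact: size_s.
have := fl k; rewrite szx => fk; rewrite /site /c.
have rS := step_remS p0 q0 k.
have fL y := f_lower (sw y) k; rewrite modn_small// in fL.
have cE y := scalar_coefE (sw y) n k; rewrite modn_small// in cE.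
rewrite (cE x) fL.
have {}cE y := etrans (cE y) (congr1 (fun b : bool => if b then _ else _) (fL y)).
case: ifP rS cE => h1 rS cE.
  case: n cE => [|n] cE.
    rewrite mul0r; have := der_cst (0 : R) x; apply: der_ext => y; by rewrite cE.
  have -> : (M * n.+1 + step_rem p q k)%N%:Z - p%:Z = (M * n + step_rem p q k.+1)%N%:Z.
    by rewrite rS /M; nia.
  rewrite lax_pow_diag//; have := fk n kM; rewrite /flow_rhs fL h1 add1n.
  by apply: der_ext => y; rewrite cE.
have -> : (M * n + step_rem p q k)%N%:Z - p%:Z = (M * n + step_rem p q k.+1)%N%:Z.
  by rewrite rS; lia.
rewrite lax_pow_diag//; have := fk n kM; rewrite /flow_rhs fL h1 add0n.
by apply: der_ext => y; rewrite cE.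
Qed.

End ScalarReduction.

(** * Rational functions of the moments *)

Section DetRational.
Variable R : realType.

Lemma det_rational_comp (S T : Type) (phi : S -> T) (X : T -> imx R) f :
  det_rational X f -> det_rational (fun y => X (phi y)) (fun y => f (phi y)).
Proof.
elim=> [r s|f1 g1 _ IHf _ IHg|f1 g1 _ IHf _ IHg|f1 g1 _ IHf _ IHg|f1 g1 _ IHf _ IHg g0|n f1 _ IH].
- exact: (DR_entry (fun y => X (phi y))).
- exact: DR_add.
- exact: DR_sub.
- exact: DR_mul.
- by apply: DR_div => // t; exact: g0.
- exact: (DR_det (f := fun i j y => f1 i j (phi y))).
Qed.

Lemma det_rational_ext (T : Type) (X : T -> imx R) f g : f =1 g ->
  det_rational X f -> det_rational X g.
Proof. by move=> /funext ->. Qed.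

Lemma det_rational_subst (T : Type) (X Y : T -> imx R) f :
  (forall r s, det_rational X (fun t => Y t r s)) ->
  det_rational Y f -> det_rational X f.
Proof.
move=> XY; elim=> [r s|f1 g1 _ IHf _ IHg|f1 g1 _ IHf _ IHg|f1 g1 _ IHf _ IHg|f1 g1 _ IHf _ IHg g0|n f1 _ IH].
- exact: XY.
- exact: DR_add.
- exact: DR_sub.
- exact: DR_mul.
- exact: DR_div.
- exact: DR_det.
Qed.

Lemma det_rational0 (T : Type) (X : T -> imx R) : det_rational X (fun=> 0).
Proof.
apply: det_rational_ext (DR_sub (DR_entry X 0 0) (DR_entry X 0 0)) => t.
exact: subrr.
Qed.

Lemma ratr_closed_det (T : Type) (X : T -> imx R) f t0 :
  (forall r s, exists x : rat, X t0 r s = ratr x) ->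
  det_rational X f -> exists x : rat, f t0 = ratr x.
Proof.
move=> X0; elim=> [r s|f1 g1 _ [x ->] _ [y ->]|f1 g1 _ [x ->] _ [y ->]
  |f1 g1 _ [x ->] _ [y ->]|f1 g1 _ [x ->] _ [y ->] _|n f1 _ IH].
- exact: X0.
- by exists (x + y); rewrite rmorphD.
- by exists (x - y); rewrite rmorphB.
- by exists (x * y); rewrite rmorphM.
- by exists (x / y); rewrite fmorph_div.
- have [A AE] : exists A : 'I_n -> 'I_n -> rat, forall i j, f1 i j t0 = ratr (A i j).
    have c i : exists B : 'I_n -> rat, forall j, f1 i j t0 = ratr (B j).
      by have [B BE] := choice (IH i); exists B.
    by have [A AE] := choice c; exists A.
  exists (\det (\matrix_(i, j) A i j)); rewrite -det_map_mx; congr (\det _).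
  by apply/matrixP => i j; rewrite !mxE.
Qed.

Variable L : nat.
Implicit Types (t : 'I_L -> R) (f g : ('I_L -> R) -> R).

Lemma set_timeK t l : set_time t l (t l) = t.
Proof. by apply/funext => m; rewrite /set_time; case: eqP => // ->. Qed.

Lemma set_timeE t l y : set_time t l y l = y.
Proof. by rewrite /set_time eqxx. Qed.

Lemma partial_add l f g t a b : is_partial l f t a -> is_partial l g t b ->
  is_partial l (fun t => f t + g t) t (a + b).
Proof. exact: der_add. Qed.

Lemma partial_sub l f g t a b : is_partial l f t a -> is_partial l g t b ->
  is_partial l (fun t => f t - g t) t (a - b).
Proof. exact: der_sub. Qed.

Lemma partial_mul l f g t a b : is_partial l f t a -> is_partial l g t b ->
  is_partial l (fun t => f t * g t) t (a * g t + f t * b).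
Proof. by move=> fa gb; have := der_mul fa gb; rewrite set_timeK. Qed.

Lemma partial_div l f g t a b : g t != 0 ->
  is_partial l f t a -> is_partial l g t b ->
  is_partial l (fun t => f t / g t) t ((a - f t / g t * b) / g t).
Proof.
move=> g0 fa gb; have g0' : (fun y => g (set_time t l y)) (t l) != 0 by rewrite /= set_timeK.
by have := der_div g0' fa gb; rewrite /= !set_timeK.
Qed.

Lemma partial_inv l f t a : f t != 0 -> is_partial l f t a ->
  is_partial l (fun t => (f t)^-1) t (- (a * (f t)^-1 * (f t)^-1)).
Proof.
move=> f0 fa; have f0' : (fun y => f (set_time t l y)) (t l) != 0 by rewrite /= set_timeK.
apply: (is_derive_eq (der_ext _ (der_div f0' (der_cst 1 (t l)) fa))).
  by move=> y; rewrite div1r.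
by rewrite /= set_timeK; field.
Qed.

Lemma partial_eq l f t a b : a = b -> is_partial l f t a -> is_partial l f t b.
Proof. by move=> ->. Qed.

(** Symmetry of the mixed derivatives is made part of the class: it holds for
    the moments by inspection and passes to rational functions by the usual
    rules, without any continuity of second derivatives. *)
Definition C2sym f := exists (g : 'I_L -> ('I_L -> R) -> R) (h : 'I_L -> 'I_L -> ('I_L -> R) -> R),
  [/\ forall l t, is_partial l f t (g l t),
      forall l m t, is_partial m (g l) t (h l m t) &
      forall l m t, h l m t = h m l t].

Lemma C2_cst (c : R) : C2sym (fun=> c).
Proof.
exists (fun _ _ => 0), (fun _ _ _ => 0); split=> // *; exact: der_cst.
Qed.

Lemma C2_add f g : C2sym f -> C2sym g -> C2sym (fun t => f t + g t).
Proof.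
move=> [f1 [f2 [fd fdd fs]]] [g1 [g2 [gd gdd gs]]].
exists (fun l t => f1 l t + g1 l t), (fun l m t => f2 l m t + g2 l m t).
by split=> [l t|l m t|l m t]; [exact: partial_add|exact: partial_add|rewrite fs gs].
Qed.

Lemma C2_sub f g : C2sym f -> C2sym g -> C2sym (fun t => f t - g t).
Proof.
move=> [f1 [f2 [fd fdd fs]]] [g1 [g2 [gd gdd gs]]].
exists (fun l t => f1 l t - g1 l t), (fun l m t => f2 l m t - g2 l m t).
by split=> [l t|l m t|l m t]; [exact: partial_sub|exact: partial_sub|rewrite fs gs].
Qed.

Lemma C2_mul f g : C2sym f -> C2sym g -> C2sym (fun t => f t * g t).
Proof.
move=> [f1 [f2 [fd fdd fs]]] [g1 [g2 [gd gdd gs]]].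
exists (fun l t => f1 l t * g t + f t * g1 l t),
  (fun l m t => (f2 l m t * g t + f1 l t * g1 m t) + (f1 m t * g1 l t + f t * g2 l m t)).
split=> [l t|l m t|l m t]; first exact: partial_mul.
  by apply: partial_add; apply: partial_mul.
by rewrite fs gs; ring.
Qed.

Lemma C2_inv f : (forall t, f t != 0) -> C2sym f -> C2sym (fun t => (f t)^-1).
Proof.
move=> f0 [f1 [f2 [fd fdd fs]]].
exists (fun l t => 0 - f1 l t * (f t)^-1 * (f t)^-1),
  (fun l m t => 2 * f1 l t * f1 m t * (f t)^-1 ^+ 3 - f2 l m t * (f t)^-1 ^+ 2).
split=> [l t|l m t|l m t]; last by rewrite fs; ring.
  by rewrite sub0r; exact: partial_inv.
apply: partial_eq (partial_sub (der_cst 0 (t m))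
  (partial_mul (partial_mul (fdd l m t) (partial_inv (f0 t) (fd m t))) (partial_inv (f0 t) (fd m t)))).
by move: (f0 t) => ?; field.
Qed.

Lemma C2_det n (f : 'I_n -> 'I_n -> ('I_L -> R) -> R) :
  (forall i j, C2sym (f i j)) ->
  C2sym (fun t => \det (\matrix_(i < n, j < n) f i j t)).
Proof.
move=> fC; have sumC (I : Type) (r : seq I) (F : I -> ('I_L -> R) -> R) :
    (forall i, C2sym (F i)) -> C2sym (fun t => \sum_(i <- r) F i t).
  move=> FC; elim: r => [|i r IH].
    by rewrite (_ : (fun t => _) = (fun=> 0)); [exact: C2_cst|apply/funext => t; rewrite big_nil].
  rewrite (_ : (fun t => _) = (fun t => F i t + \sum_(j <- r) F j t)).
    exact: C2_add.
  by apply/funext => t; rewrite big_cons.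
have prodC (I : Type) (r : seq I) (F : I -> ('I_L -> R) -> R) :
    (forall i, C2sym (F i)) -> C2sym (fun t => \prod_(i <- r) F i t).
  move=> FC; elim: r => [|i r IH].
    by rewrite (_ : (fun t => _) = (fun=> 1)); [exact: C2_cst|apply/funext => t; rewrite big_nil].
  rewrite (_ : (fun t => _) = (fun t => F i t * \prod_(j <- r) F j t)).
    exact: C2_mul.
  by apply/funext => t; rewrite big_cons.
rewrite (_ : (fun t => _) = fun t => \sum_(s : 'S_n) (-1) ^+ s * \prod_(i < n) f i (s i) t).
  apply: sumC => s; apply: C2_mul; first exact: C2_cst.
  exact: prodC.
apply/funext => t; apply: eq_bigr => s _; congr (_ * _).
by apply: eq_bigr => i _; rewrite mxE.
Qed.

Lemma det_rational_C2 (X : ('I_L -> R) -> imx R) f :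
  (forall r s, C2sym (fun t => X t r s)) -> det_rational X f -> C2sym f.
Proof.
move=> XC; elim=> [r s|f1 g1 _ IHf _ IHg|f1 g1 _ IHf _ IHg|f1 g1 _ IHf _ IHg|f1 g1 _ IHf _ IHg g0|n f1 _ IH].
- exact: XC.
- exact: C2_add.
- exact: C2_sub.
- exact: C2_mul.
- by apply: C2_mul => //; exact: C2_inv.
- exact: C2_det.
Qed.

End DetRational.

Section StarRational.
Variables (R : realType) (T : Type) (X : T -> imx R) (u l : T -> nat -> R).
Hypotheses (u0 : forall t n, 0 < u t n) (l0 : forall t n, 0 < l t n).
Hypotheses (du : forall n, det_rational X (fun t => u t n))
           (dl : forall n, det_rational X (fun t => l t n)).

Lemma star_det_rational n :
  det_rational X (fun t => star_up (u t) (l t) n) /\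
  det_rational X (fun t => star_lo (u t) (l t) n).
Proof.
have lo k : det_rational X (fun t => star_up (u t) (l t) k) ->
    det_rational X (fun t => star_lo (u t) (l t) k).
  move=> dk; apply: DR_div => //; first exact: DR_mul.
  by move=> t; apply/lt0r_neq0/star_up_gt0.
suff up : det_rational X (fun t => star_up (u t) (l t) n) by split=> //; exact: lo.
elim: n => [|n IH]; first exact: DR_add.
by apply: DR_sub; [exact: DR_add|exact: lo].
Qed.

End StarRational.

(** * Evolution of the pivots and of the connections *)

Section Elimination.
Variable R : realType.

Lemma shift_powM N (Y : imx R) r s : imul (mpow (shift_mx R) N) Y r s = Y (r + N)%N s.
Proof.
elim: N r => [|N IH] r; first by rewrite /= imul1m addn0.
rewrite /= -imulA; [|exact: rb_shift|exact/rb_mpow/rb_shift].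
by rewrite shiftM IH addSnnS.
Qed.

Lemma tau_det_rational (T : Type) (X : T -> imx R) n :
  det_rational X (fun t => tau (X t) n).
Proof. by apply: (DR_det (f := fun i j t => X t i j)) => i j; exact: DR_entry. Qed.

Lemma elim_det_rational (T : Type) (X : T -> imx R) n k :
  (forall t n, tau (X t) n != 0) -> det_rational X (fun t => elim_mx (X t) n k).
Proof.
move=> t0; have [kn|kn] := leqP k n; last first.
  by apply: det_rational_ext (det_rational0 X) => t; rewrite elim_mx_lower.
rewrite /elim_mx kn.
apply: DR_div; [|exact: tau_det_rational|by move=> t; exact: t0].
pose e := ((inord k : 'I_n.+1) + (ord_max : 'I_n.+1))%N.
pose g t : R := \det (\matrix_(i < n, j < n)
   (X t (lift (inord k : 'I_n.+1) i) (lift (ord_max : 'I_n.+1) j))).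
have dg : det_rational X g.
  apply: (DR_det (f := fun i j t =>
    X t (lift (inord k : 'I_n.+1) i) (lift (ord_max : 'I_n.+1) j))) => i j.
  exact: DR_entry.
have gE t : cofactor (\matrix_(i < n.+1, j < n.+1) X t i j) (inord k) ord_max = (-1) ^+ (odd e) * g t.
  rewrite /cofactor signr_odd; congr (_ * \det _).
  by apply/matrixP => i j; rewrite !mxE.
apply: det_rational_ext (fun t => esym (gE t)) _.
case: (odd e); last by apply: det_rational_ext dg => t; rewrite mul1r.
apply: det_rational_ext (DR_sub (det_rational0 X) dg) => t.
by rewrite expr1 mulN1r sub0r.
Qed.

Lemma pivot_det_rational (T : Type) (X : T -> imx R) n :
  (forall t n, tau (X t) n != 0) -> det_rational X (fun t => pivot (X t) n).
Proof.
by move=> t0; apply: DR_div => [||t]; [exact: tau_det_rational..|exact: t0].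
Qed.

Lemma elim_sum (M : imx R) n j :
  imul (elim_mx M) M n j = \sum_(i < n.+1) elim_mx M n i * M i j.
Proof. by apply: imulE => k nk; rewrite elim_mx_lower ?mul0r. Qed.

Lemma elimT_sum (M : imx R) n i :
  imul (elim_mx (itr M)) (itr M) n i = \sum_(j < n.+1) M i j * elim_mx (itr M) n j.
Proof. by rewrite elim_sum; apply: eq_bigr => j _; exact: mulrC. Qed.

(** Eliminating on both sides of [M] leaves the pivots; as both eliminations
    annihilate the entries that their own variation meets, only the variation
    of [M] contributes to that of the pivot. *)
Lemma der_pivot (Mx : R -> imx R) x N n :
  (forall y n, tau (Mx y) n != 0) ->
  (forall k, exists v, is_derive x (1 : R) (fun y => elim_mx (Mx y) n k) v) ->
  (forall k, exists v, is_derive x (1 : R) (fun y => elim_mx (itr (Mx y)) n k) v) ->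
  (forall r s, is_derive x (1 : R) (fun y => Mx y r s) (Mx x (r + N)%N s)) ->
  is_derive x (1 : R) (fun y => pivot (Mx y) n)
    (pivot (Mx x) n *
     imul (imul (gbL (gb_of (Mx x))) (mpow (shift_mx R) N)) (gbLi (gb_of (Mx x))) n n).
Proof.
move=> t0 /choice[dE dEP] /choice[dF dFP] dM.
have LiE r : gbLi (gb_of (Mx x)) r n =
    imul (elim_mx (itr (Mx x))) (itr (Mx x)) n r / pivot (Mx x) n by exact: gb_of_Li.
have -> : gbL (gb_of (Mx x)) = elim_mx (Mx x) by [].
move: (gbLi _) LiE => Li LiE.
set E := fun y => elim_mx (Mx y) n; set F := fun y => elim_mx (itr (Mx y)) n.
have tT y m : tau (itr (Mx y)) m != 0 by rewrite tau_tr.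
have En y : E y n = 1 by exact: elim_mx_unit.
have Fn y : F y n = 1 by exact: elim_mx_unit.
have dEn : dE n = 0.
  by apply: der_unique (dEP n) _; apply: der_ext (der_cst 1 x) => y; rewrite -/(E y) En.
have dFn : dF n = 0.
  by apply: der_unique (dFP n) _; apply: der_ext (der_cst 1 x) => y; rewrite -/(F y) Fn.
have EM y j : (j < n)%N -> \sum_(i < n.+1) E y i * Mx y i j = 0.
  by move=> jn; rewrite -elim_sum elim_mx_upper.
have FM y i : (i < n)%N -> \sum_(j < n.+1) Mx y i j * F y j = 0.
  by move=> jn; rewrite -elimT_sum elim_mx_upper.
have EFM y : pivot (Mx y) n = \sum_(i < n.+1) \sum_(j < n.+1) E y i * (Mx y i j * F y j).
  rewrite -elim_mx_pivot exchange_big big_ord_recr /= big1 ?add0r => [|j _].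
    rewrite elim_sum; apply: eq_bigr => i _.
    by rewrite -/(E y) Fn mulr1.
  rewrite (eq_bigr (fun i : 'I_n.+1 => E y i * Mx y i j * F y j)) => [|i _].
    by rewrite -mulr_suml EM ?mul0r.
  by rewrite mulrA.
apply: (der_ext (fun y => esym (EFM y))).
have d0 (i j : 'I_n.+1) := der_mul (dEP i) (der_mul (dM i j) (dFP j)).
apply: (is_derive_eq (der_sum (fun i => der_sum (fun j => d0 i j)))).
have p0 : pivot (Mx x) n != 0 by rewrite mulf_neq0// invr_neq0.
rewrite (eq_bigr (fun i : 'I_n.+1 =>
  dE i * (\sum_(j < n.+1) Mx x i j * F x j) +
  (\sum_(j < n.+1) E x i * (Mx x (i + N)%N j * F x j) +
   \sum_(j < n.+1) E x i * Mx x i j * dF j))); last first.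
  move=> i _; rewrite mulr_sumr -!big_split; apply: eq_bigr => j _ /=.
  by rewrite /E /F; ring.
rewrite !big_split /= [X in X + _](_ : _ = 0) ?add0r; last first.
  rewrite big_ord_recr /= dEn mul0r addr0 big1// => i _.
  by rewrite FM ?mulr0.
rewrite [X in _ + X](_ : _ = 0) ?addr0; last first.
  rewrite exchange_big big_ord_recr /= [X in _ + X]big1 ?addr0; last first.
    by move=> i _; rewrite dFn mulr0.
  by rewrite big1// => j _; rewrite -mulr_suml EM ?mul0r.
rewrite -imulA; [|exact/rb_lower/elim_mx_lower|exact/rb_mpow/rb_shift].
rewrite (@imulE _ n.+1) => [|k nk]; last first.
  by rewrite elim_mx_lower ?mul0r.
rewrite mulr_sumr; apply: eq_bigr => i _; rewrite shift_powM LiE elimT_sum.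
rewrite -mulr_sumr [RHS]mulrCA; congr (_ * _).
by rewrite [RHS]mulrC divfK.
Qed.

End Elimination.

(** * The bidiagonal factors of a shifted moment matrix *)

Section ShiftedFactors.
Variable R : realType.
Variables p q : nat.
Hypotheses (p0 : (0 < p)%N) (q0 : (0 < q)%N).

Implicit Types (X Y : imx R).

Definition vertex (X : imx R) b a : imx R := fun r s => X (r + b)%N (s + a)%N.

Lemma tp_vertex X b a : totally_positive X -> totally_positive (vertex X b a).
Proof.
move=> tp n rows cols hr hc.
apply: (tp n (fun i => rows i + b)%N (fun j => cols j + a)%N) => i j ij.
  by rewrite ltn_add2r; exact: hr.
by rewrite ltn_add2r; exact: hc.
Qed.

Lemma tp_tr X : totally_positive X -> totally_positive (itr X).
Proof.
move=> tp n rows cols hr hc; rewrite -det_tr.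
rewrite (_ : _^T = \matrix_(i, j) X (cols i) (rows j)); first exact: tp.
by apply/matrixP => i j; rewrite !mxE.
Qed.

Lemma tp_tau X n : totally_positive X -> 0 < tau X n.
Proof. by move=> tp; apply: (tp n (fun i => i : nat) (fun i => i : nat)). Qed.

Lemma tp_tauN0 X n : totally_positive X -> tau X n != 0.
Proof. by move=> tp; exact/lt0r_neq0/tp_tau. Qed.

Lemma tp_pivot X n : totally_positive X -> 0 < pivot X n.
Proof. by move=> tp; rewrite divr_gt0// tp_tau. Qed.

Lemma gb_of_positive X : totally_positive X -> gb_positive (gb_of X).
Proof.
move=> tp; split=> r s rs; last exact: elim_mx_gt0.
rewrite gb_of_Li divr_gt0 ?tp_pivot//; apply: elim_mx_gt0 => //.
exact: tp_tr.
Qed.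

Lemma gb_of_Uinv X n : (forall n, tau X n != 0) -> gbU (gb_of X) n n = (pivot X n)^-1.
Proof. move=> t0; have tT : tau (itr X) n != 0 by rewrite (tau_tr X).
by rewrite /= {1}/itr (elim_mx_unit tT) div1r. Qed.

Lemma vertexS_col X b a : vertex X b a.+1 = imul (vertex X b a) (itr (shift_mx R)).
Proof. by apply: imxP => r s; rewrite mulTshift /vertex addSnnS. Qed.

Lemma vertexS_row X b a : vertex X b.+1 a = imul (shift_mx R) (vertex X b a).
Proof. by apply: imxP => r s; rewrite shiftM /vertex addSnnS. Qed.

(** The coefficients of the connections are quotients of pivots at the two
    vertices. *)
Lemma conn_lower_coef X b a : totally_positive X ->
  imul (gbL (gb_of (vertex X b a))) (gbLi (gb_of (vertex X b a.+1))) =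
  mkL (fun n => pivot (vertex X b a) n.+1 / pivot (vertex X b a.+1) n).
Proof.
move=> tp; have t0 c d n := tp_tauN0 n (tp_vertex c d tp).
have g0 := gb_ofP (t0 b a); have g1 := gb_ofP (t0 b a.+1).
have MM := vertexS_col X b a.
rewrite (normalized_lowerE (conn_lower_normalized g0 g1 MM)); congr mkL.
apply/funext => n; rewrite (conn_lower_entry g0 g1 MM)// eqxx gb_of_Uinv//.
by congr (_ / _); exact: elim_mx_pivot.
Qed.

Lemma conn_upper_coef X b a : totally_positive X ->
  imul (gbUi (gb_of (vertex X b.+1 a))) (gbU (gb_of (vertex X b a))) =
  mkU (fun n => pivot (vertex X b.+1 a) n / pivot (vertex X b a) n).
Proof.
move=> tp; have t0 c d n := tp_tauN0 n (tp_vertex c d tp).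
have g0 := gb_ofP (t0 b a); have g1 := gb_ofP (t0 b.+1 a).
have MM := vertexS_row X b a.
rewrite (normalized_upperE (conn_upper_normalized g0 g1 MM)); congr mkU.
apply/funext => n; rewrite (conn_upper_diag g0 g1) gb_of_Uinv//.
by congr (_ / _); exact: elim_mx_pivot.
Qed.

(** The vertices met along the lower connections and back along the upper
    ones; the two paths meet because [X] is a step-line matrix. *)
Definition cyc_vertex (X : imx R) k : imx R :=
  if (k <= p)%N then vertex X 0 k else vertex X (q - (k - p)) 0.

(** Both kinds of connection have coefficients that are quotients of pivots at
    their two vertices; a lower one takes the next pivot at its first vertex. *)
Definition factor_coef X k n : R :=
  let c := ((k < p) + n)%N in
  pivot (cyc_vertex X k) c / pivot (cyc_vertex X k.+1) n.

Definition init_factors X : seq (cfactor R) :=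
  [seq ((k < p)%N, factor_coef X k) | k <- iota 0 (p + q)].

Definition step_line (X : imx R) := forall r s, X r (s + p)%N = X (r + q)%N s.

Lemma size_init X : size (init_factors X) = (p + q)%N.
Proof. by rewrite size_map size_iota. Qed.

Lemma nth_init X k : (k < p + q)%N ->
  nth (dflt R) (init_factors X) k = ((k < p)%N, factor_coef X k).
Proof. by move=> kM; rewrite (nth_map 0%N) ?size_iota// nth_iota. Qed.

Lemma word_init X : map fst (init_factors X) = nseq p true ++ nseq q false.
Proof.
rewrite -map_comp iotaD map_cat; congr (_ ++ _); apply: (@eq_from_nth _ true).
- by rewrite size_map size_iota size_nseq.
- move=> i; rewrite size_map size_iota => ip.
  by rewrite (nth_map 0%N) ?size_iota// nth_iota// nth_nseq ip.
- by rewrite size_map size_iota size_nseq.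
- move=> i; rewrite size_map size_iota => ip.
  by rewrite (nth_map 0%N) ?size_iota// nth_iota//= nth_nseq ip add0n ltnNge leq_addr.
Qed.

Section Gauge.
Variable X : imx R.
Hypotheses (tp : totally_positive X) (sl : step_line X).

Lemma tp_cyc_vertex k : totally_positive (cyc_vertex X k).
Proof. by rewrite /cyc_vertex; case: ifP => _; exact: tp_vertex. Qed.

Lemma cyc_vertex_p : cyc_vertex X p = vertex X q 0.
Proof.
rewrite /cyc_vertex leqnn; apply: imxP => r s.
by rewrite /vertex !addn0 sl.
Qed.

Lemma cyc_vertex_upper k : (p <= k)%N -> cyc_vertex X k = vertex X (q - (k - p)) 0.
Proof.
rewrite leq_eqVlt => /predU1P[<-|pk]; first by rewrite subnn subn0 cyc_vertex_p.
by rewrite /cyc_vertex leqNgt pk.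
Qed.

Let G k := gbL (gb_of (cyc_vertex X k)).
Let Sh n := mpow (shift_mx R) n.

Lemma G_band k : row_banded (G k).
Proof. exact/rb_lower/elim_mx_lower. Qed.

Lemma Sh_band n : row_banded (Sh n).
Proof. exact/rb_mpow/rb_shift. Qed.

Lemma mpowD Y m n : row_banded Y -> mpow Y (m + n) = imul (mpow Y m) (mpow Y n).
Proof.
move=> rY; elim: m => [|m IH]; first by rewrite imul1m.
by rewrite addSn /= IH imulA//; exact: rb_mpow.
Qed.

Lemma ShD m n : Sh (m + n) = imul (Sh m) (Sh n).
Proof. exact/mpowD/rb_shift. Qed.

(** Each factor transports the lower Gauss--Borel factor of one vertex to that
    of the next, an upper factor adding one shift. *)
Lemma gauge_factor k : (k < p + q)%N ->
  imul (fmx (nth (dflt R) (init_factors X) k)) (G k.+1) = imul (G k) (Sh (p <= k)%N).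
Proof.
move=> kM; rewrite nth_init// /fmx /=; have t0 c d n := tp_tauN0 n (tp_vertex c d tp).
have [kp|pk] := ltnP k p.
  rewrite (_ : mkL _ = imul (gbL (gb_of (vertex X 0 k))) (gbLi (gb_of (vertex X 0 k.+1)))).
    rewrite /G /cyc_vertex (ltnW kp) kp /Sh /= imulm1.
    exact: conn_lowerL (gb_ofP (t0 0%N k)) (gb_ofP (t0 0%N k.+1)).
  rewrite conn_lower_coef//; congr mkL; apply/funext => n.
  by rewrite /factor_coef /cyc_vertex kp (ltnW kp) add1n.
have -> : Sh true = shift_mx R by rewrite /Sh /= imulm1.
pose b := (q - (k - p)).-1.
have eb : (q - (k - p) = b.+1)%N by rewrite /b; lia.
have eb1 : (q - (k.+1 - p) = b)%N by rewrite /b; lia.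
rewrite (_ : mkU _ = imul (gbUi (gb_of (vertex X b.+1 0))) (gbU (gb_of (vertex X b 0)))).
  rewrite /G (cyc_vertex_upper pk) (cyc_vertex_upper (leqW pk)) eb eb1.
  exact: conn_upperL (gb_ofP (t0 b 0%N)) (gb_ofP (t0 b.+1 0%N)) (vertexS_row X b 0).
rewrite conn_upper_coef//; congr mkU; apply/funext => n.
rewrite /factor_coef (cyc_vertex_upper pk) (cyc_vertex_upper (leqW pk)) eb eb1.
by rewrite ltnNge pk.
Qed.

Lemma gauge_segment k n : (k + n <= p + q)%N ->
  imul (lprod (take n (drop k (init_factors X)))) (G (k + n)) =
  imul (G k) (Sh (k + n - maxn k p)).
Proof.
elim: n k => [|n IH] k kn.
  rewrite take0 addn0 imul1m /Sh.
  have -> : (k - maxn k p = 0)%N by lia.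
  by rewrite /= imulm1.
rewrite (drop_nth (dflt R)) ?size_init; last by lia.
rewrite /lprod /= -/(lprod _) -imulA; [|exact: rb_fmx|exact: rb_lprod].
rewrite addnS -addSn IH; last by lia.
rewrite imulA; [|exact: rb_fmx|exact: G_band].
rewrite gauge_factor; last by lia.
rewrite -imulA; [|exact: G_band|exact: Sh_band].
by rewrite -ShD; congr (imul _ (Sh _)); case: leqP => /=; lia.
Qed.

Lemma G_cyc : G (p + q) = G 0.
Proof.
rewrite /G cyc_vertex_upper ?leq_addr// addKn subnn.
by rewrite /cyc_vertex leq0n.
Qed.

Lemma gauge_cyc k : (k <= p + q)%N ->
  imul (cyc (init_factors X) k) (G k) = imul (G k) (Sh q).
Proof.
move=> kM; rewrite /cyc /rot lprod_cat -imulA; [|exact: rb_lprod..].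
have := gauge_segment (_ : (0 + k <= p + q)%N); rewrite drop0 add0n => -> //.
have h : (k + (p + q - k) <= p + q)%N by lia.
have := gauge_segment h; rewrite subnKC// take_oversize ?size_drop ?size_init//.
rewrite G_cyc => e.
rewrite imulA; [|exact: rb_lprod|exact: G_band].
rewrite e -imulA; [|exact: G_band|exact: Sh_band].
by rewrite -ShD; congr (imul _ (Sh _)); lia.
Qed.

(** Conjugation by the lower Gauss--Borel factor turns the [m]-th power of a
    cyclic product into a shift by [q * m] rows, which multiplies the density by
    [x ^+ m] and thus is the derivative in the [m]-th time. *)
Lemma cyc_init_diag k m n : (k <= p + q)%N ->
  mpow (cyc (init_factors X) k) m n n =
  imul (imul (G k) (Sh (q * m))) (gbLi (gb_of (cyc_vertex X k))) n n.
Proof.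
move=> kM; have e := mpow_comm m (rb_cyc _ _) (Sh_band q) (G_band k) (gauge_cyc kM).
have -> : Sh (q * m) = mpow (Sh q) m.
  elim: m {e} => [|m IH]; first by rewrite muln0.
  by rewrite mulnS ShD IH.
rewrite -e -imulA; [|exact/rb_mpow/rb_cyc|exact: G_band].
have g := gb_ofP (fun n => tp_tauN0 n (tp_cyc_vertex k)).
by rewrite (imxP (gb_LLi g)) imulm1.
Qed.

End Gauge.

Lemma init_factorsE X : step_line X -> init_factors X =
  [seq (true, fun n => pivot (vertex X 0 a) n.+1 / pivot (vertex X 0 a.+1) n)
     | a <- iota 0 p] ++
  [seq (false, fun n => pivot (vertex X b.+1 0) n / pivot (vertex X b 0) n)
     | b <- rev (iota 0 q)].
Proof.
move=> sl; rewrite /init_factors iotaD map_cat; congr (_ ++ _).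
  apply/eq_in_map => k; rewrite mem_iota => /andP[_ kp]; rewrite kp; congr (_, _).
  by apply/funext => n; rewrite /factor_coef /cyc_vertex kp (ltnW kp) add1n.
apply: (@eq_from_nth _ (dflt R)); first by rewrite !size_map size_rev !size_iota.
move=> i; rewrite size_map size_iota => iq.
rewrite !(nth_map 0%N) ?size_rev ?size_iota// nth_iota// nth_rev ?size_iota//.
rewrite nth_iota; last by lia.
rewrite !add0n ltnNge leq_addr; congr (_, _); apply/funext => n.
have h0 : (p <= p + i)%N by rewrite leq_addr.
have h1 : (p <= (p + i).+1)%N by lia.
rewrite /factor_coef (cyc_vertex_upper sl h0) (cyc_vertex_upper sl h1).
have -> : (p + i < p)%N = false by lia.
by congr (pivot (vertex X _ _) _ / pivot (vertex X _ _) _); lia.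
Qed.

End ShiftedFactors.

Section InitialFlow.
Variable R : realType.
Variables (p q L : nat) (X : ('I_L -> R) -> imx R).
Hypotheses (p0 : (0 < p)%N) (q0 : (0 < q)%N).
Hypotheses (tp : forall t, totally_positive (X t)) (sl : forall t, step_line p q (X t)).
Hypothesis dX : forall l t r s,
  is_partial l (fun t => X t r s) t (X t (r + q * l.+1)%N s).

Lemma C2_X r s : C2sym (fun t => X t r s).
Proof.
exists (fun l t => X t (r + q * l.+1)%N s),
  (fun l m t => X t (r + q * l.+1 + q * m.+1)%N s).
split=> [l t|l m t|l m t]; [exact: dX|exact: dX|].
by rewrite -!addnA [(q * l.+1 + _)%N]addnC.
Qed.

Lemma det_rational_diff f : det_rational X f -> forall (l : 'I_L) t,
  exists v, is_partial l f t v.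
Proof.
by move=> /(det_rational_C2 C2_X)[g [h [d _ _]]] l t; exists (g l t).
Qed.

Lemma det_rational_cyc_vertex k r s : det_rational X (fun t => cyc_vertex p q (X t) k r s).
Proof.
rewrite /cyc_vertex; case: (k <= p)%N; first exact: (DR_entry X (r + 0) (s + k)).
exact: (DR_entry X (r + (q - (k - p))) (s + 0)).
Qed.

Lemma cyc_vertex_tau k t n : tau (cyc_vertex p q (X t) k) n != 0.
Proof. exact/tp_tauN0/tp_cyc_vertex. Qed.

Lemma pivot_rational k n : det_rational X (fun t => pivot (cyc_vertex p q (X t) k) n).
Proof.
apply: det_rational_subst (det_rational_cyc_vertex k) _.
by apply: pivot_det_rational => t m; exact: cyc_vertex_tau.
Qed.

Lemma partial_pivot k n l t : (k <= p + q)%N ->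
  is_partial l (fun t => pivot (cyc_vertex p q (X t) k) n) t
    (pivot (cyc_vertex p q (X t) k) n *
     mpow (cyc (init_factors p q (X t)) k) l.+1 n n).
Proof.
move=> kM; rewrite (cyc_init_diag p0 q0 (tp t) (sl t))//.
have h := @der_pivot R (fun y => cyc_vertex p q (X (set_time t l y)) k) (t l) (q * l.+1) n.
rewrite /is_partial; move: h; rewrite set_timeK; apply=> [y m|i|i|r s].
- exact: cyc_vertex_tau.
- have := @elim_det_rational _ _ (fun t => cyc_vertex p q (X t) k) n i.
  move=> /(_ (fun t m => cyc_vertex_tau k t m)).
  by move=> /(det_rational_subst (det_rational_cyc_vertex k))/det_rational_diff/(_ l t).
- have dT r s : det_rational X (fun t => itr (cyc_vertex p q (X t) k) r s).
    exact: det_rational_cyc_vertex.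
  have := @elim_det_rational _ _ (fun t => itr (cyc_vertex p q (X t) k)) n i.
  have tT t' m : tau (itr (cyc_vertex p q (X t') k)) m != 0.
    by rewrite (tau_tr (cyc_vertex p q (X t') k)) cyc_vertex_tau.
  move=> /(_ tT).
  by move=> /(det_rational_subst dT)/det_rational_diff/(_ l t).
rewrite /cyc_vertex; case: (k <= p)%N.
  rewrite /vertex (_ : r + q * l.+1 + 0 = (r + 0) + q * l.+1)%N; last by lia.
  exact: dX.
rewrite /vertex (_ : r + q * l.+1 + (q - (k - p)) = (r + (q - (k - p))) + q * l.+1)%N; last by lia.
exact: dX.
Qed.

(** Logarithmic derivatives of pivots are diagonal entries of the cyclic
    products, so their quotients satisfy the Lax equations of the factors. *)
Lemma init_flow l t : flow_at (fun y => init_factors p q (X (set_time t l y))) l.+1 (t l).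
Proof.
move=> k n; rewrite size_init => kM; rewrite /flow_rhs set_timeK nth_init// -[(_, _).1]/(k < p)%N -[(_, _).2]/(factor_coef _ _ _ _).
have d1 := partial_pivot ((k < p) + n) l t (ltnW kM).
have d2 := partial_pivot n l t kM.
have p2 : pivot (cyc_vertex p q (X t) k.+1) n != 0.
  exact/lt0r_neq0/tp_pivot/tp_cyc_vertex.
apply: (@der_ext _ (fun y => factor_coef p q (X (set_time t l y)) k n)).
  by move=> y; rewrite nth_init.
have := partial_div p2 d1 d2; apply: partial_eq.
by rewrite /factor_coef; field.
Qed.

Lemma init_pos t : pos_list (init_factors p q (X t)).
Proof.
move=> k; rewrite size_init => kM; rewrite -/(dflt R) nth_init// => n /=.
by rewrite divr_gt0// tp_pivot//; exact: tp_cyc_vertex.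
Qed.

Lemma init_rational k n : (k < p + q)%N ->
  det_rational X (fun t => (nth (dflt R) (init_factors p q (X t)) k).2 n).
Proof.
move=> kM; apply: det_rational_ext (_ : det_rational _ (fun t => factor_coef p q (X t) k n)).
  by move=> t; rewrite nth_init.
apply: DR_div => [||t]; [exact: pivot_rational..|].
exact/lt0r_neq0/tp_pivot/tp_cyc_vertex.
Qed.

End InitialFlow.

(** * Integrals over the unit interval *)

Section UnitIntegral.
Variable R : realType.
Notation mu := (@lebesgue_measure R).
Implicit Types (f g w : R -> R) (x z : R).

Definition unit_itv : set R := [set` `]0, 1[].

Definition uint f := mu.-integrable unit_itv (EFin \o f).
Definition umean f : R := \int[mu]_(x in unit_itv) f x.

Lemma mU : measurable (unit_itv : set (measurableTypeR R)). Proof. exact: measurable_itv. Qed.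

Lemma unit_itvP x : unit_itv x <-> 0 < x /\ x < 1.
Proof. by rewrite /unit_itv /= in_itv /=; split=> [/andP//|[-> ->]]. Qed.

Lemma uint_ext f g : (forall x, 0 < x -> x < 1 -> f x = g x) -> uint f -> uint g.
Proof.
move=> fg; apply: eq_integrable => //; first exact: mU.
by move=> x; rewrite inE => /unit_itvP[x0 x1] /=; rewrite fg.
Qed.

Lemma umean_ext f g : (forall x, 0 < x -> x < 1 -> f x = g x) -> umean f = umean g.
Proof. by move=> fg; apply: eq_Rintegral => x; rewrite inE => /unit_itvP[x0 x1]; exact: fg. Qed.

Lemma uintD f g : uint f -> uint g -> uint (fun x => f x + g x).
Proof.
move=> fi gi; have := integrableD mU fi gi.
by apply: eq_integrable => //; exact: mU.
Qed.

Lemma uintZ c f : uint f -> uint (fun x => c * f x).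
Proof.
move=> fi; have := integrableZl mU c fi.
by apply: eq_integrable => //; exact: mU.
Qed.

Lemma umeanD f g : uint f -> uint g -> umean (fun x => f x + g x) = umean f + umean g.
Proof. by move=> fi gi; exact: (RintegralD mU fi gi). Qed.

Lemma umeanZ c f : uint f -> umean (fun x => c * f x) = c * umean f.
Proof. by move=> fi; exact: (RintegralZl c mU fi). Qed.

Lemma uint0 : uint (fun=> 0).
Proof. exact: integrable0. Qed.

Lemma umean0 : umean (fun=> 0) = 0.
Proof. by rewrite /umean /Rintegral integral0. Qed.

Lemma uintB f g : uint f -> uint g -> uint (fun x => f x - g x).
Proof.
move=> fi gi; apply: uint_ext (uintD fi (uintZ (-1) gi)) => x _ _.
by rewrite mulN1r.
Qed.

Lemma umeanB f g : uint f -> uint g -> umean (fun x => f x - g x) = umean f - umean g.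
Proof. by move=> fi gi; exact: (RintegralB mU fi gi). Qed.

Lemma uint_sum (I : Type) (r : seq I) (F : I -> R -> R) :
  (forall i, uint (F i)) -> uint (fun x => \sum_(i <- r) F i x).
Proof.
move=> Fi; elim: r => [|i r IH].
  by apply: uint_ext uint0 => x _ _; rewrite big_nil.
by apply: uint_ext (uintD (Fi i) IH) => x _ _; rewrite big_cons.
Qed.

Lemma umean_sum (I : Type) (r : seq I) (F : I -> R -> R) :
  (forall i, uint (F i)) -> umean (fun x => \sum_(i <- r) F i x) = \sum_(i <- r) umean (F i).
Proof.
move=> Fi; elim: r => [|i r IH].
  by rewrite big_nil -[RHS]umean0; apply: umean_ext => x _ _; rewrite big_nil.
rewrite big_cons -IH -umeanD//; last exact: uint_sum.
by apply: umean_ext => x _ _; rewrite big_cons.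
Qed.

Lemma umean_le f g : uint f -> uint g -> (forall x, 0 < x -> x < 1 -> f x <= g x) ->
  umean f <= umean g.
Proof.
move=> fi gi fg; apply: (le_Rintegral mU fi gi) => x /unit_itvP[x0 x1]; exact: fg.
Qed.

(** A zero integral would make [f] vanish almost everywhere, whereas the unit
    interval without the points of [s] has measure one. *)
Lemma umean_gt0 f (s : seq R) : uint f ->
  (forall x, 0 < x -> x < 1 -> x \notin s -> 0 < f x) ->
  (forall x, 0 < x -> x < 1 -> 0 <= f x) -> 0 < umean f.
Proof.
move=> fi fp f0.
have /integrableP[mf _] := fi.
have J0 : 0 <= umean f by apply: Rintegral_ge0 => x /unit_itvP[]; exact: f0.
rewrite lt_def J0 andbT; apply/eqP => J.
have I0 : (\int[mu]_(x in unit_itv) `|(EFin \o f) x| = 0)%E.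
  have -> : (\int[mu]_(x in unit_itv) `|(EFin \o f) x| =
             \int[mu]_(x in unit_itv) (EFin \o f) x)%E.
    apply: eq_integral => x; rewrite inE => /unit_itvP[x0 x1] /=.
    by rewrite ger0_norm// f0.
  have := J; rewrite /umean /Rintegral => J'.
  have fn : (\int[mu]_(x in unit_itv) (EFin \o f) x)%E \is a fin_num.
    by apply: integrable_fin_num => //; exact: mU.
  by rewrite -(fineK fn) J'.
have [A [mA A0 subA]] := (ae_eq_integral_abs mu mU mf).1 I0.
have cs : countable [set` s] by exact/finite_set_countable/finite_seq.
have ms : measurable ([set` s] : set (measurableTypeR R)).
  by apply: countable_measurable cs => x; exact: measurable_set1.
have s0 : mu [set` s] = 0%E by exact: countable_lebesgue_measure0.
have sub : unit_itv `<=` A `|` [set` s].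
  move=> x Ux; have [xs|xs] := boolP (x \in s); first by right.
  left; apply: subA => /= h; have [x0 x1] := (unit_itvP x).1 Ux.
  have := fp x x0 x1 xs; have := h Ux => /= -[->]; by rewrite ltxx.
have : (mu unit_itv <= mu (A `|` [set` s]))%E.
  by apply: le_measure => //; rewrite inE; [exact: mU|exact: measurableU].
have U1 : mu unit_itv = 1%E.
  by rewrite /unit_itv lebesgue_measure_itv /= lte_fin ltr01 oppr0 adde0.
have : (mu (A `|` [set` s]) <= mu A + mu [set` s])%E by exact: measureU2.
rewrite A0 s0 adde0 U1 => h1 h2.
by have := le_trans h2 h1; rewrite lee_fin ler10.
Qed.

(** A continuous factor is bounded on the closed interval. *)
Lemma uintM f g : uint f -> continuous g -> uint (fun x => f x * g x).
Proof.
move=> fi cg.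
have mg : measurable_fun (unit_itv : set (measurableTypeR R)) g.
  by apply: measurable_funTS; exact: continuous_measurable_fun.
have bg : [bounded g x | x in unit_itv].
  have : bounded_set (g @` `[0, 1]).
    apply: compact_bounded; apply: continuous_compact; last exact: segment_compact.
    exact: continuous_subspaceT.
  move=> [M [Mr MM]]; exists M; split=> // M' MM' x /unit_itvP[x0 x1] /=.
  by apply: (MM M' MM'); exists x => //; rewrite /= in_itv /= !ltW.
have := integrableMl mU fi mg bg.
by apply: eq_integrable => //; exact: mU.
Qed.

Lemma powR_continuous_gt0 (a x : R) : 0 < x -> {for x, continuous (fun y => y `^ a)}.
Proof.
move=> x0; apply: differentiable_continuous; apply/derivable1_diffP.
by apply: derivable_powR; rewrite in_itv /= x0.
Qed.

Lemma powR_FTC z (c : R) : 0 < z -> 0 < c -> c <= 1 ->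
  (\int[mu]_(x in `[c, 1%R]) (x `^ (z - 1))%R%:E = (z^-1 * (1 - c `^ z))%R%:E)%E.
Proof.
move=> z0 c0; rewrite le_eqVlt => /predU1P[->|c1].
  by rewrite set_itv1 integral_set1 powR1 subrr mulr0.
have := @continuous_FTC2 R (fun x => x `^ (z - 1)) (fun x => z^-1 * x `^ z) c 1 c1.
rewrite /= powR1 => ->.
- by rewrite -EFinB mulrBr.
- apply: continuous_in_subspaceT => x; rewrite inE /= in_itv /= => /andP[cx _].
  by apply: powR_continuous_gt0; exact: lt_le_trans cx.
- have cont y : 0 < y -> {for y, continuous (fun x => z^-1 * x `^ z)}.
    by move=> y0; apply: cvgM; [exact: cvg_cst|exact: powR_continuous_gt0].
  split=> [x||].
  + rewrite in_itv /= => /andP[cx _]; apply: derivableM => //.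
    by apply: derivable_powR; rewrite in_itv /= (lt_trans c0).
  + by apply: cvg_at_right_filter; exact: cont.
  + by apply: cvg_at_left_filter; exact: cont.
- move=> x; rewrite in_itv /= => /andP[cx _]; have x0 := lt_trans c0 cx.
  have h := der_mul (der_cst z^-1 x) (is_derive1_powR z x0).
  by rewrite derive1E (@derive_val _ _ _ _ _ _ _ h) mul0r add0r mulKf ?gt_eqF.
Qed.

Lemma powR_measurable z (A : set R) :
  measurable_fun (A : set (measurableTypeR R)) (fun x => x `^ z).
Proof. by apply: measurable_funTS; exact: measurable_powR. Qed.

(** The density is not bounded near 0 when [z < 1]: the integral is the limit of
    those over [[1/(n+1), 1]]. *)
Lemma powR_unit z : 0 < z ->
  uint (fun x => x `^ (z - 1)) /\ umean (fun x => x `^ (z - 1)) = z^-1.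
Proof.
move=> z0.
have mf : measurable_fun (unit_itv : set (measurableTypeR R)) (EFin \o (fun x => x `^ (z - 1))).
  by apply/measurable_EFinP; exact: powR_measurable.
have I : (\int[mu]_(x in unit_itv) (x `^ (z - 1))%R%:E = z^-1%:E)%E.
  rewrite /unit_itv integral_itv_bndo_bndc; last exact: mf.
  rewrite itv_open_bnd_bigcup.
  have c1 := @ge0_nondecreasing_set_cvg_integral _ (measurableTypeR R) R
    (fun n => [set` `[(0 + n.+1%:R^-1 : R), 1%R]]) (fun x => (x `^ (z - 1))%:E) mu.
  apply: (cvg_unique (@ereal_hausdorff R) (c1 _ _ _ _)).
  - move=> m n mn; rewrite subsetEset => x; rewrite /= !in_itv /= => /andP[h ->].
    rewrite andbT (le_trans _ h)// lerD2l lef_pV2 ?posrE ?ltr0n//.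
    by rewrite ler_nat.
  - by move=> n; exact: measurable_itv.
  - by move=> n; apply/measurable_EFinP; exact: powR_measurable.
  - by move=> n x _; rewrite lee_fin powR_ge0.
  rewrite (_ : (fun n => _) = (fun n => (z^-1 * (1 - (n.+1%:R^-1 : R) `^ z))%:E)); last first.
    apply/funext => n; rewrite add0r powR_FTC//.
    by rewrite invf_le1 ?ltr0n// ler1n.
  apply: cvg_EFin; first by near=> n.
  rewrite -[X in _ --> X]mulr1; apply: cvgM; first exact: cvg_cst.
  rewrite -[X in _ --> X]subr0; apply: cvgB; first exact: cvg_cst.
  apply: (cvg_at_rightP (fun x => x `^ z) 0 0).1; first exact: powR_cvg0.
  by split=> [n|]; [rewrite invr_gt0 ltr0n|exact: cvg_harmonic].
split; last by rewrite /umean /Rintegral I.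
apply/integrableP; split => //.
rewrite (_ : (\int[mu]_(x in unit_itv) _ = z^-1%:E)%E) ?ltry// -I.
by apply: eq_integral => x _ /=; rewrite ger0_norm ?powR_ge0.
Unshelve. all: by end_near. Qed.

Definition mom z w := umean (fun x => x `^ (z - 1) * w x).

Lemma uint_mom z w : 0 < z -> continuous w -> uint (fun x => x `^ (z - 1) * w x).
Proof. by move=> z0 cw; apply: uintM => //; exact: (powR_unit z0).1. Qed.

Lemma mom_pow z (m : nat) w : mom z (fun x => x ^+ m * w x) = mom (z + m%:R) w.
Proof.
apply: umean_ext => x x0 _; rewrite mulrA; congr (_ * _).
by rewrite addrAC [in RHS]powRD; [rewrite powR_mulrn// ltW|by rewrite (gt_eqF x0) implybT].
Qed.

Lemma der_quadratic f s d (C : R) :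
  (forall h, `|h| <= 2^-1 -> `|f (s + h) - f s - h * d| <= C * h ^+ 2) ->
  is_derive s (1 : R) f d.
Proof.
move=> fq; have C0 : 0 <= C.
  have := fq 2^-1; rewrite ger0_norm ?invr_ge0// => /(_ (lexx _)).
  by move=> /(le_trans (normr_ge0 _)); rewrite pmulr_lge0// exprn_gt0// invr_gt0.
have c : h^-1 *: ((f \o shift s) (h *: (1 : R)) - f s) @[h --> (0 : R)^'] --> d.
  apply/cvgrPdist_le => e e0; near=> h.
  have h0 : h != 0 by near: h; exact: nbhs_dnbhs_neq.
  have h1 : `|h| <= 2^-1 by near: h; apply: dnbhs0_le; rewrite invr_gt0.
  have h2 : `|h| <= e / (C + 1).
    by near: h; apply: dnbhs0_le; rewrite divr_gt0// ltr_wpDl.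
  have -> : d - h^-1 *: ((f \o shift s) (h *: (1 : R)) - f s) =
            - (h^-1 * (f (s + h) - f s - h * d)).
    rewrite /= /GRing.scale /= mulr1 [h + s]addrC; field.
    by [].
  rewrite normrN normrM normfV ler_pdivrMl ?normr_gt0//.
  apply: (le_trans (fq _ h1)); rewrite -real_normK ?num_real// expr2 mulrCA mulrC.
  rewrite [X in X <= _]mulrC ler_wpM2l//.
  apply: (@le_trans _ _ ((C + 1) * `|h|)); first by rewrite ler_wpM2r// lerDl.
  by rewrite mulrC -ler_pdivlMr// ltr_wpDl.
apply: DeriveDef; first by apply/cvg_ex; exists d; exact: c.
exact: cvg_lim c.
Unshelve. all: by end_near. Qed.

Lemma expR_taylor1 (a : R) : `|a| <= 2^-1 -> `|expR a - 1 - a| <= 2 * a ^+ 2.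
Proof.
rewrite ler_norml => /andP[a1 a2]; have a3 : 2^-1 = 1 / 2 :> R by lra.
rewrite a3 in a1 a2.
rewrite ger0_norm; last by rewrite subr_ge0 lerBrDl expR_ge1Dx.
have h : expR (- a) >= 1 - a by exact: expR_ge1Dx.
have d0 : 0 < 1 - a by lra.
have : expR a <= (1 - a)^-1.
  by rewrite -[expR a]opprK -{1}[a]opprK expRN opprK lef_pV2 ?posrE ?expR_gt0.
rewrite -(ler_pM2r d0) mulVf ?gt_eqF// => e1.
have e2 : 1 + a <= expR a by exact: expR_ge1Dx.
have e0 := expR_gt0 a.
by nra.
Qed.

Lemma continuous_expw (m : nat) s w : continuous w ->
  continuous (fun x => expR (s * x ^+ m) * w x).
Proof.
move=> cw x; apply: cvgM; last exact: cw.
apply: continuous_comp; last exact: continuous_expR.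
by apply: cvgM; [exact: cvg_cst|exact: exprn_continuous].
Qed.

Lemma umean_norm_le f g : uint f -> uint g ->
  (forall x, 0 < x -> x < 1 -> `|f x| <= g x) -> `|umean f| <= umean g.
Proof.
move=> fi gi fg; rewrite ler_norml; apply/andP; split; last first.
  by apply: umean_le => // x x0 x1; rewrite (le_trans (ler_norm _))// fg.
rewrite -mulN1r -umeanZ//; apply: umean_le => // [|x x0 x1]; first exact: uintZ.
by rewrite mulN1r; have := fg x x0 x1; rewrite ler_norml => /andP[].
Qed.

(** Differentiation under the integral sign, from a uniform second order
    estimate of the exponential. *)
Lemma der_mom z w (m : nat) s : 0 < z -> continuous w ->
  is_derive s (1 : R) (fun y => mom z (fun x => expR (y * x ^+ m) * w x))
    (mom (z + m%:R) (fun x => expR (s * x ^+ m) * w x)).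
Proof.
move=> z0 cw.
have cn : continuous (fun x => `|w x|).
  by move=> x; apply: continuous_comp; [exact: cw|exact: norm_continuous].
pose E y x := expR (y * x ^+ m) * w x.
have cE y : continuous (E y) by exact: continuous_expw.
have iE y : uint (fun x => x `^ (z - 1) * E y x) by exact: uint_mom.
have cEm : continuous (fun x => x ^+ m * E s x).
  by move=> x; apply: cvgM; [exact: exprn_continuous|exact: cE].
have iEm : uint (fun x => x `^ (z - 1) * (x ^+ m * E s x)) by exact: uint_mom.
apply: (@der_quadratic _ _ _ (2 * expR `|s| * mom z (fun x => `|w x|))) => h h1.
rewrite -mom_pow -/(E s) -/(E (s + h)) /mom.
rewrite -umeanB// -umeanZ// -umeanB//; [|exact: uintB|exact: uintZ].
rewrite mulrAC -umeanZ; last exact: uint_mom.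
apply: umean_norm_le => [||x x0 x1].
- by apply: uintB; [exact: uintB|exact: uintZ].
- by apply: uintZ; exact: uint_mom.
have y0 : 0 <= x ^+ m by rewrite exprn_ge0// ltW.
have y1 : x ^+ m <= 1 by rewrite exprn_ile1// ltW.
rewrite /E mulrDl expRD; set y := x ^+ m in y0 y1 *.
have -> : x `^ (z - 1) * (expR (s * y) * expR (h * y) * w x) -
    x `^ (z - 1) * (expR (s * y) * w x) - h * (x `^ (z - 1) * (y * (expR (s * y) * w x))) =
    (expR (s * y) * (expR (h * y) - 1 - h * y)) * (x `^ (z - 1) * w x) by ring.
rewrite normrM [`|_ * w x|]normrM (ger0_norm (powR_ge0 x (z - 1))).
apply: ler_pM => //.
  by rewrite mulr_ge0 ?powR_ge0.
rewrite normrM (ger0_norm (expR_ge0 (s * y))).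
rewrite [leRHS](_ : _ = expR `|s| * (2 * h ^+ 2)); last by ring.
have hy : `|h * y| <= `|h|.
  by rewrite normrM (ger0_norm y0) ler_piMr.
apply: ler_pM => //.
  rewrite ler_expR (le_trans (ler_norm _))// normrM (ger0_norm y0).
  by rewrite ler_piMr.
apply: (le_trans (expR_taylor1 (le_trans hy h1))).
rewrite ler_pM2l// -(real_normK (num_real (h * y))) -(real_normK (num_real h)).
by rewrite ler_sqr ?nnegrE.
Qed.

Lemma exp_partial_le (a b : R) n : `|a| <= b ->
  `|series (exp_coeff a) n| <= expR b.
Proof.
move=> ab; have b0 : 0 <= b by exact: le_trans ab.
apply: (@le_trans _ _ (series (exp_coeff b) n)).
  apply: (le_trans (ler_norm_sum _ _ _)); apply: ler_sum => k _.
  rewrite /exp_coeff /= normrM normrX normfV (ger0_norm (ler0n _ _)).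
  apply: ler_wpM2r; first by rewrite invr_ge0.
  by apply: lerXn2r; rewrite ?nnegrE.
rewrite /expR; apply: nondecreasing_cvgn_le; last exact: is_cvg_series_exp_coeff.
apply/nondecreasing_seqP => k; rewrite /series /= big_nat_recr//= lerDl.
by rewrite /exp_coeff /= mulr_ge0 ?exprn_ge0// invr_ge0.
Qed.

(** Termwise integration of the exponential series; its partial sums are
    dominated by the constant [expR `|t|]. *)
Lemma mom_exp_series z t : 0 < z ->
  (fun n => \sum_(0 <= k < n) t ^+ k / k`!%:R * (z + k%:R)^-1) @ \oo -->
  mom z (fun x => expR (t * x)).
Proof.
move=> z0; have zk k : 0 < z + k%:R by rewrite ltr_pwDl.
pose h n x := x `^ (z - 1) * series (exp_coeff (t * x)) n.
have hE n x : 0 < x -> h n x = \sum_(0 <= k < n) t ^+ k / k`!%:R * x `^ (z + k%:R - 1).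
  move=> x0; rewrite /h /series /= mulr_sumr; apply: eq_bigr => k _.
  rewrite /exp_coeff /= exprMn addrAC [in RHS]powRD ?(gt_eqF x0) ?implybT//.
  by rewrite powR_mulrn ?ltW//; ring.
have ih n : uint (h n).
  apply: uint_ext (_ : uint (fun x => \sum_(0 <= k < n) t ^+ k / k`!%:R * x `^ (z + k%:R - 1))).
    by move=> x x0 _; rewrite hE.
  by apply: uint_sum => k; apply: uintZ; exact: (powR_unit (zk k)).1.
have mh n : umean (h n) = \sum_(0 <= k < n) t ^+ k / k`!%:R * (z + k%:R)^-1.
  rewrite (umean_ext (g := fun x => \sum_(0 <= k < n) t ^+ k / k`!%:R * x `^ (z + k%:R - 1))).
    rewrite umean_sum => [|k]; last by apply: uintZ; exact: (powR_unit (zk k)).1.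
    apply: eq_bigr => k _; have [i1 i2] := powR_unit (zk k).
    by rewrite umeanZ// i2.
  by move=> x x0 _; rewrite hE.
have ce : continuous (fun x => expR (t * x)).
  move=> x; apply: continuous_comp; last exact: continuous_expR.
  by apply: cvgM; [exact: cvg_cst|exact: cvg_id].
have ie := uint_mom z0 ce.
have ig : uint (fun x => expR `|t| * x `^ (z - 1)) by apply: uintZ; exact: (powR_unit z0).1.
pose f_ n := EFin \o h n; pose f := EFin \o (fun x => x `^ (z - 1) * expR (t * x)).
pose g := EFin \o (fun x => expR `|t| * x `^ (z - 1)).
have ae1 : {ae mu, forall x, unit_itv x -> f_ ^~ x @ \oo --> f x}.
  apply: aeW => x _; apply: cvg_EFin; first by near=> n.
  by apply: cvgM; [exact: cvg_cst|exact: is_cvg_series_exp_coeff].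
have ae2 : {ae mu, forall x n, unit_itv x -> (`|f_ n x| <= g x)%E}.
  apply: aeW => x n /unit_itvP[x0 x1]; rewrite lee_fin /h normrM mulrC.
  rewrite (ger0_norm (powR_ge0 x (z - 1))) ler_wpM2r ?powR_ge0//.
  apply: exp_partial_le; rewrite normrM (ger0_norm (ltW x0)).
  by rewrite ler_piMr// ltW.
have mf_ n : measurable_fun (unit_itv : set (measurableTypeR R)) (f_ n).
  by have /integrableP[] := ih n.
have mf : measurable_fun (unit_itv : set (measurableTypeR R)) f.
  by have /integrableP[] := ie.
have [_ _ cv] := dominated_convergence mU mf_ mf ae1 ig ae2.
have /fine_cvg : [sequence (\int[mu]_(x in unit_itv) f_ n x)%E]_n @ \oo --> (mom z (fun x => expR (t * x)))%:E.
  rewrite /mom /umean /Rintegral fineK//.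
  by apply: (integrable_fin_num mU).
rewrite (_ : fine \o _ = fun n => \sum_(0 <= k < n) t ^+ k / k`!%:R * (z + k%:R)^-1)//.
by apply/funext => n; rewrite -mh.
Unshelve. all: by end_near. Qed.

Lemma mom_kummer z t : 0 < z -> mom z (fun x => expR (t * x)) = z^-1 * kummer z (z + 1) t.
Proof.
move=> z0; have zn k : z + k%:R != 0 by rewrite gt_eqF// ltr_pwDl.
have c := @mom_exp_series z t z0.
suff -> : kummer z (z + 1) t = z * mom z (fun x => expR (t * x)).
  by rewrite mulKf ?gt_eqF.
rewrite /kummer; apply: cvg_lim => //.
rewrite (_ : series _ = (fun n => z * \sum_(0 <= k < n) t ^+ k / k`!%:R * (z + k%:R)^-1)).
  by apply: cvgM; [exact: cvg_cst|exact: c].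
apply/funext => n; rewrite /series /= mulr_sumr; apply: eq_bigr => k _.
have -> : (\prod_(i < k) (z + i%:R)) / (\prod_(i < k) (z + 1 + i%:R)) = z / (z + k%:R).
  have zi i : z + 1 + i%:R != 0 by rewrite -addrA nat1r zn.
  elim: k => [|k IH]; first by rewrite !big_ord0 mulr0n addr0 divr1 divff ?gt_eqF.
  rewrite !big_ord_recr /= invfM mulrACA IH mulrA divfK//.
  by rewrite -addrA nat1r.
by rewrite -!mulrA; congr (_ * _); rewrite mulrC -!mulrA mulrCA.
Qed.

End UnitIntegral.

(** * Determinants of integrals *)

Section BorderedDet.
Variable F : fieldType.

(** Up to sign the determinant of [A] bordered by [f] and [g], which makes it
    invariant under unimodular row and column operations ([cof_form_congr]). *)
Definition cof_form n (A : 'M[F]_n) (f : 'cV[F]_n) (g : 'rV[F]_n) : F :=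
  \sum_i \sum_j f i 0 * g 0 j * cofactor A i j.

Lemma det_bordered n (A : 'M[F]_n.+1) (f : 'cV[F]_n.+1) (g : 'rV[F]_n.+1) :
  \det (block_mx 0 g f A : 'M[F]_(1 + n.+1)) = - cof_form A f g.
Proof.
pose B : 'M[F]_n.+2 := block_mx (0 : 'M[F]_1) g f A.
have B00 : B 0 0 = 0 by do 3![rewrite mxE ?split1 ?unlift_none ?liftK /=].
have B0l j : B 0 (lift 0 j) = g 0 j by do 3![rewrite ?mxE ?split1 ?unlift_none ?liftK /=].
have Bl0 i : B (lift 0 i) 0 = f i 0 by do 3![rewrite ?mxE ?split1 ?unlift_none ?liftK /=].
have Bll i j : B (lift 0 i) (lift 0 j) = A i j.
  by do 3![rewrite ?mxE ?split1 ?unlift_none ?liftK /=].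
rewrite -/B; clearbody B.
rewrite (expand_det_row B 0) big_ord_recl B00 mul0r add0r /cof_form exchange_big /=.
rewrite -sumrN; apply: eq_bigr => j _; rewrite B0l /cofactor.
rewrite (expand_det_col _ 0) -sumrN mulr_sumr mulr_sumr; apply: eq_bigr => i _.
have -> : row' 0 (col' (lift 0 j) B) i 0 = f i 0.
  rewrite !mxE -Bl0; congr (B _ _); apply: val_inj => /=.
  by rewrite /bump.
rewrite /cofactor.
have -> : row' i (col' 0 (row' 0 (col' (lift 0 j) B))) = row' i (col' j A).
  apply/matrixP => a b; rewrite !mxE -Bll; congr (B _ _); apply: val_inj => /=.
  by rewrite /bump /=; lia.
rewrite /= /bump /= add0n addn0 add1n exprS exprD; ring.
Qed.

Lemma cof_form_congr n (A P Q : 'M[F]_n.+1) f g : \det P = 1 -> \det Q = 1 ->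
  cof_form (P *m A *m Q) (P *m f) (g *m Q) = cof_form A f g.
Proof.
move=> P1 Q1; apply: oppr_inj; rewrite -!det_bordered.
have -> : block_mx 0 (g *m Q) (P *m f) (P *m A *m Q) =
  block_mx (1%:M : 'M[F]_1) 0 0 P *m block_mx 0 g f A *m block_mx (1%:M : 'M[F]_1) 0 0 Q.
  by rewrite !mulmx_block ?(mul0mx, mulmx0, mul1mx, mulmx1, addr0, add0r).
by rewrite !det_mulmx !det_ublock P1 Q1 det1 !mul1r mulr1.
Qed.

(** Subtracting multiples of the first row clears the first column. *)
Definition clear_mx n (phi : 'I_n -> F) : 'M[F]_n.+1 :=
  \matrix_(i, j) if unlift 0 i is Some i' then
    (i == j)%:R - (j == 0)%:R * phi i' else (j == 0)%:R.

Lemma det_clear n (phi : 'I_n -> F) : \det (clear_mx phi) = 1.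
Proof.
rewrite det_trig; last first.
  apply/is_trig_mxP => i j ij; rewrite mxE.
  have j0 : (j == 0) = false by apply/negbTE; rewrite -lt0n (leq_ltn_trans _ ij).
  by case: unliftP => [i' _|_]; rewrite j0 ?mul0r ?subr0// -val_eqE ltn_eqF.
rewrite big1// => i _; rewrite mxE; case: unliftP => [i' ->|-> //].
by rewrite eqxx lift_eqF mul0r subr0.
Qed.

Lemma clear_mul0 n m phi (A : 'M[F]_(n.+1, m)) j : (clear_mx phi *m A) 0 j = A 0 j.
Proof.
rewrite mxE big_ord_recl big1 ?addr0 => [|i _]; rewrite mxE unlift_none ?eqxx ?mul1r//.
by rewrite lift_eqF mul0r.
Qed.

Lemma clear_mulS n m phi (A : 'M[F]_(n.+1, m)) i j :
  (clear_mx phi *m A) (lift 0 i) j = A (lift 0 i) j - phi i * A 0 j.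
Proof.
rewrite mxE big_ord_recl mxE liftK lift_eqF eqxx mul1r sub0r mulNr addrC; congr (_ - _).
rewrite (bigD1 i)//= big1 ?addr0 => [|k ki]; rewrite mxE liftK lift_eqF mul0r subr0.
  by rewrite eqxx mul1r.
by rewrite (inj_eq lift_inj) eq_sym (negbTE ki) mul0r.
Qed.

Lemma det_first_pivot n (B : 'M[F]_n.+1) : B 0 0 != 0 -> \det B = B 0 0 *
  \det (\matrix_(i < n, j < n)
    (B (lift 0 i) (lift 0 j) - B (lift 0 i) 0 / B 0 0 * B 0 (lift 0 j))).
Proof.
move=> B0; pose phi i := B (lift 0 i) 0 / B 0 0.
rewrite -[LHS]mul1r -(det_clear phi) -det_mulmx (expand_det_col _ 0) big_ord_recl.
rewrite clear_mul0 big1 ?addr0 => [|i _]; last first.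
  by rewrite clear_mulS /phi divfK// subrr mul0r.
rewrite /cofactor expr0 mul1r; congr (_ * \det _); apply/matrixP => i j.
by rewrite [LHS]mxE [in LHS]mxE clear_mulS mxE.
Qed.

Lemma cof_form_first_pivot n (A : 'M[F]_n.+1) (f : 'cV[F]_n.+1) (g : 'rV[F]_n.+1) : f 0 0 != 0 -> g 0 0 != 0 ->
  let phi i := f (lift 0 i) 0 / f 0 0 in
  let psi j := g 0 (lift 0 j) / g 0 0 in
  cof_form A f g = f 0 0 * g 0 0 * \det (\matrix_(i < n, j < n)
    (A (lift 0 i) (lift 0 j) - phi i * A 0 (lift 0 j)
     - psi j * (A (lift 0 i) 0 - phi i * A 0 0))).
Proof.
move=> f0 g0 phi psi; pose P := clear_mx phi; pose Q := (clear_mx psi)^T.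
have mQ m (X : 'M[F]_(m, n.+1)) i j : (X *m Q) i j = (clear_mx psi *m X^T) j i.
  by rewrite /Q -[X in X *m _]trmxK -trmx_mul mxE.
rewrite -(cof_form_congr A f g (det_clear phi) (_ : \det Q = 1)); last by rewrite det_tr det_clear.
rewrite /cof_form big_ord_recl [X in _ + X]big1 ?addr0; last first.
  move=> i _; rewrite big1// => j _.
  by rewrite clear_mulS /phi divfK// subrr !mul0r.
rewrite big_ord_recl big1 ?addr0; last first.
  by move=> j _; rewrite mQ clear_mulS !mxE /psi divfK// subrr mulr0 mul0r.
rewrite clear_mul0 mQ clear_mul0 mxE; congr (_ * _).
rewrite /cofactor expr0 mul1r; congr (\det _); apply/matrixP => i j.
rewrite [LHS]mxE [LHS]mxE mQ clear_mulS ![_^T _ _]mxE !clear_mulS.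
by rewrite [RHS]mxE.
Qed.

(** Expansion along every row at once. When [A i j] is the mean of [f i * g j],
    it makes the mean of the form [n] times the determinant. *)
Lemma cof_form_det n (A : 'M[F]_n) :
  \sum_i \sum_j A i j * cofactor A i j = n%:R * \det A.
Proof.
rewrite (eq_bigr (fun=> \det A)) => [|i _]; last by rewrite -expand_det_row.
by rewrite sumr_const card_ord mulr_natl.
Qed.

End BorderedDet.

(** * Total positivity *)

Section ExponentialSums.
Variable R : realType.
Implicit Types (l : seq (R * R)) (z : seq R) (s x : R).

Definition expsum l s : R := \sum_(p <- l) p.1 * expR (p.2 * s).

Lemma der_expsum l s :
  is_derive s (1 : R) (expsum l) (expsum [seq (p.1 * p.2, p.2) | p <- l] s).
Proof.
rewrite /expsum; elim: l => [|p l IH].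
  apply: (der_ext (f := fun=> 0)); first by move=> y; rewrite big_nil.
  by rewrite big_nil; exact: der_cst.
apply: (der_ext (f := fun y => p.1 * expR (p.2 * y) + \sum_(p <- l) p.1 * expR (p.2 * y))).
  by move=> y; rewrite big_cons.
rewrite big_cons /=; apply: der_add => //.
have d1 : is_derive s (1 : R) (fun y => p.2 * y) p.2.
  apply: (is_derive_eq (der_mul (der_cst p.2 s) (is_derive_id s 1))).
  by rewrite mul0r add0r mulr1.
have d2 : is_derive s (1 : R) (fun y => expR (p.2 * y)) (p.2 * expR (p.2 * s)).
  apply: (is_derive_eq (is_derive1_comp (is_derive_expR _) d1)).
  by rewrite /GRing.scale /= mulrC.
apply: (is_derive_eq (der_mul (der_cst p.1 s) d2)).
by rewrite mul0r add0r mulrA.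
Qed.

(** Rolle's theorem with the zeros listed in increasing order from [x] on. *)
Lemma rolle_path (f f' : R -> R) x z : (forall s, is_derive s (1 : R) f (f' s)) ->
  path <%R x z -> f x = 0 -> (forall s, s \in z -> f s = 0) ->
  exists z', [/\ path <%R x z', size z' = size z & forall s, s \in z' -> f' s = 0].
Proof.
move=> df; elim: z x => [|y z IH] x /=; first by move=> _ _ _; exists [::].
move=> /andP[xy pz] fx fz.
have fy : f y = 0 by apply: fz; rewrite mem_head.
have [z' [pz' sz' z'0]] := IH y pz fy (fun s sz => fz s (mem_behead (s := y :: z) sz)).
have dr s : derivable f s 1 by case: (df s).
have [|c] := @Rolle R f x y xy (fun s _ => dr s) _ (etrans fx (esym fy)).
  by apply: derivable_within_continuous => s _.
rewrite in_itv /= => /andP[xc cy] dc.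
exists (c :: z'); split=> /=; [|by rewrite sz'|].
  rewrite xc /=; case: z' pz' {sz' z'0} => //= v z' /andP[yv ->].
  by rewrite (lt_trans cy yv).
move=> s; rewrite inE => /predU1P[->|/z'0//].
exact: der_unique (df c) dc.
Qed.

(** Divided by one of its exponentials, the sum has a constant term, which
    differentiation removes: by Rolle's theorem one zero fewer is left for one
    term fewer. *)
Lemma expsum_zeros l z : uniq [seq p.2 | p <- l] -> sorted <%R z ->
  size z = size l -> (forall s, s \in z -> expsum l s = 0) ->
  forall p, p \in l -> p.1 = 0.
Proof.
move En : (size l) => n; elim: n l z En => [|n IH] l z.
  by move=> /size0nil -> _ _ _ _ p; rewrite in_nil.
case: l => [//|[c0 a0] l] /= [sl] /andP[a0l ul].
case: z => [//|x z] /= pz [sz] z0.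
pose l1 := [seq (p.1, p.2 - a0) | p <- l].
have gE s : expR (- a0 * s) * expsum ((c0, a0) :: l) s = c0 + expsum l1 s.
  rewrite /expsum big_cons /= mulrDr; congr (_ + _).
    by rewrite mulrCA -expRD mulNr addNr expR0 mulr1.
  rewrite mulr_sumr big_map; apply: eq_bigr => p _ /=.
  by rewrite mulrCA -expRD; congr (_ * expR _); ring.
have dg s : is_derive s (1 : R) (fun s => c0 + expsum l1 s)
    (expsum [seq (p.1 * p.2, p.2) | p <- l1] s).
  by apply: (is_derive_eq (der_add (der_cst c0 s) (der_expsum l1 s))); rewrite add0r.
have g0 s : s \in x :: z -> c0 + expsum l1 s = 0.
  by move=> /z0 h; rewrite -gE h mulr0.
have [z' [pz' sz' z'0]] := rolle_path dg pz (g0 x (mem_head _ _))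
  (fun s sz => g0 s (mem_behead (s := x :: z) sz)).
have l0 p : p \in l -> p.1 = 0.
  move=> pl; pose p' := (p.1 * (p.2 - a0), p.2 - a0).
  have : p'.1 = 0.
    apply: (IH [seq (p.1 * p.2, p.2) | p <- l1] z' _ _ _ _ _ p').
    - by rewrite !size_map.
    - have -> : [seq r.2 | r <- [seq (r.1 * r.2, r.2) | r <- l1]] =
                [seq a - a0 | a <- [seq r.2 | r <- l]] by rewrite -!map_comp.
      by rewrite map_inj_uniq//; exact: addIr.
    - exact: path_sorted pz'.
    - by rewrite sz'.
    - exact: z'0.
    - by rewrite -map_comp; apply/mapP; exists p.
  move=> /eqP; rewrite mulf_eq0 subr_eq0 => /predU1P[//|/eqP e].
  by case/negP: a0l; rewrite -e; apply/mapP; exists p.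
move=> p; rewrite inE => /predU1P[->|/l0//] /=.
have := g0 x (mem_head _ _); rewrite /expsum /l1 big_map big_seq big1 ?addr0// => q ql.
by rewrite /= (l0 q ql) mul0r.
Qed.

End ExponentialSums.

Section Vandermonde.
Variable R : realType.
Implicit Types (a b : nat -> R).

Definition gvand k a (y : 'I_k -> R) : R :=
  \det (\matrix_(i < k, j < k) expR (a i * ln (y j))).

Lemma gvand_neq0 k a (y : 'I_k -> R) :
  {in [pred i | i < k]%N &, injective a} -> injective y -> (forall j, 0 < y j) ->
  gvand a y != 0.
Proof.
move=> ai yi y0; apply/negP => /det0P[v v0 vA].
case/negP: v0; apply/eqP/rowP => i; rewrite [RHS]mxE.
pose l := [seq (v 0 i, a i) | i <- enum 'I_k].
pose z := sort <=%R [seq ln (y j) | j <- enum 'I_k].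
have uz : uniq [seq ln (y j) | j <- enum 'I_k].
  rewrite map_inj_uniq ?enum_uniq// => j1 j2 /ln_inj e; apply: yi.
  by apply: e; rewrite posrE.
apply: (@expsum_zeros _ l z _ _ _ _ (v 0 i, a i)).
- rewrite -map_comp map_inj_in_uniq ?enum_uniq// => j1 j2 _ _ /= e.
  by apply: val_inj; apply: ai e; rewrite inE ltn_ord.
- by rewrite sort_lt_sorted.
- by rewrite size_sort !size_map.
- move=> s; rewrite mem_sort => /mapP[j _ ->].
  have := congr1 (fun w : 'rV_k => w 0 j) vA; rewrite [X in _ = X]mxE => vAj.
  rewrite /expsum big_map big_enum /= -[RHS]vAj mxE.
  by apply: eq_bigr => m _; rewrite mxE.
- by apply/mapP; exists i; rewrite ?mem_enum.
Qed.

Lemma continuous_sum (I : Type) (r : seq I) (f : I -> R -> R) :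
  (forall i, continuous (f i)) -> continuous (fun x => \sum_(i <- r) f i x).
Proof.
move=> fc; elim: r => [|i r IH].
  rewrite (_ : (fun x => _) = fun=> 0); first by move=> x; exact: cvg_cst.
  by apply/funext => x; rewrite big_nil.
rewrite (_ : (fun x => _) = fun x => f i x + \sum_(j <- r) f j x).
  by move=> x; apply: cvgD; [exact: fc|exact: IH].
by apply/funext => x; rewrite big_cons.
Qed.

Lemma continuous_prod (I : Type) (r : seq I) (f : I -> R -> R) :
  (forall i, continuous (f i)) -> continuous (fun x => \prod_(i <- r) f i x).
Proof.
move=> fc; elim: r => [|i r IH].
  rewrite (_ : (fun x => _) = fun=> 1); first by move=> x; exact: cvg_cst.
  by apply/funext => x; rewrite big_nil.
rewrite (_ : (fun x => _) = fun x => f i x * \prod_(j <- r) f j x).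
  by move=> x; apply: cvgM; [exact: fc|exact: IH].
by apply/funext => x; rewrite big_cons.
Qed.

Lemma continuous_det n (f : 'I_n -> 'I_n -> R -> R) :
  (forall i j, continuous (f i j)) ->
  continuous (fun x => \det (\matrix_(i < n, j < n) f i j x)).
Proof.
move=> fc.
rewrite (_ : (fun x => _) = fun x => \sum_(s : 'S_n) (-1) ^+ s * \prod_(i < n) f i (s i) x).
  apply: continuous_sum => s x; apply: cvgM; first exact: cvg_cst.
  by apply: continuous_prod.
apply/funext => x; apply: eq_bigr => s _; congr (_ * _).
by apply: eq_bigr => i _; rewrite mxE.
Qed.

Definition increasing_below k a := forall i j, (i < j)%N -> (j < k)%N -> a i < a j.

Lemma increasing_below_inj k a : increasing_below k a -> {in [pred i | i < k]%N &, injective a}.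
Proof.
move=> ia i j ik jk e; have [ij|ji|//] := ltngtP i j.
  by have := ia i j ij jk; rewrite e ltxx.
by have := ia j i ji ik; rewrite e ltxx.
Qed.

(** The determinant cannot vanish while the exponents move from [a] to [b]. *)
Lemma gvand_same_sign k a b (y : 'I_k -> R) :
  increasing_below k a -> increasing_below k b -> injective y -> (forall j, 0 < y j) ->
  0 < gvand a y * gvand b y.
Proof.
move=> ia ib yi y0.
pose h x := gvand (fun i => (1 - x) * a i + x * b i) y.
have hc : continuous h.
  apply: continuous_det => i j x; apply: continuous_comp; last exact: continuous_expR.
  apply: cvgM; last exact: cvg_cst.
  apply: cvgD; apply: cvgM; try exact: cvg_cst; last exact: cvg_id.
  by apply: cvgB; [exact: cvg_cst|exact: cvg_id].
have h0 x : 0 <= x <= 1 -> h x != 0.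
  move=> /andP[x0 x1]; apply: gvand_neq0 => //; apply: increasing_below_inj => i j ij jk.
  have := ia i j ij jk; have := ib i j ij jk => l1 l2.
  have [->|xn] := eqVneq x 0; first by rewrite subr0 !mul1r !mul0r !addr0.
  by apply: ler_ltD; [rewrite ler_wpM2l ?subr_ge0// ltW|rewrite ltr_pM2l// lt_def xn].
have e0 : gvand a y = h 0.
  by congr (gvand _ y); apply/funext => i; rewrite subr0 mul1r mul0r addr0.
have e1 : gvand b y = h 1.
  by congr (gvand _ y); apply/funext => i; rewrite subrr mul1r mul0r add0r.
rewrite e0 e1 ltNge; apply/negP => le0.
have n0 := h0 0; rewrite lexx ler01 in n0; have n1 := h0 1; rewrite lexx ler01 in n1.
have {n0 n1}[n0 n1] := (n0 isT, n1 isT).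
have [||c] := @IVT R h 0 1 0 ler01; first exact: continuous_subspaceT.
  rewrite ge_min le_max; case: (ltgtP (h 0) 0) (n0) => //= s0 _.
    by rewrite leNgt; apply/negP => s1; move: le0; rewrite leNgt nmulr_rgt0// s1.
  rewrite ?orbT ?andbT leNgt; apply/negP => s1; by move: le0; rewrite leNgt pmulr_rgt0// s1.
by rewrite in_itv /= => /h0 /eqP.
Qed.

End Vandermonde.

Section PositiveIntegrals.
Variable R : realType.
Implicit Types (f g : nat -> R -> R) (E : seq R).

Definition sys_det k f (y : 'I_k -> R) : R := \det (\matrix_(i < k, j < k) f i (y j)).

(** The hypothesis that lets the induction of [det_umean_gt0] go through. The
    sign of a single collocation determinant depends on the order of the points;
    that of the product of two does not, so the points need not be ordered. The
    set [E] collects the points at which the systems have been reduced. *)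
Definition copositive n E f g :=
  (forall k (y : 'I_k -> R), (k <= n)%N -> injective y ->
     (forall j, [/\ 0 < y j, y j < 1 & y j \notin E]) -> 0 < sys_det f y * sys_det g y) /\
  (forall x i, x \in E -> f i x = 0).

(** What is left of the system when multiples of its first function are
    subtracted so that the others vanish at the point [x]. *)
Definition reduce_at x f : nat -> R -> R := fun i y => f i.+1 y - f i.+1 x / f 0%N x * f 0%N y.

Lemma sys_det_reduce k f x (y : 'I_k -> R) : f 0%N x != 0 ->
  sys_det f (fun j : 'I_k.+1 => oapp y x (unlift 0 j)) = f 0%N x * sys_det (reduce_at x f) y.
Proof.
move=> f0; rewrite /sys_det det_first_pivot; rewrite mxE unlift_none //=.
congr (_ * \det _); apply/matrixP => i j; rewrite !mxE !liftK unlift_none /=.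
by rewrite /reduce_at.
Qed.

Lemma copositive_at n E f g x : copositive n.+1 E f g ->
  0 < x -> x < 1 -> x \notin E -> 0 < f 0%N x * g 0%N x.
Proof.
move=> [fg _] x0 x1 xE; have := fg 1%N (fun=> x) (ltn0Sn n) _ (fun=> And3 x0 x1 xE).
rewrite /sys_det !det_mx11 !mxE; apply.
by move=> i j _; rewrite !ord1.
Qed.

Lemma copositive_reduce n E f g x : copositive n.+1 E f g ->
  0 < x -> x < 1 -> x \notin E ->
  copositive n (x :: E) (reduce_at x f) (reduce_at x g).
Proof.
move=> cfg x0 x1 xE; have fg0 := copositive_at cfg x0 x1 xE.
have f0 : f 0%N x != 0 by apply: contraTneq fg0 => ->; rewrite mul0r ltxx.
have g0 : g 0%N x != 0 by apply: contraTneq fg0 => ->; rewrite mulr0 ltxx.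
case: (cfg) => fg fE; split=> [k y kn yi yE|z i]; last first.
  rewrite inE => /predU1P[->|zE]; first by rewrite /reduce_at divfK ?subrr.
  by rewrite /reduce_at (fE z i.+1 zE) (fE z 0%N zE) mulr0 subrr.
have := fg k.+1 (fun j : 'I_k.+1 => oapp y x (unlift 0 j)) kn.
rewrite !sys_det_reduce// mulrACA pmulr_rgt0//; apply=> [j1 j2|j]; last first.
  case: unliftP => [j' _|_] /=; last by [].
  by have [? ?] := yE j'; rewrite inE negb_or => /andP[].
case: unliftP => [j1' ->|->]; case: unliftP => [j2' ->|->] //=.
- by move=> /yi ->.
- by move=> e; have [_ _] := yE j1'; rewrite e mem_head.
- by move=> e; have [_ _] := yE j2'; rewrite -e mem_head.
Qed.

(** Induction on the size: [n.+1] times the determinant is the average of a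
    bordered form, which at each point [x] is a positive multiple of the
    determinant of the systems reduced at [x]. *)
Theorem det_umean_gt0 n E f g : copositive n E f g ->
  (forall i j, uint (fun x => f i x * g j x)) ->
  0 < \det (\matrix_(i < n, j < n) umean (fun x => f i x * g j x)).
Proof.
elim: n E f g => [|n IH] E f g cfg fgi; first by rewrite det_mx00.
set A := \matrix_(i, j) _.
pose fv x : 'cV[R]_n.+1 := \col_i f i x; pose gv x : 'rV[R]_n.+1 := \row_j g j x.
pose S x := cof_form A (fv x) (gv x).
have SE x : S x = \sum_(i < n.+1) \sum_(j < n.+1) cofactor A i j * (f i x * g j x).
  by apply: eq_bigr => i _; apply: eq_bigr => j _; rewrite !mxE mulrC.
have iij (i j : 'I_n.+1) : uint (fun x => cofactor A i j * (f i x * g j x)) by exact: uintZ.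
have iS : uint S.
  apply: uint_ext (uint_sum (index_enum _) (fun i => uint_sum (index_enum _) (fun j => iij i j))).
  by move=> x _ _; rewrite SE.
have mS : umean S = n.+1%:R * \det A.
  rewrite -cof_form_det (umean_ext (g := fun x =>
    \sum_(i < n.+1) \sum_(j < n.+1) cofactor A i j * (f i x * g j x))).
    rewrite umean_sum => [|i]; last exact: uint_sum.
    apply: eq_bigr => i _; rewrite umean_sum//; apply: eq_bigr => j _.
    by rewrite umeanZ// mxE mulrC.
  by move=> x _ _; rewrite SE.
suff : 0 < umean S by rewrite mS pmulr_rgt0.
have SxE x : x \in E -> S x = 0.
  move=> xE; rewrite SE big1// => i _; rewrite big1// => j _.
  by rewrite (cfg.2 x i xE) mul0r mulr0.
have Sx x : 0 < x -> x < 1 -> x \notin E -> 0 < S x.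
  move=> x0 x1 xE; have fg0 := copositive_at cfg x0 x1 xE.
  have f0 : f 0%N x != 0 by apply: contraTneq fg0 => ->; rewrite mul0r ltxx.
  have g0 : g 0%N x != 0 by apply: contraTneq fg0 => ->; rewrite mulr0 ltxx.
  rewrite /S cof_form_first_pivot; [|by rewrite mxE..].
  rewrite !mxE /= mulr_gt0//.
  pose f' := reduce_at x f; pose g' := reduce_at x g.
  have rE i j y : f' i y * g' j y = f i.+1 y * g j.+1 y - f i.+1 x / f 0%N x * (f 0%N y * g j.+1 y)
      - g j.+1 x / g 0%N x * (f i.+1 y * g 0%N y - f i.+1 x / f 0%N x * (f 0%N y * g 0%N y)).
    by rewrite /f' /g' /reduce_at; ring.
  have i1 i j : uint (fun y => f i.+1 y * g j y - f i.+1 x / f 0%N x * (f 0%N y * g j y)).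
    by apply: uintB => //; exact: uintZ.
  have i' i j : uint (fun y => f' i y * g' j y).
    apply: uint_ext (uintB (i1 i j.+1) (uintZ (g j.+1 x / g 0%N x) (i1 i 0%N))) => y _ _.
    by rewrite rE.
  have := IH (x :: E) f' g' (copositive_reduce cfg x0 x1 xE) i'.
  congr (0 < \det _); apply/matrixP => i j; rewrite !mxE /=.
  rewrite (umean_ext (fun y _ _ => rE i j y)) umeanB//; last exact: uintZ.
  rewrite umeanZ// !umeanB//; try exact: uintZ.
  by rewrite !umeanZ.
apply: (umean_gt0 (s := E)) => // x x0 x1; have [xE|xE] := boolP (x \in E).
  by rewrite SxE.
by rewrite ltW// Sx.
Qed.

(** The systems are the real powers [x `^ a i] and [x `^ (b i - 1)]; the weight
    is a positive factor of the columns of the second one. *)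
Lemma det_mom_gt0 n (a b : nat -> R) (w : R -> R) :
  increasing_below n a -> increasing_below n b -> continuous w -> (forall x, 0 < w x) ->
  (forall i j, 0 < a i + b j) ->
  0 < \det (\matrix_(i < n, j < n) mom (a i + b j) w).
Proof.
move=> ia ib cw w0 ab0.
pose f i x := x `^ (a i); pose g j x := x `^ (b j - 1) * w x.
have fgE i j x : 0 < x -> f i x * g j x = x `^ (a i + b j - 1) * w x.
  move=> x0; rewrite /f /g mulrA -powRD ?(gt_eqF x0) ?implybT//.
  by rewrite addrA.
have fgi i j : uint (fun x => f i x * g j x).
  by apply: uint_ext (uint_mom (ab0 i j) cw) => x x0 _; rewrite fgE.
have -> : \matrix_(i < n, j < n) mom (a i + b j) w =
          \matrix_(i < n, j < n) umean (fun x => f i x * g j x).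
  by apply/matrixP => i j; rewrite !mxE; apply: umean_ext => x x0 _; rewrite fgE.
apply: (@det_umean_gt0 n [::]) => //; split=> // k y kn yi yE.
have y0 j : 0 < y j by have [] := yE j.
have -> : sys_det f y = gvand a y.
  by congr (\det _); apply/matrixP => i j; rewrite !mxE /f /powR gt_eqF.
have -> : sys_det g y = gvand (fun i => b i - 1) y * \prod_(j < k) w (y j).
  have -> : \prod_(j < k) w (y j) = \det (diag_mx (\row_j w (y j))).
    by rewrite det_diag; apply: eq_bigr => j _; rewrite mxE.
  rewrite /gvand -det_mulmx mul_mx_diag; congr (\det _).
  by apply/matrixP => i j; rewrite !mxE /g /powR gt_eqF.
rewrite mulrA pmulr_lgt0; last by apply: prodr_gt0 => j _.
apply: gvand_same_sign => //.
  by move=> i j ij jk; apply: ia => //; exact: leq_trans kn.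
by move=> i j ij jk; rewrite ltrD2r; apply: ib => //; exact: leq_trans kn.
Qed.

End PositiveIntegrals.

(** * The deformed moment matrix *)

Section PineiroMoments.
Variable R : realType.
Variables p q : nat.
Hypotheses (p0 : (0 < p)%N) (q0 : (0 < q)%N).
Variables (alpha : p.-tuple R) (beta : q.-tuple R).
Implicit Types (w : R -> R) (x : R).

Lemma mx_entryE (A : 'M[R]_(q, p)) j i (jq : (j < q)%N) (ip : (i < p)%N) :
  mx_entry A j i = A (Ordinal jq) (Ordinal ip).
Proof. by rewrite /mx_entry !insubT. Qed.

Lemma Kmx_atE n (i j : 'I_n) x : Kmx_at n x i j =
  if j == i.+1 :> nat then 1 else if (i.+1 == n) && (j == 0 :> nat) then x else 0.
Proof.
rewrite !mxE; case: eqP => _; first by rewrite hornerC.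
by case: ifP => _; rewrite ?hornerX ?hornerC.
Qed.

Lemma Kmx_mul n m (Y : 'M[R]_(n, m)) (i : 'I_n) j x (n0 : (0 < n)%N) :
  (Kmx_at n x *m Y) i j =
  if insub i.+1 is Some i' then Y i' j else x * Y (Ordinal n0) j.
Proof.
rewrite mxE; case: insubP => [i' /= lt e|].
  rewrite (bigD1 i')//= big1 ?addr0 => [|k ki]; rewrite Kmx_atE.
    by rewrite e eqxx mul1r.
  have -> : (k == i.+1 :> nat) = false.
    by apply: contraNF ki => /eqP ki; apply/eqP/val_inj; rewrite /= ki e.
  by rewrite (ltn_eqF lt) mul0r.
rewrite -leqNgt => ge; have e : i.+1 = n by apply/eqP; rewrite eqn_leq ltn_ord.
rewrite (bigD1 (Ordinal n0))//= big1 ?addr0 => [|k ki]; rewrite Kmx_atE /=.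
  by rewrite e !eqxx andbT.
rewrite e eqxx ltn_eqF ?ltn_ord//= (_ : (k == 0 :> nat) = false) ?mul0r//.
by apply: contraNF ki => /eqP ki; apply/eqP/val_inj.
Qed.

Lemma divmodS n r : (0 < n)%N ->
  if ((r %% n).+1 < n)%N then ((r.+1 %/ n = r %/ n) /\ (r.+1 %% n = (r %% n).+1))%N
  else ((r.+1 %/ n = (r %/ n).+1) /\ (r.+1 %% n = 0) /\ ((r %% n).+1 = n))%N.
Proof.
move=> n0; have e := divn_eq r n; have lt := ltn_pmod r n0; case: ifP => h.
  have -> : r.+1 = (r %/ n * n + (r %% n).+1)%N by rewrite addnS -e.
  by rewrite divnMDl// modnMDl (divn_small h) (modn_small h) addn0.
have en : (r %% n).+1 = n by lia.
have -> : r.+1 = ((r %/ n).+1 * n)%N by rewrite mulSn addnC -{3}en addnS -e.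
by rewrite mulnK// modnMl.
Qed.

(** Left multiplication by the shift matrix passes to the next row of the
    density, after the last one back to the first with one more power of [x].
    The rows of the step-line moment matrix are numbered in the same way, so it
    deletes the first of them; likewise for columns. *)
Lemma moment_Kmx_row (Phi : R -> 'M[R]_(q, p)) r s :
  moment_matrix (fun x => Kmx_at q x *m Phi x) r s = moment_matrix Phi r.+1 s.
Proof.
apply: eq_Rintegral => x _.
have jq := ltn_pmod r q0; have ip := ltn_pmod s p0; have jq' := ltn_pmod r.+1 q0.
rewrite !mx_entryE (Kmx_mul _ _ _ _ q0) /=.
have := divmodS r q0; case: insubP => [i' /= lt e|/negbTE ge]; rewrite ?lt ?ge.
  move=> [d m]; rewrite d; congr (_ * Phi x _ _).
  by apply: val_inj; rewrite /= e m.
move=> [d [m e]]; rewrite d addSn exprSr -mulrA; congr (_ * (_ * Phi x _ _)).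
by apply: val_inj; rewrite /= m.
Qed.

Lemma moment_Kmx_col (Phi : R -> 'M[R]_(q, p)) r s :
  moment_matrix (fun x => Phi x *m (Kmx_at p x)^T) r s = moment_matrix Phi r s.+1.
Proof.
apply: eq_Rintegral => x _.
have jq := ltn_pmod r q0; have ip := ltn_pmod s p0; have ip' := ltn_pmod s.+1 p0.
rewrite !mx_entryE -[Phi x in LHS]trmxK -trmx_mul mxE (Kmx_mul _ _ _ _ p0) /=.
have := divmodS s p0; case: insubP => [i' /= lt e|/negbTE ge]; rewrite ?lt ?ge.
  move=> [d m]; rewrite d mxE; congr (_ * Phi x _ _).
  by apply: val_inj; rewrite /= e m.
move=> [d [m e]]; rewrite d addnS exprSr -mulrA mxE; congr (_ * (_ * Phi x _ _)).
by apply: val_inj; rewrite /= m.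
Qed.

Lemma vertex_momentE w b a :
  vertex_moment alpha beta w b a = vertex (pineiro_moment alpha beta w) b a.
Proof.
have col : forall s r, vertex_moment alpha beta w 0 a r s = pineiro_moment alpha beta w r (s + a)%N.
  elim: a => [|a IH] s r.
    rewrite addn0; apply: eq_Rintegral => x _.
    by rewrite /vertex_density expr0 expr0 mul1mx trmx1 mulmx1.
  rewrite addnS -addSn -IH /vertex_moment -moment_Kmx_col; apply: eq_Rintegral => x _.
  by rewrite /vertex_density exprS trmx_mul mulmxA.
apply: imxP => r s; rewrite /vertex -col.
elim: b r => [|b IH] r; first by rewrite addn0.
rewrite addnS -addSn -IH /vertex_moment -moment_Kmx_row; apply: eq_Rintegral => x _.
by rewrite /vertex_density exprS !mulmxA.
Qed.

Lemma pineiro_momentE w r s :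
  pineiro_moment alpha beta w r s = mom (xnode beta r + ynode alpha s) w.
Proof.
apply: eq_Rintegral => x; rewrite inE => /unit_itvP[x0 _].
have jq := ltn_pmod r q0; have ip := ltn_pmod s p0.
rewrite mx_entryE !mxE /= mulrA; congr (_ * _).
rewrite -powR_mulrn ?ltW// -powRD; last by rewrite (gt_eqF x0) implybT.
by congr (x `^ _); rewrite /xnode /ynode natrD; ring.
Qed.

Hypotheses (alpha_sorted : sorted <%R alpha) (alpha_range : alpha`_p.-1 < alpha`_0 + 1).
Hypotheses (beta_sorted : sorted <%R beta) (beta_range : beta`_q.-1 < beta`_0 + 1).
Hypothesis ab0 : 0 < alpha`_0 + beta`_0 + 1.

(** Sorted within one unit and continued by integer steps: the nodes increase. *)
Lemma node_lt n (t : n.-tuple R) : (0 < n)%N -> sorted <%R t -> t`_n.-1 < t`_0 + 1 ->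
  {homo (fun r => (r %/ n)%:R + t`_(r %% n)) : i j / (i < j)%N >-> i < j}.
Proof.
move=> n0 st rt; apply: (homo_ltn lt_trans) => r.
have := divmodS r n0; case: ifP => h.
  move=> [-> ->]; rewrite ltrD2l; apply: (sorted_ltn_nth lt_trans) => //.
  - by rewrite inE size_tuple (leq_trans _ h).
  - by rewrite inE size_tuple.
move=> [-> [-> e]]; rewrite -natr1 -addrA ltrD2l [1 + _]addrC.
by have -> : (r %% n = n.-1)%N by rewrite -[in RHS]e.
Qed.

Lemma xnode_lt : {homo xnode beta : i j / (i < j)%N >-> i < j}.
Proof. exact: (node_lt q0). Qed.

Lemma ynode_lt : {homo ynode alpha : i j / (i < j)%N >-> i < j}.
Proof. by move=> i j ij; rewrite /ynode ltrD2r; exact: (node_lt p0). Qed.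

Lemma node_gt0 r s : 0 < xnode beta r + ynode alpha s.
Proof.
have x0 : xnode beta 0 <= xnode beta r.
  by case: r => [//|r]; rewrite ltW// xnode_lt.
have y0 : ynode alpha 0 <= ynode alpha s.
  by case: s => [//|s]; rewrite ltW// ynode_lt.
have e : xnode beta 0 + ynode alpha 0 = alpha`_0 + beta`_0 + 1.
  by rewrite /xnode /ynode !div0n !mod0n; ring.
by apply: lt_le_trans (lerD x0 y0); rewrite e.
Qed.

Lemma pineiro_tp w : continuous w -> (forall x, 0 < w x) ->
  totally_positive (pineiro_moment alpha beta w).
Proof.
move=> cw w0 [|n] rows cols hr hc; first by rewrite det_mx00.
have := @det_mom_gt0 R n.+1 (fun i => xnode beta (rows (inord i)))
  (fun j => ynode alpha (cols (inord j))) w _ _ cw w0 (fun i j => node_gt0 _ _).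
rewrite (_ : \matrix_(i, j) _ = \matrix_(i < n.+1, j < n.+1) pineiro_moment alpha beta w (rows i) (cols j)).
  apply=> i j ij jn.
    by apply: xnode_lt; apply: hr; rewrite !inordK//; exact: ltn_trans jn.
  by apply: ynode_lt; apply: hc; rewrite !inordK//; exact: ltn_trans jn.
by apply/matrixP => i j; rewrite !mxE pineiro_momentE !inord_val.
Qed.

Lemma xnode_add r n : xnode beta (r + q * n) = xnode beta r + n%:R.
Proof.
rewrite /xnode addnC mulnC modnMDl divnMDl// natrD; ring.
Qed.

Lemma ynode_add s n : ynode alpha (s + p * n) = ynode alpha s + n%:R.
Proof.
rewrite /ynode addnC mulnC modnMDl divnMDl// natrD; ring.
Qed.

Lemma pineiro_step_line w : step_line p q (pineiro_moment alpha beta w).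
Proof.
move=> r s; rewrite !pineiro_momentE -[p in (s + p)%N]muln1 -[q in (r + q)%N]muln1.
by rewrite xnode_add ynode_add; congr (mom _ w); ring.
Qed.

Section Times.
Variable L : nat.
Implicit Types (t : 'I_L -> R) (l : 'I_L).

Lemma multi_time_gt0 t x : 0 < multi_time t x.
Proof. exact: expR_gt0. Qed.

Lemma continuous_multi_time t : continuous (multi_time t).
Proof.
move=> x; apply: continuous_comp; last exact: continuous_expR.
apply: (continuous_sum (f := fun (l : 'I_L) x => t l * x ^+ l.+1)) => l y.
by apply: cvgM; [exact: cvg_cst|exact: exprn_continuous].
Qed.

(** One time at a time: the other times are part of the weight. *)
Lemma multi_time_set t l y :
  multi_time (set_time t l y) = fun x => expR (y * x ^+ l.+1) * multi_time (set_time t l 0) x.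
Proof.
apply/funext => x; rewrite /multi_time -expRD; congr expR.
rewrite (bigD1 l)//= [in RHS](bigD1 l)//= !set_timeE mul0r add0r; congr (_ + _).
by apply: eq_bigr => m /negbTE ml; rewrite /set_time ml.
Qed.

Lemma partial_moment l t r s :
  is_partial l (fun t => pineiro_moment alpha beta (multi_time t) r s) t
    (pineiro_moment alpha beta (multi_time t) (r + q * l.+1) s).
Proof.
have d := der_mom l.+1 (t l) (node_gt0 r s) (continuous_multi_time (t := set_time t l 0)).
rewrite -multi_time_set set_timeK in d.
have e : pineiro_moment alpha beta (multi_time t) (r + q * l.+1) s =
    mom (xnode beta r + ynode alpha s + l.+1%:R) (multi_time t).
  by rewrite pineiro_momentE xnode_add addrAC.
rewrite e; move: d; apply: der_ext => y.
by rewrite -multi_time_set pineiro_momentE.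
Qed.

End Times.

Lemma multi_time1 (y : R) : multi_time ((fun=> y) : 'I_1 -> R) = first_time y.
Proof. by apply/funext => x; rewrite /multi_time big_ord1 expr1. Qed.

Lemma first_time0 : @first_time R 0 = fun=> 1.
Proof. by apply/funext => x; rewrite /first_time mul0r expR0. Qed.

End PineiroMoments.

(** * Connections and selected refactorizations *)

Section RotateFlow.
Variable R : realType.
Implicit Types (s : seq (cfactor R)).

(** Unlike a remainder modulo [M], the value at [k + r = M] is [M], in agreement
    with [rot_add_mod]; the cyclic products at [M] and at 0 coincide. *)
Definition rot_index M r k : nat := if (k + r <= M)%N then (k + r)%N else (k + r - M)%N.

Lemma cyc_rot s r k : (r <= size s)%N -> (k <= size s)%N ->
  cyc (rot r s) k = cyc s (rot_index (size s) r k).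
Proof. by move=> rs ks; rewrite /cyc rot_add_mod. Qed.

Lemma cyc_rotS s r k : (r <= size s)%N -> (k < size s)%N ->
  cyc (rot r s) k = cyc s ((k + r) %% size s) /\
  cyc (rot r s) k.+1 = cyc s ((k + r) %% size s).+1.
Proof.
move=> rs ks; rewrite !cyc_rot// ?(ltnW ks)//.
have s0 : (0 < size s)%N by lia.
have [lt|ge] := ltnP (k + r) (size s).
  by rewrite modn_small// /rot_index addSn lt (ltnW lt).
have -> : ((k + r) %% size s = k + r - size s)%N.
  by rewrite -{1}(subnK ge) modnDr modn_small//; lia.
rewrite /rot_index; split.
  case: leqP => // le; have -> : (k + r = size s)%N by lia.
  by rewrite subnn cyc_size.
by rewrite addSn ltnNge ge /= subSn.
Qed.

Lemma nth_rot s r k : (r <= size s)%N -> (k < size s)%N ->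
  nth (dflt R) (rot r s) k = nth (dflt R) s ((k + r) %% size s).
Proof.
move=> rs ks; rewrite /rot nth_cat size_drop nth_drop.
have [lt|ge] := ltnP k (size s - r).
  by rewrite addnC modn_small//; lia.
rewrite nth_take; last by lia.
have e : (k + r = k - (size s - r) + size s)%N by lia.
by rewrite e modnDr modn_small//; lia.
Qed.

Lemma flow_rot (s : R -> seq (cfactor R)) M m r x : (forall y, size (s y) = M) ->
  (r <= M)%N -> flow_at s m x -> flow_at (fun y => rot r (s y)) m x.
Proof.
move=> sz rM fl k n; rewrite size_rot sz => kM.
have nE y : nth (dflt R) (rot r (s y)) k = nth (dflt R) (s y) ((k + r) %% M).
  by rewrite nth_rot ?sz.
have lt : ((k + r) %% M < M)%N by rewrite ltn_mod; lia.
have [e1 e2] : cyc (rot r (s x)) k = cyc (s x) ((k + r) %% M) /\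
    cyc (rot r (s x)) k.+1 = cyc (s x) ((k + r) %% M).+1.
  by have := @cyc_rotS (s x) r k; rewrite sz; apply.
rewrite /flow_rhs nE e1 e2; have := fl ((k + r) %% M)%N n; rewrite sz => /(_ lt).
by apply: der_ext => y; rewrite nE.
Qed.

End RotateFlow.

Section Selected.
Variable R : realType.
Variables p q : nat.
Hypotheses (p0 : (0 < p)%N) (q0 : (0 < q)%N).
Variables (alpha : p.-tuple R) (beta : q.-tuple R).

Section OneWeight.
Variable w : R -> R.
Let X := pineiro_moment alpha beta w.
Hypothesis tp : totally_positive X.

Let t0 b a n : tau (vertex X b a) n != 0.
Proof. exact/tp_tauN0/tp_vertex. Qed.

Let gb b a : gauss_borel (vertex_moment alpha beta w b a) (gb_of (vertex X b a)).
Proof. by rewrite vertex_momentE//; exact: gb_ofP. Qed.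

Lemma gauss_borel_vertex b a :
  unique (gauss_borel (vertex_moment alpha beta w b a)) (gb_of (vertex X b a)) /\
  gb_positive (gb_of (vertex X b a)).
Proof.
split; last by apply: gb_of_positive; exact: tp_vertex.
by split=> [|D gD]; [exact: gb|exact: gauss_borel_unique (gb b a) gD].
Qed.

Lemma lower_connection b a :
  let X := mkL (fun n => pivot (vertex X b a) n.+1 / pivot (vertex X b a.+1) n) in
  unique (christoffel_lower alpha beta w b a) X /\ normalized_pos_lower X.
Proof.
have g0 := gb_ofP (t0 b a); have g1 := gb_ofP (t0 b a.+1).
have MM := vertexS_col X b a; have cE := conn_lower_coef b a tp.
move=> C; split; last first.
  by apply: (pos_to_factor (f := (true, _))) => n /=; rewrite divr_gt0// tp_pivot//; exact: tp_vertex.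
have nC := normalized_mkL (fun n => pivot (vertex X b a) n.+1 / pivot (vertex X b a.+1) n).
have [rC cC] := rb_bidiag_lower nC.
split=> [|C' [nC' [D [D' [gD gD' hB hA]]]]].
  split=> //; exists (gb_of (vertex X b a)), (gb_of (vertex X b a.+1)).
  split; [exact: gb|exact: gb| |].
    apply/(arrayB_lcomb q0) => //; [exact: gb_lower g0|exact: gb_lower g1|].
    by rewrite /C -cE; exact: conn_lowerL g0 g1.
  apply/(arrayA_lcombK p0) => //; [exact: gb_upper g0|exact: gb_upper g1|].
  by rewrite /C -cE; exact: conn_lowerU g0 g1 MM.
rewrite vertex_momentE// in gD; rewrite vertex_momentE// in gD'.
have eD := gauss_borel_unique gD g0; have eD' := gauss_borel_unique gD' g1.
subst D D'; have [rC' _] := rb_bidiag_lower nC'.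
move: hB => /(arrayB_lcomb q0 rC' (gb_lower g0) (gb_lower g1)) hB.
by rewrite /C -cE (conn_lower_unique g1 hB rC').
Qed.

Lemma upper_connection b a :
  let X := mkU (fun n => pivot (vertex X b.+1 a) n / pivot (vertex X b a) n) in
  unique (christoffel_upper alpha beta w b a) X /\ normalized_pos_upper X.
Proof.
have g0 := gb_ofP (t0 b a); have g1 := gb_ofP (t0 b.+1 a).
have MM := vertexS_row X b a; have cE := conn_upper_coef b a tp.
move=> C; split; last first.
  by apply: (pos_to_factor (f := (false, _))) => n /=; rewrite divr_gt0// tp_pivot//; exact: tp_vertex.
have nC := normalized_mkU (fun n => pivot (vertex X b.+1 a) n / pivot (vertex X b a) n).
have [rC cC] := rb_bidiag_upper nC.
split=> [|C' [nC' [D [D' [gD gD' hB hA]]]]].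
  split=> //; exists (gb_of (vertex X b a)), (gb_of (vertex X b.+1 a)).
  split; [exact: gb|exact: gb| |].
    apply/(arrayB_lcombK q0) => //; [exact: gb_lower g0|exact: gb_lower g1|].
    by rewrite /C -cE; exact: conn_upperL g0 g1 MM.
  apply/(arrayA_lcomb p0) => //; [exact: gb_upper g0|exact: gb_upper g1|].
  by rewrite /C -cE; exact: conn_upperU g0 g1.
rewrite vertex_momentE// in gD; rewrite vertex_momentE// in gD'.
have eD := gauss_borel_unique gD g0; have eD' := gauss_borel_unique gD' g1.
subst D D'; have [_ cC'] := rb_bidiag_upper nC'.
move: hA => /(arrayA_lcomb p0 cC' (gb_upper g0) (gb_upper g1)) hA.
by rewrite /C -cE (conn_upper_unique g1 hA cC').
Qed.

Lemma pineiro_factorsP F : pineiro_factors alpha beta w F <->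
  F = map (@to_factor R) (init_factors p q X).
Proof.
have sl : step_line p q X by exact: pineiro_step_line.
rewrite (init_factorsE p0 q0 sl) map_cat -!map_comp; split=> [[L [U [hL hU ->]]]|->].
  congr (_ ++ _); apply/eq_in_map => k.
    rewrite mem_iota => /andP[_ kp] /=.
    by rewrite -((lower_connection 0 k).1.2 _ (hL k kp)).
  rewrite mem_rev mem_iota => /andP[_ kq] /=.
  by rewrite -((upper_connection k 0).1.2 _ (hU k kq)).
exists (fun a => mkL (fun n => pivot (vertex X 0 a) n.+1 / pivot (vertex X 0 a.+1) n)),
  (fun b => mkU (fun n => pivot (vertex X b.+1 0) n / pivot (vertex X b 0) n)).
by split=> // [a _|b _]; [exact: (lower_connection 0 a).1.1|exact: (upper_connection b 0).1.1].
Qed.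

(** Whatever the order of the replacements, the selected factors are the ones
    reached from the connections. *)
Lemma selected_unique a s' :
  creach (rot a.-1 (init_factors p q X)) s' -> map fst s' = sigma_min p q ->
  unique (selected_factors alpha beta w a) (map (@to_factor R) s').
Proof.
move=> r sw; have pos : pos_list (rot a.-1 (init_factors p q X)).
  have ps : pos_list (init_factors p q X).
    move=> k; rewrite size_init => kM; rewrite -/(dflt R) nth_init// => n /=.
    by rewrite divr_gt0// tp_pivot//; exact: tp_cyc_vertex.
  rewrite /rot; apply/pos_list_cat.
  by move: ps; rewrite -{1}(cat_take_drop a.-1 (init_factors p q X)) => /pos_list_cat[].
have wE (s : seq (cfactor R)) : [seq is_lower f | f <- map (@to_factor R) s] = map fst s.
  by rewrite -map_comp; apply: eq_map => f; exact: is_lower_to_factor.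
split=> [|F [F0 [/pineiro_factorsP -> st ww]]].
  exists (map (@to_factor R) (init_factors p q X)); split.
  - exact/pineiro_factorsP.
  - by rewrite -map_rot; exact: creach_star.
  - by rewrite wE.
rewrite -map_rot in st; have [s2 r2 e2] := star_creach st.
by rewrite e2 (creach_word_inj r r2)// sw -wE -e2 ww.
Qed.

End OneWeight.

Hypotheses (alpha_sorted : sorted <%R alpha) (alpha_range : alpha`_p.-1 < alpha`_0 + 1).
Hypotheses (beta_sorted : sorted <%R beta) (beta_range : beta`_q.-1 < beta`_0 + 1).
Hypothesis ab0 : 0 < alpha`_0 + beta`_0 + 1.

Section Family.
Variable L : nat.
Let X (t : 'I_L -> R) := pineiro_moment alpha beta (multi_time t).

Lemma X_tp t : totally_positive (X t).
Proof.
exact: (pineiro_tp p0 q0 alpha_sorted alpha_range beta_sorted beta_range ab0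
  (continuous_multi_time (t := t)) (multi_time_gt0 t)).
Qed.

Lemma X_partial l t r s :
  is_partial l (fun t => X t r s) t (X t (r + q * l.+1)%N s).
Proof.
exact: (partial_moment p0 q0 alpha_sorted alpha_range beta_sorted beta_range ab0).
Qed.

(** Positivity, the Lax equations and rationality in the moments, which the
    replacements preserve together. *)
Definition family_inv (s : ('I_L -> R) -> seq (cfactor R)) :=
  [/\ forall t, pos_list (s t),
      forall l t, flow_at (fun y => s (set_time t l y)) l.+1 (t l) &
      forall k n, det_rational X (fun t => (nth (dflt R) (s t) k).2 n)].

Lemma family_inv_init r : (r <= p + q)%N ->
  family_inv (fun t => rot r (init_factors p q (X t))).
Proof.
move=> rM; have sl t : step_line p q (X t) by exact: pineiro_step_line.
split=> [t|l t|k n].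
- rewrite /rot; apply/pos_list_cat.
  have := @init_pos R p q L X X_tp t; rewrite -{1}(cat_take_drop r (init_factors p q (X t))).
  by move=> /pos_list_cat[].
- apply: (flow_rot (s := fun y => init_factors p q (X (set_time t l y))) (M := (p + q)%N)) => //.
    by move=> y; rewrite size_init.
  exact: (init_flow p0 q0 X_tp sl X_partial).
have [kM|kM] := ltnP k (p + q); last first.
  by apply: det_rational_ext (det_rational0 X) => t; rewrite nth_default// size_rot size_init.
have lt : ((k + r) %% (p + q) < p + q)%N by rewrite ltn_mod; lia.
apply: det_rational_ext (init_rational (X := X) X_tp n lt) => t.
by rewrite nth_rot size_init.
Qed.

Lemma family_inv_step (s1 : ('I_L -> R) -> seq (cfactor R)) u l s2 v1 v2 :
  (forall t, map fst (s1 t) = v1) -> (forall t, map fst (s2 t) = v2) ->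
  family_inv (fun t => s1 t ++ [:: (false, u t); (true, l t)] ++ s2 t) ->
  family_inv (fun t => s1 t ++ [:: (true, star_lo (u t) (l t));
                                 (false, star_up (u t) (l t))] ++ s2 t).
Proof.
move=> w1 w2 [pos fl dr].
have sz1 t : size (s1 t) = size v1 by rewrite -(w1 t) size_map.
have sz2 t : size (s2 t) = size v2 by rewrite -(w2 t) size_map.
have u0 t n : 0 < u t n by have /pos_list_mid[_ h _ _] := pos t; exact: h.
have l0 t n : 0 < l t n by have /pos_list_mid[_ _ h _] := pos t; exact: h.
have du n : det_rational X (fun t => u t n).
  apply: det_rational_ext (dr (size v1) n) => t.
  by rewrite nth_mid sz1 ltnn eqxx.
have dl n : det_rational X (fun t => l t n).
  apply: det_rational_ext (dr (size v1).+1 n) => t.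
  by rewrite nth_mid sz1 ltnNge leqnSn /= eqxx gtn_eqF.
split=> [t|m t|k n].
- exact: pos_list_star.
- apply: (flow_star (n1 := size v1) (n2 := size v2)
    (s1 := fun y => s1 (set_time t m y)) (s2 := fun y => s2 (set_time t m y))
    (u := fun y => u (set_time t m y)) (l := fun y => l (set_time t m y))) => //.
  by move=> n; apply/lt0r_neq0/star_up_gt0.
- apply: det_rational_ext (_ : det_rational _ (fun t =>
    if (k < size v1)%N then (nth (dflt R) (s1 t) k).2 n else
    if k == size v1 then star_lo (u t) (l t) n else
    if k == (size v1).+1 then star_up (u t) (l t) n else
    (nth (dflt R) (s2 t) (k - (size v1).+2)).2 n)).
    by move=> t; rewrite nth_mid sz1; do 3?case: ifP => // _.
  have drk := dr k n; have [lk|gk] := ltnP k (size v1).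
    by apply: det_rational_ext drk => t; rewrite nth_mid sz1 lk.
  have [_|n1] := eqVneq k (size v1); first exact: (star_det_rational u0 l0 du dl n).2.
  have [_|n2] := eqVneq k (size v1).+1; first exact: (star_det_rational u0 l0 du dl n).1.
  apply: det_rational_ext drk => t.
  by rewrite nth_mid sz1 ltnNge gk (negbTE n1) (negbTE n2).
Qed.

Lemma selected_family a : cyc_range p q a -> exists s,
  [/\ forall t, map fst (s t) = sigma_min p q, family_inv s &
      forall t, unique (selected_factors alpha beta (multi_time t) a) (map (@to_factor R) (s t))].
Proof.
move=> ca; have rM : (a.-1 <= p + q)%N.
  by move: ca; rewrite /cyc_range => /andP[_]; rewrite /minn; case: ifP; lia.
have wI t : map fst (rot a.-1 (init_factors p q (X t))) =
    rot a.-1 (nseq p true ++ nseq q false) by rewrite map_rot word_init.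
have [s [sw inv r]] := reach_family family_inv_step (sigma_min_reach p0 q0 ca)
  wI (family_inv_init rM).
exists s; split=> // t.
exact (selected_unique (X_tp t) (r t) (sw t)).
Qed.

Hypothesis cpq : coprime p q.
Variable s : ('I_L -> R) -> seq (cfactor R).
Hypotheses (sw : forall t, map fst (s t) = sigma_min p q) (inv : family_inv s).
Let c t := scalar_coef p q (map (@to_factor R) (s t)).

Lemma family_coef_gt0 t h : (p <= h)%N -> 0 < c t h.
Proof.
move=> ph; have [n [k [kM eh]]] := site_cases p0 cpq h.
have szs := size_s (sw t).
have pk : pos_factor (nth (dflt R) (s t) k).
  by case: inv => pos _ _; apply: pos; rewrite szs.
rewrite eh /c (scalar_coefE p0 q0 cpq (sw t)) (f_lower p0 (sw t)) modn_small//.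
case: ifP => kp; last exact: pk.
case: n eh => [|n] eh; last exact: pk.
by move: ph; rewrite eh muln0 add0n leqNgt kp.
Qed.

Lemma family_coef_rational h : det_rational X (fun t => c t h).
Proof.
have [n [k [kM eh]]] := site_cases p0 cpq h; case: inv => _ _ dr.
have E t : c t h = if (step_rem p q k < p)%N then
    (if n is n'.+1 then (nth (dflt R) (s t) k).2 n' else 0)
    else (nth (dflt R) (s t) k).2 n.
  by rewrite eh /c (scalar_coefE p0 q0 cpq (sw t)) (f_lower p0 (sw t)) modn_small.
apply: det_rational_ext (fun t => esym (E t)) _; case: (_ < p)%N; last exact: dr.
by case: (n) => [|n']; [exact: det_rational0|exact: dr].
Qed.

Lemma family_flow l t j h :
  is_partial l (fun t => scalar_lax p q (c t) j h) t (scalar_flow p q l.+1 (c t) j h).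
Proof.
case: inv => _ fl _.
have := @flow_scalar R p q p0 q0 cpq (fun y => s (set_time t l y)) l.+1 (t l)
  (fun y => sw _) (fl l t) j h.
by rewrite /= set_timeK.
Qed.

(** The flows commute because they differentiate rational functions of the
    moments, whose mixed partial derivatives agree. *)
Lemma family_commute (l m : 'I_L) t j h : exists v,
  is_partial m (fun t => scalar_flow p q l.+1 (c t) j h) t v /\
  is_partial l (fun t => scalar_flow p q m.+1 (c t) j h) t v.
Proof.
have sl t' : step_line p q (X t') by exact: pineiro_step_line.
have : C2sym (fun t => scalar_lax p q (c t) j h).
  rewrite /scalar_lax; apply: C2_add; first exact: C2_cst.
  case: eqP => _; last exact: C2_cst.
  case: h => h; last exact: C2_cst.
  exact (det_rational_C2 (C2_X X_partial) (family_coef_rational h)).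
move=> [g [d [gd dd ds]]].
have gE l' : g l' = fun t => scalar_flow p q l'.+1 (c t) j h.
  by apply/funext => t'; exact: der_unique (gd l' t') (family_flow l' t' j h).
by exists (d l m t); split; [have := dd l m t|have := dd m l t; rewrite ds]; rewrite gE.
Qed.

Lemma cyclic_productE s' r : cyclic_product (map (@to_factor R) s') r = cyc s' r.-1.
Proof.
rewrite /cyclic_product -map_rot -map_comp /cyc /lprod.
by congr iprod; apply: eq_map => f; exact: factor_mxE.
Qed.

Lemma family_cyclic l t r i j : (1 <= r <= p + q)%N ->
  is_partial l (fun t => cyclic_product (map (@to_factor R) (s t)) r i j) t
    (lax (mpow (cyc (s t) r.-1) l.+1) (mpow (cyc (s t) r.-1) l.+1) (cyc (s t) r.-1) i j).
Proof.
move=> /andP[_ rM]; case: inv => _ fl _.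
have k1 : (r.-1 <= size (sigma_min p q))%N.
  by rewrite size_sigma_min (leq_trans (leq_pred r)).
have := der_cyc (s := fun y => s (set_time t l y)) (fun y => sw _) (fl l t) k1 i j.
by rewrite set_timeK; apply: der_ext => y; rewrite cyclic_productE.
Qed.

End Family.
End Selected.

Theorem theorem9p7 (R : realType) (p q : nat)
    (alpha : p.-tuple R) (beta : q.-tuple R) :
  (1 <= p)%N -> (1 <= q)%N ->
  sorted <%R alpha -> alpha`_p.-1 < alpha`_0 + 1 ->
  sorted <%R beta -> beta`_q.-1 < beta`_0 + 1 ->
  0 < alpha`_0 + beta`_0 + 1 ->
  (forall t : R,
    [/\ forall r s,
          let z := xnode beta r + ynode alpha s in
          pineiro_moment alpha beta (first_time t) r s =
            \int[lebesgue_measure]_(x in `]0, 1[) (x `^ (z - 1) * expR (t * x)) /\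
          pineiro_moment alpha beta (first_time t) r s =
            z^-1 * kummer z (z + 1) t,
        totally_positive (pineiro_moment alpha beta (first_time t)),
        forall b a, (b <= q)%N -> (a <= p)%N ->
          exists2 D, unique (gauss_borel (vertex_moment alpha beta (first_time t) b a)) D
                   & gb_positive D,
        forall b a, (b <= q)%N -> (a < p)%N ->
          exists2 X, unique (christoffel_lower alpha beta (first_time t) b a) X
                   & normalized_pos_lower X &
        forall b a, (b < q)%N -> (a <= p)%N ->
          exists2 X, unique (christoffel_upper alpha beta (first_time t) b a) X
                   & normalized_pos_upper X]) /\
  (coprime p q ->
    (forall a, cyc_range p q a ->
      exists F : R -> seq (bidiag_factor R),
        let c := fun t h => scalar_coef p q (F t) h in
        [/\ forall t, unique (selected_factors alpha beta (first_time t) a) (F t) /\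
              (forall k, (k < p + q)%N ->
                 normalized_pos_factor (nth (Lower (imx1 R)) (F t) k)),
            (forall t h, (p <= h)%N -> 0 < c t h) /\
            (forall t j h,
               is_derive t (1 : R) (fun s : R => scalar_lax p q (c s) j h)
                 (scalar_flow p q 1 (c t) j h)),
            forall r, (1 <= r <= p + q)%N -> forall t i j,
              is_derive t (1 : R) (fun s : R => cyclic_product (F s) r i j)
                (icomm (iupper (cyclic_product (F t) r)) (cyclic_product (F t) r) i j),
            forall h, det_rational
              (fun t => pineiro_moment alpha beta (first_time t))
              (fun t => c t h) &
            (exists2 F0, unique (selected_factors alpha beta (fun=> 1) a) F0
                       & forall h, c 0 h = scalar_coef p q F0 h) /\
            (tval alpha = [:: - (3%:R)^-1; 0; (3%:R)^-1] ->
             tval beta = [:: 0; (3%:R)^-1] ->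
             forall h, exists x : rat, c 0 h = ratr x)]) /\
    (forall (L : nat) a, cyc_range p q a ->
      exists F : ('I_L -> R) -> seq (bidiag_factor R),
        let c := fun t h => scalar_coef p q (F t) h in
        [/\ forall t, unique (selected_factors alpha beta (multi_time t) a) (F t),
            forall t h, (p <= h)%N -> 0 < c t h,
            forall (l : 'I_L) t j h,
              is_partial l (fun t' => scalar_lax p q (c t') j h) t
                (scalar_flow p q l.+1 (c t) j h) &
            forall (l m : 'I_L) t j h, exists v,
              is_partial m (fun t' => scalar_flow p q l.+1 (c t') j h) t v /\
              is_partial l (fun t' => scalar_flow p q m.+1 (c t') j h) t v])).
Proof.
move=> p0 q0 sa ra sb rb ab0.
have tpw (w : R -> R) : continuous w -> (forall x, 0 < w x) -> totally_positive (pineiro_moment alpha beta w).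
  by move=> cw w0; exact: (pineiro_tp p0 q0 sa ra sb rb ab0 cw w0).
have tp1 t : totally_positive (pineiro_moment alpha beta (first_time t)).
  by rewrite -multi_time1; apply: tpw; [exact: continuous_multi_time|exact: multi_time_gt0].
have z0 r s := node_gt0 p0 q0 sa ra sb rb ab0 r s.
split; [move=> t|move=> cpq].
  split; [|exact: tp1|..].
  - move=> r s z; rewrite pineiro_momentE//; split; first by [].
    exact: mom_kummer.
  - move=> b a _ _; have [u pD] := gauss_borel_vertex p0 q0 (tp1 t) b a.
    by exists (gb_of (vertex (pineiro_moment alpha beta (first_time t)) b a)).
  - move=> b a _ _; have [u pX] := lower_connection p0 q0 (tp1 t) b a.
    by eexists; [exact: u|exact: pX].
  - move=> b a _ _; have [u pX] := upper_connection p0 q0 (tp1 t) b a.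
    by eexists; [exact: u|exact: pX].
split=> [a ca|L a ca]; last first.
  have [s [sw inv u]] := selected_family p0 q0 sa ra sb rb ab0 L ca.
  exists (fun t => map (@to_factor R) (s t)); split=> //.
  - by move=> t h ph; exact: (family_coef_gt0 p0 q0 cpq sw inv).
  - by move=> l t j h; exact: (family_flow p0 q0 cpq sw inv).
  - by move=> l m t j h; exact: (family_commute p0 q0 sa ra sb rb ab0 cpq sw inv).
have [s [sw inv u]] := selected_family p0 q0 sa ra sb rb ab0 1 ca.
(* the first time is the only time of the family with a single time *)
pose ct (t : R) : 'I_1 -> R := fun=> t.
have ctE t y : set_time (ct t) ord0 y = ct y.
  by apply/funext => m; rewrite /set_time ord1 eqxx.
have XE t : pineiro_moment alpha beta (multi_time (ct t)) = pineiro_moment alpha beta (first_time t).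
  by rewrite multi_time1.
have coef_dr h : det_rational (fun t => pineiro_moment alpha beta (first_time t))
    (fun t => scalar_coef p q (map (@to_factor R) (s (ct t))) h).
  have d := det_rational_comp ct (family_coef_rational p0 q0 cpq sw inv h).
  exact (eq_ind _ (fun Z => det_rational Z _) d _ (funext XE)).
exists (fun t => map (@to_factor R) (s (ct t))); split.
- move=> t; split; first by rewrite -multi_time1; exact: u.
  move=> k kM; have szs := size_s (sw (ct t)).
  rewrite (nth_map (dflt R)) ?szs//; apply: pos_to_factor.
  by case: inv => pos _ _; apply: pos; rewrite szs.
- split=> [t h ph|t j h]; first exact: (family_coef_gt0 p0 q0 cpq sw inv).
  have := family_flow p0 q0 cpq sw inv ord0 (ct t) j h.
  by apply: der_ext => y; rewrite ctE.
- move=> r rM t i j; have := family_cyclic sw inv ord0 (ct t) i j rM.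
  rewrite /= imulm1 /lax.
  have -> : cyclic_product (map (@to_factor R) (s (ct t))) r = cyc (s (ct t)) r.-1.
    by rewrite cyclic_productE.
  by apply: der_ext => y; rewrite ctE.
- exact: coef_dr.
split.
  exists (map (@to_factor R) (s (ct 0))) => //.
  by rewrite -first_time0 -multi_time1; exact: u.
move=> ea eb h; apply: ratr_closed_det (coef_dr h) => r k.
rewrite pineiro_momentE//.
have rn n (t : n.-tuple R) m : (forall i, exists x : rat, t`_i = ratr x) ->
    exists x : rat, (m %/ n)%:R + t`_(m %% n) = ratr x.
  by move=> /(_ (m %% n)%N)[x ->]; exists ((m %/ n)%:R + x); rewrite rmorphD rmorph_nat.
have third : (3%:R)^-1 = ratr (3%:R)^-1 :> R by rewrite [RHS]fmorphV rmorph_nat.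
have [x xE] : exists x : rat, xnode beta r = ratr x.
  apply: rn => i; rewrite eb; case: i => [|[|i]] /=; last by exists 0; rewrite nth_nil rmorph0.
    by exists 0; rewrite rmorph0.
  by eexists; exact: third.
have [y yE] : exists y : rat, ynode alpha k = ratr y.
  have [|y yE] := rn p alpha k.
    move=> i; rewrite ea; case: i => [|[|[|i]]] /=.
    - by exists (- (3%:R)^-1); rewrite rmorphN /= third.
    - by exists 0; rewrite rmorph0.
    - by eexists; exact: third.
    - by exists 0; rewrite nth_nil rmorph0.
  by exists (y + 1); rewrite /ynode yE rmorphD rmorph1.
exists (x + y)^-1; rewrite fmorphV rmorphD /= -xE -yE.
rewrite -(powR_unit (z0 r k)).2; apply: umean_ext => v _ _.
by rewrite first_time0 mulr1.
Qed.
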